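(* Let $G$ be a locally compact group and let $\alpha: L^1(G)\to L^1(G)$ be a continuous algebra homomorphism. If $T$ is a bounded Jordan left $\alpha$-centralizer on $L^1(G)$, then there exists $\mu\in M(G)$ such that $T(\varphi)=\mu*\alpha(\varphi)$ for all $\varphi\in L^1(G)$.
   Context: $L^1(G)$ is the group algebra of $G$ (with respect to a left Haar measure, with convolution product), and $M(G)=C_0(G)^*$ is the measure algebra of $G$, where $C_0(G)$ is the space of complex-valued continuous functions on $G$ vanishing at infinity. The convolution of $\mu,\nu\in M(G)$ is given by $(\mu*\nu)(f)=\int_G\int_G f(xy)\,d\mu(x)\,d\nu(y)$ for $f\in C_0(G)$; $L^1(G)$ is regarded as a closed ideal of $M(G)$. An additive map $T:L^1(G)\to L^1(G)$ is called a Jordan left $\alpha$-centralizer if $T(\varphi*\varphi)=T(\varphi)*\alpha(\varphi)$ for all $\varphi\in L^1(G)$. It is bounded if there is $C\ge 0$ with $\|T(\varphi)\|_1\le C\|\varphi\|_1$ for all $\varphi\in L^1(G)$. *)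

(* Defs.v *)
From HB Require Import structures.
From mathcomp Require Import all_boot all_order all_algebra.
From mathcomp Require Import generic_quotient ring_quotient complex.
From mathcomp Require Import all_classical all_reals all_analysis.
From mathcomp Require Import measurable_realfun.

Set Implicit Arguments.
Unset Strict Implicit.
Unset Printing Implicit Defensive.

Import Order.TTheory GRing.Theory Num.Theory.
Import numFieldNormedType.Exports.
Import ComplexField.Normc.

Local Open Scope classical_set_scope.
Local Open Scope ring_scope.

HB.mixin Record isTopologicalGroup G & Group G & Topological G := {
  mulg_continuous : continuous (fun p : G * G => (p.1 * p.2)%g) ;
  invg_continuous : continuous (fun x : G => (x^-1)%g)
}.

(* The distinguished point is arbitrary: it is only there because the
   library builds generated sigma-algebras on pointed types. *)
#[short(type="topologicalGroupType")]
HB.structure Definition TopologicalGroup :=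
  {G of Group G & PointedTopological G & isTopologicalGroup G}.

Section complex_norm.
Variable R : realType.
Implicit Types z w : R[i].

Lemma normcE z : `|z| = (normc z)%:C%C.
Proof. by []. Qed.

Lemma normc_ge0 z : 0 <= normc z.
Proof. by case: z => a b; exact: sqrtr_ge0. Qed.

Lemma ler_normcD z w : normc (z + w) <= normc z + normc w.
Proof. by rewrite -lecR rmorphD/= -!normcE ler_normD. Qed.

Lemma normc_le z : normc z <= `|complex.Re z| + `|complex.Im z|.
Proof.
case: z => a b /=; rewrite -ler_sqr ?nnegrE ?sqrtr_ge0 ?addr_ge0//.
rewrite sqr_sqrtr ?addr_ge0 ?sqr_ge0// sqrrD !real_normK ?num_real//.
by rewrite -addrA lerD2l lerDr mulrn_wge0// mulr_ge0.
Qed.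

Lemma normc_continuous : continuous (@normc R : R[i]^o -> R).
Proof.
move=> z; apply/(@cvgrPdist_lt _ _ _ (nbhs (z : R[i]^o))) => e e0.
have e0C : (0 : R[i]) < e%:C%C by rewrite ltcR.
apply/nbhs_ballP; exists e%:C%C => //= w.
rewrite -ball_normE/= normcE ltcR; apply: le_lt_trans.
rewrite ler_norml; apply/andP; split.
  rewrite lerNl opprB lerBlDr.
  have -> : normc (z - w) = normc (w - z).
    by apply: (@complexI R); rewrite -!normcE distrC.
  by apply: le_trans (ler_normcD _ _); rewrite subrK.
by rewrite lerBlDr; apply: le_trans (ler_normcD _ _); rewrite subrK.
Qed.

End complex_norm.

Section L1.
Context d (T : measurableType d) (R : realType).
Variable m : {measure set T -> \bar R}.
Local Notation C := (R[i]^o).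

Definition Cintegrable (f : T -> C) :=
  m.-integrable setT (EFin \o (@complex.Re R \o f)) /\
  m.-integrable setT (EFin \o (@complex.Im R \o f)).

Definition Cintegral (f : T -> C) : C :=
  Complex (\int[m]_x complex.Re (f x)) (\int[m]_x complex.Im (f x)).

Lemma Cintegrable_normc (f : T -> C) :
  Cintegrable f -> m.-integrable setT (EFin \o (@normc R \o f)).
Proof.
move=> [fr fi].
have mr : measurable_fun setT (@complex.Re R \o f).
  by apply/measurable_EFinP; exact: measurable_int fr.
have mi : measurable_fun setT (@complex.Im R \o f).
  by apply/measurable_EFinP; exact: measurable_int fi.
apply: (@le_integrable _ _ _ _ _ _ _
  (fun x => (`|complex.Re (f x)| + `|complex.Im (f x)|)%:E)) => //.
- apply/measurable_EFinP.
  rewrite (_ : _ \o _ = Num.sqrt \o (fun x => (complex.Re (f x)) ^+ 2 +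
      (complex.Im (f x)) ^+ 2)); last first.
    by apply/funext => x /=; case: (f x).
  apply: (@measurableT_comp _ _ _ _ _ _ (@Num.sqrt R)).
    by apply: continuous_measurable_fun; exact: sqrt_continuous.
  by apply: measurable_funD; exact: measurable_funX.
- move=> x _; rewrite !abse_EFin lee_fin [leLHS]ger0_norm; last exact: normc_ge0.
  by apply: le_trans (normc_le _) _; exact: ler_norm.
- apply: (@eq_integrable _ _ _ _ _ measurableT
      ((abse \o (EFin \o (@complex.Re R \o f))) \+
       (abse \o (EFin \o (@complex.Im R \o f))))%E) => //.
  by apply: integrableD => //; exact: integrable_abse.
Qed.

Definition L1pred : {pred T -> C} := mem [set f | Cintegrable f].

Lemma L1pred_submod_closed : submod_closed L1pred.
Proof.
split.
  rewrite inE; split; rewrite (_ : _ \o _ = cst 0%E)//; exact: integrable0.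
move=> a f g; rewrite !inE => -[fr fi] [gr gi]; split.
- rewrite (_ : _ \o _ = (fun x => (complex.Re a)%:E *
      (complex.Re (f x))%:E - (complex.Im a)%:E * (complex.Im (f x))%:E)
      \+ (EFin \o (@complex.Re R \o g)))%E; last first.
    apply/funext => x /=; rewrite !fctE -!EFinM -EFinB -EFinD; congr EFin.
    by case: a (f x) (g x) => [a1 a2] [b1 b2] [c1 c2].
  apply: integrableD => //; apply: integrableB => //; exact: integrableZl.
- rewrite (_ : _ \o _ = (fun x => (complex.Re a)%:E *
      (complex.Im (f x))%:E + (complex.Im a)%:E * (complex.Re (f x))%:E)
      \+ (EFin \o (@complex.Im R \o g)))%E; last first.
    apply/funext => x /=; rewrite !fctE -!EFinM -!EFinD; congr EFin.
    by case: a (f x) (g x) => [a1 a2] [b1 b2] [c1 c2].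
  apply: integrableD => //; apply: integrableD => //; exact: integrableZl.
Qed.

HB.instance Definition _ := GRing.isSubmodClosed.Build _ _ L1pred
  L1pred_submod_closed.

Record integrable_fun := IntegrableFun {
  integrable_val :> T -> C ; _ : integrable_val \in L1pred }.

HB.instance Definition _ := [isSub for integrable_val].
HB.instance Definition _ := [Choice of integrable_fun by <:].
HB.instance Definition _ := [SubChoice_isSubLmodule of integrable_fun by <:].

Lemma integrable_funP (f : integrable_fun) : Cintegrable f.
Proof. by have := valP f; rewrite inE. Qed.

Definition ae0 : {pred integrable_fun} :=
  mem [set f : integrable_fun | {ae m, forall x, f x = 0}].

Lemma ae0_submod_closed : submod_closed ae0.
Proof.
split; first by rewrite inE; apply: aeW.
move=> a f g; rewrite !inE => f0 g0; apply: filterS2 f0 g0 => x /=.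
by rewrite !fctE => -> ->; rewrite scaler0 addr0.
Qed.

HB.instance Definition _ := GRing.isSubmodClosed.Build _ _ ae0
  ae0_submod_closed.

Definition L1 := Quotient.quot ae0.
HB.instance Definition _ := GRing.Zmodule.on L1.
HB.instance Definition _ := EqQuotient.on L1.

Definition L1_fun (phi : L1) : T -> C := repr phi.
Coercion L1_fun : L1 >-> Funclass.

Local Open Scope quotient_scope.

Lemma L1_piP (f g : integrable_fun) :
  (\pi_L1 f = \pi_L1 g) <-> {ae m, forall x, f x = g x}.
Proof.
split=> [/eqP|fg].
  rewrite -Quotient.idealrBE inE; apply: filterS => x /=.
  by rewrite !fctE => /eqP; rewrite subr_eq0 => /eqP.
apply/eqP; rewrite -Quotient.idealrBE inE.
by apply: filterS fg => x /=; rewrite !fctE => ->; rewrite subrr.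
Qed.

Lemma ae_eq_Rintegral (f g : T -> R) :
  m.-integrable setT (EFin \o f) -> m.-integrable setT (EFin \o g) ->
  {ae m, forall x, f x = g x} -> \int[m]_x f x = \int[m]_x g x.
Proof.
move=> fi gi fg; congr fine; apply: ae_eq_integral => //.
- exact: measurable_int fi.
- exact: measurable_int gi.
- by apply: filterS fg => x /= -> _.
Qed.

Definition L1_norm (phi : L1) : R[i] := (\int[m]_x normc (phi x))%:C%C.

Lemma L1_piD (f g : integrable_fun) :
  \pi_L1 (f + g) = (\pi_L1 f + \pi_L1 g : L1).
Proof. exact: Quotient.pi_add. Qed.

Lemma L1_reprD (phi psi : L1) :
  {ae m, forall x, (phi + psi : L1) x = phi x + psi x}.
Proof.
have /L1_piP : \pi_L1 (repr (phi + psi)) = \pi_L1 (repr phi + repr psi).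
  by rewrite L1_piD !reprK.
exact: filterS.
Qed.

Lemma Cintegrable_L1 (phi : L1) : Cintegrable phi.
Proof. exact: integrable_funP. Qed.

Lemma L1_normD (phi psi : L1) : L1_norm (phi + psi) <= L1_norm phi + L1_norm psi.
Proof.
rewrite /L1_norm -rmorphD/= lecR -RintegralD//; last 2 first.
- exact/Cintegrable_normc/Cintegrable_L1.
- exact/Cintegrable_normc/Cintegrable_L1.
have fpi := Cintegrable_normc (Cintegrable_L1 phi).
have gpi := Cintegrable_normc (Cintegrable_L1 psi).
have sum_int : Cintegrable (repr phi + repr psi) by exact: integrable_funP.
rewrite (@ae_eq_Rintegral _ (fun x => normc (phi x + psi x))).
- apply: le_Rintegral => //.
  + exact: Cintegrable_normc sum_int.
  + by have := integrableD measurableT fpi gpi.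
  + by move=> x _; exact: ler_normcD.
- exact/Cintegrable_normc/Cintegrable_L1.
- exact: Cintegrable_normc sum_int.
- by apply: filterS (L1_reprD phi psi) => x ->.
Qed.

Definition L1_scale (a : C) (phi : L1) : L1 := \pi_L1 (a *: repr phi).

Lemma L1_scale_pi a f : L1_scale a (\pi_L1 f) = \pi_L1 (a *: f).
Proof.
apply/L1_piP; have /L1_piP : \pi_L1 (repr (\pi_L1 f)) = \pi_L1 f.
  by rewrite reprK.
by apply: filterS => x /=; rewrite !fctE => ->.
Qed.

Lemma L1_scaleA a b phi : L1_scale a (L1_scale b phi) = L1_scale (a * b) phi.
Proof. by rewrite {2}/L1_scale L1_scale_pi scalerA. Qed.

Lemma L1_scale1 : left_id 1 L1_scale.
Proof. by move=> phi; rewrite /L1_scale scale1r reprK. Qed.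

Lemma L1_scaleDr : right_distributive L1_scale +%R.
Proof.
move=> a phi psi; rewrite -[phi]reprK -[psi]reprK -L1_piD.
by rewrite !L1_scale_pi scalerDr L1_piD.
Qed.

Lemma L1_scaleDl (phi : L1) : {morph L1_scale^~ phi : a b / a + b}.
Proof. by move=> a b; rewrite /L1_scale scalerDl L1_piD. Qed.

HB.instance Definition _ := GRing.Zmodule_isLmodule.Build C L1
  L1_scaleA L1_scale1 L1_scaleDr L1_scaleDl.

Lemma L1_reprZ (a : C) (phi : L1) : {ae m, forall x, (a *: phi : L1) x = a * phi x}.
Proof.
have /L1_piP : \pi_L1 (repr (a *: phi)) = \pi_L1 (a *: repr phi).
  by rewrite reprK.
exact: filterS.
Qed.

Lemma L1_normZ (a : C) (phi : L1) : L1_norm (a *: phi) = `|a| * L1_norm phi.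
Proof.
rewrite /L1_norm normcE -rmorphM/=; congr (_ %:C)%C.
rewrite -RintegralZl//; last exact/Cintegrable_normc/Cintegrable_L1.
have aphi : Cintegrable (a *: repr phi) by exact: integrable_funP.
rewrite (@ae_eq_Rintegral _ (fun x => normc (a * phi x))).
- by apply: eq_Rintegral => x _; rewrite normcM.
- exact/Cintegrable_normc/Cintegrable_L1.
- exact: Cintegrable_normc aphi.
- by apply: filterS (L1_reprZ a phi) => x ->.
Qed.

Lemma L1_norm_eq0 (phi : L1) : L1_norm phi = 0 -> phi = 0.
Proof.
move=> [] phi0.
have phii := Cintegrable_normc (Cintegrable_L1 phi).
have zero0 : {ae m, forall x, repr (0 : L1) x = 0}.
  have /L1_piP : \pi_L1 (repr (0 : L1)) = \pi_L1 0.
    by rewrite reprK; apply/(addrI (\pi_L1 0)); rewrite -L1_piD !addr0.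
  exact: filterS.
rewrite -[phi]reprK -[RHS]reprK; apply/L1_piP.
have : (\int[m]_x `|(normc (phi x))%:E| = 0)%E.
  rewrite -[RHS]/(0%R%:E) -phi0 fineK ?integrable_fin_num//.
  by apply: eq_integral => x _; rewrite abse_EFin ger0_norm ?normc_ge0.
move/(ae_eq_integral_abs m measurableT (measurable_int _ phii)).
apply: filterS2 zero0 => x -> /(_ I)/= [] /eq0_normc; exact.
Qed.

HB.instance Definition _ := Lmodule_isNormed.Build C L1
  L1_normD L1_normZ L1_norm_eq0.

End L1.

Section C0.
Context (X : ptopologicalType) (R : realType).
Local Notation C := (R[i]^o).

Definition vanishing_at_infinity (f : X -> C) :=
  forall e : R, 0 < e ->
    exists2 K : set X, compact K & forall x, ~ K x -> normc (f x) < e.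

Definition C0pred : {pred X -> C} :=
  mem [set f | continuous f /\ vanishing_at_infinity f].

Lemma C0pred_submod_closed : submod_closed C0pred.
Proof.
split.
  rewrite inE; split; first by move=> x; exact: cvg_cst.
  by move=> e e0; exists set0 => [|x _]; [exact: compact0|rewrite normc0].
move=> a f g; rewrite !inE => -[fc fv] [gc gv]; split.
  move=> x; apply: cvgD; last exact: gc.
  by apply: cvgZr; exact: fc.
move=> e e0.
have a1 : 0 < normc a + 1 by rewrite ltr_wpDl ?normc_ge0.
have [K cK Kf] := fv (e / 2 / (normc a + 1)) ltac:(by rewrite !divr_gt0).
have [L cL Lg] := gv (e / 2) ltac:(by rewrite divr_gt0).
exists (K `|` L); first exact: compactU.
move=> x /not_orP[/Kf Kx /Lg Lx]; rewrite !fctE.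
apply: le_lt_trans (ler_normcD _ _) _; rewrite [e]splitr.
apply: ler_ltD => //; rewrite normcM.
apply: (@le_trans _ _ ((normc a + 1) * normc (f x))).
  by rewrite ler_wpM2r ?normc_ge0// lerDl.
by rewrite mulrC -ler_pdivlMr// ltW.
Qed.

HB.instance Definition _ := GRing.isSubmodClosed.Build _ _ C0pred
  C0pred_submod_closed.

Record C0 := MkC0 { C0_val :> X -> C ; _ : C0_val \in C0pred }.

HB.instance Definition _ := [isSub for C0_val].
HB.instance Definition _ := [Choice of C0 by <:].
HB.instance Definition _ := [SubChoice_isSubLmodule of C0 by <:].

Definition C0_sup (f : C0) : R := sup (range (fun x => normc (f x))).

Lemma C0_has_sup (f : C0) : has_sup (range (fun x => normc (f x))).
Proof.
split; first by exists (normc (f point)); exists point.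
have := valP f; rewrite inE => -[fc /(_ 1 ltr01)[K cK Kf]].
have /compact_bounded : compact ((@normc R \o f) @` K).
  apply: continuous_compact => //; apply: continuous_subspaceT => x.
  by apply: continuous_comp; [exact: fc|exact: normc_continuous].
move=> [M [_ MK]]; exists (Num.max 1 (M + 1)) => _ [x _ <-].
rewrite le_max; have [Kx|/Kf/ltW ->//] := pselect (K x).
apply/orP; right; apply: le_trans (ler_norm _) _.
by apply: (MK (M + 1)); [rewrite ltrDl|exists x].
Qed.

Lemma C0_supP (f : C0) x : normc (f x) <= C0_sup f.
Proof. by apply: ub_le_sup; [case: (C0_has_sup f)|exists x]. Qed.

Definition C0_norm (f : C0) : R[i] := (C0_sup f)%:C%C.

Lemma C0_normD f g : C0_norm (f + g) <= C0_norm f + C0_norm g.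
Proof.
rewrite /C0_norm -rmorphD/= lecR; apply: ge_sup.
  by case: (C0_has_sup (f + g)).
move=> _ [x _ <-]; apply: le_trans (ler_normcD _ _) _.
by apply: lerD; exact: C0_supP.
Qed.

Lemma C0_sup_ge0 f : 0 <= C0_sup f.
Proof. exact: le_trans (normc_ge0 _) (C0_supP f point). Qed.

Lemma C0_norm_eq0 f : C0_norm f = 0 -> f = 0.
Proof.
move=> [] f0; apply/val_inj/funext => x /=; apply: eq0_normc.
by apply/eqP; rewrite eq_le normc_ge0 -f0 C0_supP.
Qed.

Lemma C0_normZ_le (a : C) f : C0_sup (a *: f) <= normc a * C0_sup f.
Proof.
apply: ge_sup; first by case: (C0_has_sup (a *: f)).
move=> _ [x _ <-] /=; rewrite fctE normcM.
by rewrite ler_wpM2l ?normc_ge0// C0_supP.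
Qed.

Lemma C0_normZ (a : C) f : C0_norm (a *: f) = `|a| * C0_norm f.
Proof.
rewrite /C0_norm normcE -rmorphM/=; congr (_ %:C)%C.
apply/eqP; rewrite eq_le C0_normZ_le/=.
have [->|a0] := eqVneq a 0; first by rewrite normc0 mul0r C0_sup_ge0.
have na0 : 0 < normc a.
  rewrite lt_neqAle normc_ge0 andbT eq_sym.
  by apply: contra a0 => /eqP/eq0_normc ->.
rewrite -ler_pdivlMl// -normcV.
by apply: le_trans (C0_normZ_le _ _); rewrite scalerA mulVf// scale1r.
Qed.

HB.instance Definition _ := Lmodule_isNormed.Build C C0
  C0_normD C0_normZ C0_norm_eq0.

End C0.

Notation borel G := (g_sigma_algebraType (@open G)).

Section group_algebra.
Context (G : topologicalGroupType) (R : realType).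
Local Notation C := (R[i]^o).

(* A nonzero left-invariant Radon measure. *)
Record left_haar (m : {measure set (borel G) -> \bar R}) : Prop := LeftHaar {
  haar_neq0 : (m setT != 0)%E ;
  haar_compact : forall K : set G, compact K -> (m K < +oo)%E ;
  haar_outer : forall A : set (borel G), measurable A ->
    m A = ereal_inf [set m U | U in [set U : set G | open U /\ A `<=` U]] ;
  haar_inner : forall U : set G, open U ->
    m U = ereal_sup [set m K | K in [set K : set G | compact K /\ K `<=` U]] ;
  haar_left : forall (x : G) (A : set (borel G)), measurable A ->
    m [set (x * y)%g | y in A] = m A
}.

Variable m : {measure set (borel G) -> \bar R}.

(* The class of x |-> \int phi(y) psi(y^-1 x) dy. For a left Haar measure on
   a locally compact group this integral converges for almost every x and
   defines an integrable function, so the default value 0 is not used. *)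
Definition L1_conv (phi psi : L1 m) : L1 m :=
  xget 0 [set h : L1 m | {ae m, forall x : borel G,
    h x = Cintegral m (fun y : G => phi y * psi (y^-1 * x)%g)}].

Definition jordan_left_centralizer (alpha T : L1 m -> L1 m) :=
  forall phi, T (L1_conv phi phi) = L1_conv (T phi) (alpha phi).

(* M(G), the dual of C_0(G): mu f stands for the integral of f against mu. *)
Record measure_algebra := MeasureAlgebra {
  measure_fun :> {linear C0 G R -> C} ;
  measure_continuous : continuous measure_fun
}.

(* f as an element of C_0(G), and 0 if f is not in C_0(G). *)
Definition to_C0 (f : G -> C) : C0 G R := insubd 0 f.

(* (mu * nu)(f) = \int \int f(x y) dmu(x) dnu(y). On a locally compact
   Hausdorff group, both arguments of [to_C0] are in C_0(G) when mu is in
   M(G). *)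
Definition M_conv (mu nu : C0 G R -> C) : C0 G R -> C := fun f =>
  nu (to_C0 (fun y => mu (to_C0 (fun x => f (x * y)%g)))).

(* L^1(G) inside M(G): the functional of the measure phi dm. *)
Definition L1_to_M (phi : L1 m) : C0 G R -> C := fun f =>
  Cintegral m (fun x : G => f x * phi x).

End group_algebra.

(* Main.v *)
(** Let mu be a weak-* cluster point, in the dual of C_0(G), of the bounded
    family T(e), where e runs through an approximate unit of L^1(G). Polarizing
    T(phi * phi) = T(phi) * alpha(phi) gives
      T(phi * e + e * phi) = T(phi) * alpha(e) + T(e) * alpha(phi).
    Multiplied on the right by alpha(psi), this becomes in the limit
      2 T(phi) * alpha(psi) = T(phi) * alpha(psi) + mu * alpha(phi * psi),
    that is T(phi) * alpha(psi) = mu * alpha(phi * psi). For psi = e this turns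
    the polarized identity into 2 T(phi) = mu * alpha(phi) + mu * alpha(phi).

    These are identities of functionals on C_0(G), where the functional of
    phi * psi sends f to the value of phi at x |-> \int f(x y) psi(y) dy.
    Since G need not be sigma-compact and the Borel sets of G x G are not those
    of the product sigma-algebra, Fubini's theorem does not apply. It is
    replaced by the fact that a bounded functional on C_0(G) commutes with the
    integral of a norm-continuous C_0(G)-valued function against an L^1
    function. The convolution of phi and psi in L^1(G) is then the limit of the
    convolutions of truncations of phi to compact sets with C_c functions that
    approximate psi. *)

Require Import Defs.
From HB Require Import structures.
From mathcomp Require Import all_boot all_order all_algebra.
From mathcomp Require Import generic_quotient complex.
From mathcomp Require Import all_classical all_reals all_analysis.
From mathcomp Require Import measurable_realfun lra ring.

Set Implicit Arguments.
Unset Strict Implicit.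
Unset Printing Implicit Defensive.

Import Order.TTheory GRing.Theory Num.Theory.
Import numFieldNormedType.Exports.
Import ComplexField.Normc.

Local Open Scope classical_set_scope.
Local Open Scope ring_scope.

(** * Integration of complex-valued functions *)

(** The elements alpha(e) need not act as an approximate unit on L^1(G), so T(phi) * alpha(e) has no
    evident limit. This is why the polarized identity is first multiplied by alpha(psi): the product
    alpha(e) * alpha(psi) = alpha(e * psi) does converge. The identity obtained in this way rewrites
    T(phi) * alpha(e) as mu * alpha(phi * e), whose limit is known, so the factor alpha(psi) never
    has to be cancelled.

    Every product is tested at some f in C_0(G) after its right factor has been moved onto f. Then
    T(e) acts on a test function that does not depend on e, which is all that weak-* convergence can
    control. The cluster point is realized as a limit along an ultrafilter of units, so that one
    choice serves every f.

    Inversion need not preserve a left Haar measure. This matters in two places: null sets pulled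
    back by y |-> y^-1 x, which are treated on compact sets, and units acting on the right, which
    are made symmetric. *)

Section complex_numbers.
Variable R : realType.
Local Notation C := (R[i]^o).
Implicit Types z w : C.

Lemma normc_Re z : `|complex.Re z| <= normc z.
Proof.
case: z => a b /=; rewrite -[`|a|]sqrtr_sqr ?real_normK ?num_real//.
by rewrite ler_sqrt ?addr_ge0 ?sqr_ge0// lerDl sqr_ge0.
Qed.

Lemma normc_Im z : `|complex.Im z| <= normc z.
Proof.
case: z => a b /=; rewrite -[`|b|]sqrtr_sqr ?real_normK ?num_real//.
by rewrite ler_sqrt ?addr_ge0 ?sqr_ge0// lerDr sqr_ge0.
Qed.

Lemma normc_real (a : R) : normc (a%:C%C : C) = `|a|.
Proof. by rewrite /= expr0n/= addr0 sqrtr_sqr. Qed.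

Lemma normcN z : normc (- z) = normc z.
Proof. by apply: (@complexI R); rewrite -!Defs.normcE normrN. Qed.

Lemma normcB z w : normc (z - w) = normc (w - z).
Proof. by rewrite -normcN opprB. Qed.

Lemma normc1 : normc (1 : C) = 1.
Proof. by rewrite (normc_real 1) normr1. Qed.

Lemma cvg_normcP {U} {F : set_system U} {FF : Filter F} (f : U -> C) (l : C) :
  f @ F --> l <-> forall e, 0 < e -> \forall t \near F, normc (l - f t) < e.
Proof.
split=> [/cvgrPdist_lt fl e e0|h].
  have e0C : (0 : R[i]) < e%:C%C by rewrite ltcR.
  by apply: filterS (fl _ e0C) => t; rewrite Defs.normcE ltcR.
(* The radius ranges over [R[i]]; being positive there forces its imaginary part [e'] to vanish, so
   real radii suffice. *)
apply/cvgrPdist_lt => -[e e'] e0.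
have e'0 : e' = 0 by move: e0; rewrite ltcE/= => /andP[/eqP].
rewrite e'0 in e0 *; move: e0; rewrite (ltcR 0 e) => e0.
by apply: filterS (h e e0) => t; rewrite Defs.normcE ltcR.
Qed.

Lemma continuous_Re : continuous (@complex.Re R : C -> R).
Proof.
move=> z; apply/(@cvgrPdist_lt _ _ _ (nbhs (z : C))) => e e0.
have /cvg_normcP/(_ e e0) : id @ nbhs z --> z by exact: cvg_id.
apply: filterS => w; apply: le_lt_trans.
by apply: le_trans (normc_Re _); case: (z) (w) => [? ?] [? ?].
Qed.

Lemma continuous_Im : continuous (@complex.Im R : C -> R).
Proof.
move=> z; apply/(@cvgrPdist_lt _ _ _ (nbhs (z : C))) => e e0.
have /cvg_normcP/(_ e e0) : id @ nbhs z --> z by exact: cvg_id.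
apply: filterS => w; apply: le_lt_trans.
by apply: le_trans (normc_Im _); case: (z) (w) => [? ?] [? ?].
Qed.

Lemma continuous_real_complex : continuous (real_complex R : R -> C).
Proof.
move=> a; apply/cvg_normcP => e e0.
have /cvgrPdist_lt/(_ e e0) : id @ nbhs a --> a by exact: cvg_id.
apply: filterS => b.
have -> : a%:C%C - b%:C%C = (a - b)%:C%C :> C by rewrite rmorphB.
by rewrite normc_real.
Qed.

Lemma complexEta z : Complex (complex.Re z) (complex.Im z) = z.
Proof. by case: z. Qed.

Lemma cvg_complexP {U} {F : set_system U} {FF : Filter F} (f : U -> C) (l : C) :
  f @ F --> l <-> complex.Re (f t) @[t --> F] --> complex.Re l /\
    complex.Im (f t) @[t --> F] --> complex.Im l.
Proof.
split=> [fl|[/cvgrPdist_lt fr /cvgrPdist_lt fi]].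
  split.
    exact: (continuous_cvg _ (@continuous_Re l) fl).
  exact: (continuous_cvg _ (@continuous_Im l) fl).
apply/cvg_normcP => e e0.
have e2 : 0 < e / 2 by rewrite divr_gt0.
apply: filterS2 (fr _ e2) (fi _ e2) => t h1 h2.
apply: le_lt_trans (normc_le _) _; rewrite [e]splitr; apply: ltrD.
  by apply: le_lt_trans h1; case: (l) (f t) => [? ?] [? ?].
by apply: le_lt_trans h2; case: (l) (f t) => [? ?] [? ?].
Qed.

Definition conjz z : C := Complex (complex.Re z) (- complex.Im z).

Lemma mul_conjz z : conjz z * z = ((normc z) ^+ 2)%:C%C.
Proof.
case: z => a b; rewrite /conjz/= sqr_sqrtr ?addr_ge0 ?sqr_ge0//.
apply/eqP; rewrite eq_complex /=; apply/andP; split; apply/eqP; ring.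
Qed.

Lemma normc_conjz z : normc (conjz z) = normc z.
Proof. by case: z => a b /=; rewrite sqrrN. Qed.

Lemma ReM z w : complex.Re (z * w) =
  complex.Re z * complex.Re w - complex.Im z * complex.Im w.
Proof. by case: z w => [? ?] [? ?]. Qed.

Lemma ImM z w : complex.Im (z * w) =
  complex.Re z * complex.Im w + complex.Im z * complex.Re w.
Proof. by case: z w => [? ?] [? ?]. Qed.

Lemma ReD z w : complex.Re (z + w) = complex.Re z + complex.Re w.
Proof. by case: z w => [? ?] [? ?]. Qed.

Lemma ImD z w : complex.Im (z + w) = complex.Im z + complex.Im w.
Proof. by case: z w => [? ?] [? ?]. Qed.

Lemma normc_eps0 z (M : R) : (forall e, 0 < e -> normc z <= M * e) -> z = 0.
Proof.
move=> h; apply: eq0_normc; apply/eqP; rewrite eq_le normc_ge0 andbT.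
rewrite leNgt; apply/negP => z0.
have M1 : 0 < `|M| + 1 by rewrite ltr_wpDl.
have := h (normc z / (2 * (`|M| + 1))) ltac:(by rewrite divr_gt0// mulr_gt0).
rewrite leNgt => /negP; apply.
apply: (@le_lt_trans _ _ ((`|M| + 1) * (normc z / (2 * (`|M| + 1))))).
  rewrite ler_wpM2r//; last by apply: le_trans (ler_norm M) _; rewrite lerDl.
  by apply: divr_ge0; [exact: normc_ge0|apply: mulr_ge0 => //; exact: ltW].
by rewrite invfM mulrCA [X in _ * X]mulrCA divff ?gt_eqF// mulr1; lra.
Qed.

End complex_numbers.

(** * Complex integrals and their convergence theorems *)

Section complex_integral.
Context d (T : measurableType d) (R : realType).
Variable m : {measure set T -> \bar R}.
Local Notation C := (R[i]^o).
Local Notation Ri f := (m.-integrable setT (EFin \o f)).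
Implicit Types f g : T -> C.

Definition Cmeas f := measurable_fun setT (@complex.Re R \o f) /\
  measurable_fun setT (@complex.Im R \o f).

Lemma Cintegrable_meas f : Cintegrable m f -> Cmeas f.
Proof. by move=> [fr fi]; split; apply/measurable_EFinP; [exact: measurable_int fr|exact: measurable_int fi]. Qed.

Lemma CmeasD f g : Cmeas f -> Cmeas g -> Cmeas (fun x => f x + g x).
Proof.
move=> [fr fi] [gr gi]; split.
  rewrite (_ : _ \o _ = (@complex.Re R \o f) \+ (@complex.Re R \o g)).
    exact: measurable_funD.
  by apply/funext => x /=; rewrite ReD.
rewrite (_ : _ \o _ = (@complex.Im R \o f) \+ (@complex.Im R \o g)).
  exact: measurable_funD.
by apply/funext => x /=; rewrite ImD.
Qed.

Lemma CmeasM f g : Cmeas f -> Cmeas g -> Cmeas (fun x => f x * g x).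
Proof.
move=> [fr fi] [gr gi]; split.
  rewrite (_ : _ \o _ = ((@complex.Re R \o f) \* (@complex.Re R \o g)) \-
    ((@complex.Im R \o f) \* (@complex.Im R \o g))).
    by apply: measurable_funB; apply: measurable_funM.
  by apply/funext => x /=; rewrite ReM.
rewrite (_ : _ \o _ = ((@complex.Re R \o f) \* (@complex.Im R \o g)) \+
    ((@complex.Im R \o f) \* (@complex.Re R \o g))).
  by apply: measurable_funD; apply: measurable_funM.
by apply/funext => x /=; rewrite ImM.
Qed.

Lemma Cmeas_cst (c : C) : Cmeas (fun=> c).
Proof. by split; exact: measurable_cst. Qed.

Lemma Cmeas_real (f : T -> R) : measurable_fun setT f ->
  Cmeas (fun x => (f x)%:C%C).
Proof. by move=> mf; split => //=; exact: measurable_cst. Qed.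

Lemma Ri_dom (h g : T -> R) : measurable_fun setT h -> Ri g ->
  (forall x, `|h x| <= g x) -> Ri h.
Proof.
move=> mh ig hg; apply: le_integrable ig => //; first exact/measurable_EFinP.
by move=> x _ /=; rewrite lee_fin (le_trans (hg x))// ler_norm.
Qed.

Lemma Cintegrable_dom f (g : T -> R) : Cmeas f -> Ri g ->
  (forall x, normc (f x) <= g x) -> Cintegrable m f.
Proof.
move=> [mr mi] ig fg; split.
  by apply: Ri_dom ig _ => // x; apply: le_trans (normc_Re _) (fg x).
by apply: Ri_dom ig _ => // x; apply: le_trans (normc_Im _) (fg x).
Qed.

Lemma RiD (h g : T -> R) : Ri h -> Ri g -> Ri (fun x => h x + g x).
Proof. by move=> ih ig; have := integrableD measurableT ih ig. Qed.

Lemma RiZ (a : R) (h : T -> R) : Ri h -> Ri (fun x => a * h x).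
Proof. by move=> ih; have := @integrableZl _ _ _ m _ measurableT a _ ih. Qed.

Lemma Ri0 : Ri (fun=> 0).
Proof. exact: integrable0. Qed.

Lemma CintegrableD f g : Cintegrable m f -> Cintegrable m g ->
  Cintegrable m (fun x => f x + g x).
Proof.
move=> fi gi; apply: (@Cintegrable_dom _ (fun x => normc (f x) + normc (g x))).
- by apply: CmeasD; exact: Cintegrable_meas.
- by apply: RiD; exact: Cintegrable_normc.
- by move=> x; exact: ler_normcD.
Qed.

Lemma CintegrableMb (b f : T -> C) (B : R) : Cmeas b ->
  (forall x, normc (b x) <= B) -> Cintegrable m f ->
  Cintegrable m (fun x => b x * f x).
Proof.
move=> mb bB fi; apply: (@Cintegrable_dom _ (fun x => B * normc (f x))).
- by apply: CmeasM => //; exact: Cintegrable_meas.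
- by apply: RiZ; exact: Cintegrable_normc.
- by move=> x; rewrite normcM ler_wpM2r// normc_ge0.
Qed.

Lemma CintegrableZ (c : C) f : Cintegrable m f ->
  Cintegrable m (fun x => c * f x).
Proof. by apply: (@CintegrableMb _ _ (normc c)) => //; exact: Cmeas_cst. Qed.

Lemma Cintegrable_real (h : T -> R) : Ri h -> Cintegrable m (fun x => (h x)%:C%C).
Proof. by move=> ih; split; [exact: ih|exact: Ri0]. Qed.

Lemma Cintegrable0 : Cintegrable m (fun=> 0).
Proof. by split; exact: Ri0. Qed.

Lemma CintegralD f g : Cintegrable m f -> Cintegrable m g ->
  Cintegral m (fun x => f x + g x) = Cintegral m f + Cintegral m g.
Proof.
move=> [fr fi] [gr gi]; rewrite /Cintegral.
under eq_Rintegral do rewrite ReD.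
under [X in Complex _ X]eq_Rintegral do rewrite ImD.
by rewrite !RintegralD.
Qed.

Lemma CintegralZ (c : C) f : Cintegrable m f ->
  Cintegral m (fun x => c * f x) = c * Cintegral m f.
Proof.
move=> [fr fi]; rewrite /Cintegral.
under eq_Rintegral do rewrite ReM.
under [X in Complex _ X]eq_Rintegral do rewrite ImM.
rewrite RintegralB//; [|exact: RiZ|exact: RiZ].
rewrite RintegralD//; [|exact: RiZ|exact: RiZ].
by rewrite !RintegralZl//; case: c.
Qed.

Lemma CintegralB f g : Cintegrable m f -> Cintegrable m g ->
  Cintegral m (fun x => f x - g x) = Cintegral m f - Cintegral m g.
Proof.
move=> fi gi; transitivity (Cintegral m (fun x => f x + (-1) * g x)).
  by congr Cintegral; apply/funext => x; rewrite mulN1r.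
by rewrite CintegralD ?CintegralZ ?mulN1r//; exact: CintegrableZ.
Qed.

Lemma CintegrableB f g : Cintegrable m f -> Cintegrable m g ->
  Cintegrable m (fun x => f x - g x).
Proof.
move=> fi gi; rewrite (_ : (fun x => _) = (fun x => f x + (-1) * g x)).
  by apply: CintegrableD => //; exact: CintegrableZ.
by apply/funext => x; rewrite mulN1r.
Qed.

Lemma Cintegral_real (h : T -> R) :
  Cintegral m (fun x => (h x)%:C%C) = (\int[m]_x h x)%:C%C.
Proof. by rewrite /Cintegral /= Rintegral_cst// mul0r. Qed.

Lemma Cintegral0 : Cintegral m (fun=> 0) = 0.
Proof. by rewrite (Cintegral_real (fun=> 0)) Rintegral_cst// mul0r. Qed.

(** Multiplying by the conjugate of [z] turns the integral into the real number |z|^2, which is then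
    the integral of a real part bounded by |z| |f|. *)
Lemma normc_Cintegral f : Cintegrable m f ->
  normc (Cintegral m f) <= \int[m]_x normc (f x).
Proof.
move=> fi; set z := Cintegral m f.
have [z0|z0] := eqVneq (normc z) 0.
  by rewrite z0; apply: Rintegral_ge0 => x _; exact: normc_ge0.
have zp : 0 < normc z by rewrite lt_neqAle eq_sym z0 normc_ge0.
rewrite -(ler_pM2l zp) -expr2.
have -> : normc z ^+ 2 = complex.Re (conjz z * z) by rewrite mul_conjz.
rewrite -CintegralZ//= -RintegralZl//; last exact: Cintegrable_normc.
apply: le_Rintegral => //.
- by case: (CintegrableZ (conjz z) fi).
- exact/RiZ/Cintegrable_normc.
- move=> x _; apply: le_trans (ler_norm _) _.
  by apply: le_trans (normc_Re _) _; rewrite normcM normc_conjz.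
Qed.

Lemma eq_Cintegral f g : f =1 g -> Cintegral m f = Cintegral m g.
Proof. by move=> /funext ->. Qed.

Lemma ae_eq_Cintegral f g : Cintegrable m f -> Cintegrable m g ->
  {ae m, forall x, f x = g x} -> Cintegral m f = Cintegral m g.
Proof.
move=> [fr fi] [gr gi] fg; rewrite /Cintegral.
congr Complex; apply: ae_eq_Rintegral => //.
  by apply: filterS fg => x ->.
by apply: filterS fg => x ->.
Qed.

Lemma ae_eq_normc f g : Cintegrable m f -> Cintegrable m g ->
  {ae m, forall x, f x = g x} -> \int[m]_x normc (f x) = \int[m]_x normc (g x).
Proof.
move=> fi gi fg; apply: ae_eq_Rintegral.
- exact: Cintegrable_normc.
- exact: Cintegrable_normc.
- by apply: filterS fg => x ->.
Qed.

Lemma R_dominated (h_ : nat -> T -> R) (h g : T -> R) :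
  (forall n, measurable_fun setT (h_ n)) -> measurable_fun setT h -> Ri g ->
  {ae m, forall x, h_ ^~ x @ \oo --> h x} ->
  {ae m, forall x, forall n, `|h_ n x| <= g x} ->
  Ri h /\ \int[m]_x h_ n x @[n --> \oo] --> \int[m]_x h x.
Proof.
move=> mh_ mh ig hh hg.
have [] := @dominated_convergence _ _ _ m setT measurableT
  (fun n => EFin \o h_ n) (EFin \o h) (EFin \o g).
- by move=> n; exact/measurable_EFinP.
- exact/measurable_EFinP.
- apply: filterS hh => x hx _; exact: cvg_EFin (nearW _ _) hx.
- by [].
- by apply: filterS hg => x hx n _ /=; rewrite lee_fin.
move=> ih _ hc; split=> //.
rewrite -[X in _ --> X]/(fine (\int[m]_x (EFin \o h) x)).
apply: fine_cvg; rewrite fineK//; exact: integrable_fin_num.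
Qed.

Lemma C_dominated (f_ : nat -> T -> C) f (g : T -> R) :
  (forall n, Cmeas (f_ n)) -> Cmeas f -> Ri g ->
  {ae m, forall x, f_ ^~ x @ \oo --> f x} ->
  {ae m, forall x, forall n, normc (f_ n x) <= g x} ->
  Cintegrable m f /\ Cintegral m (f_ n) @[n --> \oo] --> Cintegral m f.
Proof.
move=> mf_ [mr mi] ig ff fg.
have [] := @R_dominated (fun n x => complex.Re (f_ n x)) _ _ (fun n => (mf_ n).1) mr ig.
- by apply: filterS ff => x /cvg_complexP[].
- by apply: filterS fg => x h n; apply: le_trans (normc_Re _) (h n).
move=> ir cr.
have [] := @R_dominated (fun n x => complex.Im (f_ n x)) _ _ (fun n => (mf_ n).2) mi ig.
- by apply: filterS ff => x /cvg_complexP[].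
- by apply: filterS fg => x h n; apply: le_trans (normc_Im _) (h n).
move=> ii ci; split; first by split.
by apply/cvg_complexP; split.
Qed.

(** This supplies the majorants for dominated convergence and the almost everywhere convergence of
    series. The extended-valued limit may be infinite on a null set, where [fine] puts 0; hence [g]
    dominates only almost everywhere. *)
Lemma R_levi (g_ : nat -> T -> R) (M : R) :
  (forall n, Ri (g_ n)) -> (forall n x, 0 <= g_ n x) ->
  (forall n x, g_ n x <= g_ n.+1 x) ->
  (forall n, \int[m]_x g_ n x <= M) ->
  exists g : T -> R, [/\ Ri g, forall x, 0 <= g x,
    {ae m, forall x, forall n, g_ n x <= g x},
    {ae m, forall x, g_ ^~ x @ \oo --> g x} &
    \int[m]_x g x <= M].
Proof.
move=> ig g0 gS gM.
have nd x : nondecreasing_seq (g_ ^~ x).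
  by apply/nondecreasing_seqP => n; exact: gS.
pose G x : \bar R := limn (fun n => (g_ n x)%:E).
have ndE x : nondecreasing_seq (fun n => (g_ n x)%:E).
  by move=> i j ij; rewrite lee_fin nd.
have cG x : (g_ n x)%:E @[n --> \oo] --> G x.
  exact: ereal_nondecreasing_is_cvgn.
have leG n x : ((g_ n x)%:E <= G x)%E.
  have -> : G x = ereal_sup (range (fun n => (g_ n x)%:E)).
    by apply: cvg_lim => //; exact: ereal_nondecreasing_cvgn.
  by apply: ereal_sup_ubound; exists n.
have G0 x : (0 <= G x)%E by apply: le_trans (leG 0%N x); rewrite lee_fin.
have mg n : measurable_fun setT (fun x => (g_ n x)%:E).
  exact: measurable_int (ig n).
have mG : measurable_fun setT G.
  by apply: (emeasurable_fun_cvg (fun n x => (g_ n x)%:E)) => //.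
have iG : (\int[m]_x G x <= M%:E)%E.
  have -> : (\int[m]_x G x = limn (fun n => \int[m]_x (g_ n x)%:E))%E.
    by rewrite -monotone_convergence//; move=> n x _; rewrite lee_fin.
  apply: lime_le.
    apply: ereal_nondecreasing_is_cvgn => i j ij; apply: ge0_le_integral => //.
    - by move=> x _; rewrite lee_fin.
    - by move=> x _; exact: ndE.
  apply: nearW => n; rewrite -(fineK (integrable_fin_num _ (ig n)))//.
  by rewrite lee_fin; exact: gM.
have IG : m.-integrable setT G.
  apply/integrableP; split => //.
  under eq_integral do rewrite gee0_abs//.
  exact: le_lt_trans iG (ltry _).
have finG := integrable_ae measurableT IG.
have iG' : m.-integrable setT (EFin \o (fine \o G)).
  apply: le_integrable IG => //.
    by do 2 apply: measurableT_comp => //.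
  move=> x _ /=; have := G0 x; case: (G x) => //= r.
  by rewrite leey.
exists (fine \o G); split => //.
- by move=> x; exact: fine_ge0.
- apply: filterS finG => x /(_ I) fx n /=.
  by rewrite -lee_fin fineK.
- apply: filterS finG => x /(_ I) fx.
  by apply: (@fine_cvg _ _ _ _ (fun n => (g_ n x)%:E) (fine (G x))); rewrite fineK//; exact: cG.
- rewrite -lee_fin /Rintegral fineK ?integrable_fin_num//.
  apply: le_trans iG; rewrite le_eqVlt; apply/orP; left; apply/eqP.
  apply: ae_eq_integral => //.
    exact: measurable_int iG'.
  by apply: filterS finG => x /(_ I) fx _ /=; rewrite fineK.
Qed.

End complex_integral.

(** * Continuous functions on locally compact groups *)

(** Sets satisfying [Q] are directed upwards by unions, and near-covering compactness along the
    corresponding filter [F] puts [K] inside one of them; no finite subcover is named. Urysohn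
    functions, null sets and vector-valued integrals are all glued in this way. *)
Lemma compact_union_ind (X : topologicalType) (K : set X) (Q : set X -> Prop) :
  compact K -> Q set0 -> (forall A B, Q A -> Q B -> Q (A `|` B)) ->
  (forall A B, A `<=` B -> Q B -> Q A) ->
  (forall x, K x -> exists2 U, nbhs x U & Q U) -> Q K.
Proof.
move=> /compact_near_coveringP cK Q0 QU QS Qloc.
pose F : set_system (set X) :=
  [set S | exists2 A, Q A & forall B, A `<=` B -> Q B -> S B].
have FF : Filter F.
  split.
  - by exists set0.
  - move=> S S' [A QA AS] [A' QA' AS']; exists (A `|` A'); first exact: QU.
    move=> B AB QB; split; first by apply: AS => // x Ax; apply: AB; left.
    by apply: AS' => // x Ax; apply: AB; right.
  - by move=> S S' SS' [A QA AS]; exists A => // B AB QB; apply/SS'/AS.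
have [|A QA AK] := cK _ F (fun B x => B x) FF; last by apply: (QS _ A) => //; exact: (AK A).
move=> x /Qloc[U xU QU']; exists (U, [set B | U `<=` B]); last by case=> y B [/= Uy]; apply.
by split => //; exists U.
Qed.

Section locally_compact_hausdorff.
Context (X : topologicalType) (R : realType).
Hypothesis hausX : hausdorff_space X.
Hypothesis lcX : locally_compact [set: X].

Lemma compact_nbhs (x : X) : exists2 K, nbhs x K & compact K.
Proof.
have [U xU [cU _]] := lcX (I : [set: X] x).
have xU' : nbhs x (fun y => setT y -> U y) by exact: xU.
by exists U => //; apply: filterS xU' => y; exact.
Qed.

(** Complete regularity separates a point from a closed set; [compact_union_ind] passes from points
    to [K], the maximum of two functions serving a union. *)
Lemma locally_compact_urysohn (K U : set X) : compact K -> open U -> K `<=` U ->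
  exists f : X -> R, [/\ continuous f, forall x, 0 <= f x <= 1,
    forall x, K x -> f x = 1 &
    exists L, [/\ compact L, L `<=` U & forall x, ~ L x -> f x = 0]].
Proof.
move=> cK oU KU; apply: (compact_union_ind (Q := fun A =>
  exists f : X -> R, [/\ continuous f, forall x, 0 <= f x <= 1,
    forall x, A x -> f x = 1 &
    exists L, [/\ compact L, L `<=` U & forall x, ~ L x -> f x = 0]])) cK _ _ _ _.
- exists (fun=> 0); split => //.
  + by move=> x; exact: cvg_cst.
  + by move=> x; rewrite lexx ler01.
  + by exists set0; split => //; exact: compact0.
- move=> A B [f [fc f01 fA [L [cL LU Lf]]]] [g [gc g01 gB [L' [cL' LU' Lg]]]].
  exists (fun x => Num.max (f x) (g x)); split.
  + by move=> x; apply: continuous_max; [exact: fc|exact: gc].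
  + move=> x; have /andP[f0 f1] := f01 x; have /andP[g0 g1] := g01 x.
    by rewrite le_max f0 ge_max f1 g1.
  + move=> x; have /andP[f0 f1] := f01 x; have /andP[g0 g1] := g01 x.
    by case=> [/fA ->|/gB ->]; [rewrite max_l|rewrite max_r].
  + exists (L `|` L'); split; first exact: compactU.
      by move=> x [/LU|/LU'].
    by move=> x /not_orP[/Lf -> /Lg ->]; rewrite maxxx.
- move=> A B AB [f [fc f01 fA fL]]; exists f; split => // x /AB; exact: fA.
- move=> x Kx; have [L xL cL] := compact_nbhs x.
  have Ux : nbhs x U by apply: open_nbhs_nbhs; split => //; exact: KU.
  have [g [gc g01 gx gB]] : exists g : X -> R, [/\ continuous g,
      range g `<=` `[0, 1]%classic, g @` [set x] `<=` [set 0] &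
      g @` (~` (U `&` L)°) `<=` [set 1]].
    apply/uniform_separatorP.
    apply: (locally_compact_completely_regular (R := R)) => //.
      by apply: open_closedC; exact: open_interior.
    by apply; apply: filterI.
  have gx0 : g x = 0 by apply: gx; exists x.
  have g0 y : 0 <= g y by have := g01 _ (imageP g (I : setT y)); rewrite /= in_itv/= => /andP[].
  exists (g @^-1` [set r | r < 1/4]).
    apply: (gc x); rewrite gx0; apply: (@lt_nbhsl _ _ (1/4)); lra.
  (* Clipping [2 - 4 * g] gives the value 1 on the whole neighbourhood [g < 1/4] of [x], and 0 where
     [g > 1/2]. The set [g <= 1/2] lies both in [U] and in the compact set [L], because [g] is 1 off
     the interior of their intersection. *)
  exists (fun y => Num.max 0 (Num.min 1 (2 - 4 * g y))); split.
  + move=> y.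
    apply: (@continuous_max _ _ (fun=> 0) (fun y => Num.min 1 (2 - 4 * g y))).
      exact: cvg_cst.
    apply: (@continuous_min _ _ (fun=> 1) (fun y => 2 - 4 * g y)).
      exact: cvg_cst.
    have c : 2 - 4 * g z @[z --> y] --> 2 - 4 * g y.
      apply: (@cvgB _ R^o); first exact: cvg_cst.
      by apply: (@cvgM R); [exact: cvg_cst|exact: gc].
    exact: c.
  + by move=> y; rewrite le_max lexx ge_max ler01/= ge_min lexx.
  + move=> y /= gy; rewrite min_l; last lra.
    by rewrite max_r.
  + exists (L `&` (g @^-1` [set r | r <= 1/2])).
    have sub : g @^-1` [set r | r <= 1/2] `<=` U `&` L.
      move=> y /= gy; apply: contrapT => ny.
      have : g y = 1 by apply: gB; exists y => // /interior_subset.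
      lra.
    split.
    * apply: compact_closedI => //; apply: closed_comp; last exact: closed_le.
      by move=> ? _; exact: gc.
    * by move=> y [_ /sub[]].
    * move=> y nL; have gy : 1/2 < g y.
        rewrite ltNge; apply/negP => gy; apply: nL; split => //.
        by have [] := sub _ gy.
      by rewrite max_l// ge_min; apply/orP; right; lra.
Qed.

End locally_compact_hausdorff.

(** * Group operations, neighbourhoods and compact sets *)

Section group_topology.
Context (G : topologicalGroupType).
Implicit Types (K L : set G) (x y : G).

Lemma mulg_cvg {U} {F : set_system U} {FF : Filter F} (f g : U -> G) x y :
  f @ F --> x -> g @ F --> y -> (f u * g u)%g @[u --> F] --> (x * y)%g.
Proof.
move=> fx gy.
exact: (@cvg_comp _ _ _ (fun u => (f u, g u)) (fun p : G * G => (p.1 * p.2)%g)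
  F _ _ (cvg_pair fx gy) (mulg_continuous (x, y))).
Qed.

Lemma mulgl_continuous x : continuous (fun y : G => (x * y)%g).
Proof. by move=> y; apply: mulg_cvg; [exact: cvg_cst|exact: cvg_id]. Qed.

Lemma mulgr_continuous x : continuous (fun y : G => (y * x)%g).
Proof. by move=> y; apply: mulg_cvg; [exact: cvg_id|exact: cvg_cst]. Qed.

Lemma compact_mulg K L : compact K -> compact L ->
  compact [set (p.1 * p.2)%g | p in K `*` L].
Proof.
move=> cK cL; apply: continuous_compact; last exact: compact_setX.
by apply: continuous_subspaceT => p; exact: mulg_continuous.
Qed.

Lemma compact_invg K : compact K -> compact [set x | K (x^-1)%g].
Proof.
move=> cK; rewrite (_ : [set _ | _] = (fun x : G => (x^-1)%g) @` K).
  apply: continuous_compact => //.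
  by apply: continuous_subspaceT => p; exact: invg_continuous.
apply/seteqP; split => [x Kx|_ [x Kx <-]]; last by rewrite /= invgK.
by exists (x^-1)%g => //; rewrite invgK.
Qed.

Lemma compact_translate K x : compact K -> compact [set y | K (x * y)%g].
Proof.
move=> cK; rewrite (_ : [set _ | _] = (fun y : G => (x^-1 * y)%g) @` K).
  apply: continuous_compact => //.
  by apply: continuous_subspaceT => p; exact: mulgl_continuous.
apply/seteqP; split => [y Ky|_ [y Ky <-]]; last by rewrite /= mulVKg.
by exists (x * y)%g => //; rewrite mulKg.
Qed.

Lemma compact_translater K x : compact K -> compact [set y | K (y * x)%g].
Proof.
move=> cK; rewrite (_ : [set _ | _] = (fun y : G => (y * x^-1)%g) @` K).
  apply: continuous_compact => //.
  by apply: continuous_subspaceT => p; exact: mulgr_continuous.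
apply/seteqP; split => [y Ky|_ [y Ky <-]]; last by rewrite /= mulgVK.
by exists (y * x)%g => //; rewrite mulgK.
Qed.

Lemma near1_invg (P : G -> Prop) :
  (\forall v \near (1%g : G), P v) -> \forall v \near (1%g : G), P (v^-1)%g.
Proof.
move=> nP.
have h : (v^-1)%g @[v --> (1%g : G)] --> (1%g : G).
  by rewrite -[X in _ --> X](invg1 G); exact: invg_continuous.
exact: (h _ nP).
Qed.

Lemma near_translate (P : G -> Prop) x :
  (\forall v \near (1%g : G), P (x * v)%g) <-> \forall y \near x, P y.
Proof.
split=> h.
  have c : (x^-1 * y)%g @[y --> x] --> (1%g : G).
    by rewrite -[X in _ --> X](mulVg x); exact: mulgl_continuous.
  have h' : nbhs x (fun y => P (x * (x^-1 * y))%g) := c _ h.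
  by apply: filterS h' => y; rewrite mulVKg.
have c : (x * y)%g @[y --> (1%g : G)] --> x.
  by rewrite -[X in _ --> X](mulg1 x); exact: mulgl_continuous.
exact: (c _ h).
Qed.

End group_topology.

(** * Functions in C_0(G) and C_c(G) *)

Section C0_facts.
Context (X : topologicalGroupType) (R : realType).
Local Notation C := (R[i]^o).
Implicit Types f : C0 X R.

Definition vanish_off (K : set X) (g : X -> C) := forall x, ~ K x -> g x = 0.

Definition Cc (g : X -> C) := continuous g /\ exists2 K, compact K & vanish_off K g.

Lemma C0_continuous f : continuous f.
Proof. by have := valP f; rewrite inE => -[]. Qed.

Lemma C0_vanish f : vanishing_at_infinity f.
Proof. by have := valP f; rewrite inE => -[]. Qed.

Lemma to_C0E (g : X -> C) : g \in @C0pred X R -> to_C0 g = g :> (X -> C).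
Proof. by move=> h; rewrite /to_C0 [LHS]insubdK. Qed.

Lemma C0_sup_le f M : (forall x, normc (f x) <= M) -> C0_sup f <= M.
Proof.
by move=> fM; apply: ge_sup; [case: (C0_has_sup f)|move=> _ [x _ <-]].
Qed.

Lemma addC0E f g x : (f + g) x = f x + g x.
Proof. by []. Qed.

Lemma subC0E f g x : (f - g) x = f x - g x.
Proof. by []. Qed.

Lemma scaleC0E (a : C) f x : (a *: f) x = a * f x.
Proof. by []. Qed.

Lemma C0_normE f : `|f| = (C0_sup f)%:C%C :> R[i].
Proof. by []. Qed.

Lemma Cc_C0 (g : X -> C) : Cc g -> g \in @C0pred X R.
Proof.
move=> [gc [K cK Kg]]; rewrite inE; split=> // e e0; exists K => // x /Kg ->.
by rewrite normc0.
Qed.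

(** This is how functions given by an integral at each point, such as [vint], are recognized as
    elements of C_0(G). *)
Lemma C0_unif_closed (g : X -> C) :
  (forall e, 0 < e -> exists f, forall x, normc (g x - f x) <= e) ->
  g \in @C0pred X R.
Proof.
move=> h; rewrite inE; split.
  move=> x; apply/cvg_normcP => e e0.
  have e3 : 0 < e / 3 by rewrite divr_gt0.
  have [f fg] := h _ e3.
  have /cvg_normcP/(_ _ e3) := @C0_continuous f x.
  apply: filterS => y fy.
  have -> : g x - g y = (g x - f x) + ((f x - f y) + (f y - g y)).
    by rewrite [f x - f y + _]addrA subrK addrA subrK.
  apply: le_lt_trans (ler_normcD _ _) _.
  have := ler_normcD (f x - f y) (f y - g y).
  have := fg x; have := fg y; rewrite normcB; lra.
move=> e e0; have e2 : 0 < e / 2 by rewrite divr_gt0.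
have [f fg] := h _ e2; have [K cK Kf] := C0_vanish f e2.
exists K => // x /Kf fx; have -> : g x = (g x - f x) + f x by rewrite subrK.
by apply: le_lt_trans (ler_normcD _ _) _; have := fg x; lra.
Qed.

Lemma Cc_bounded (g : X -> C) : Cc g -> exists2 B, 0 <= B & forall x, normc (g x) <= B.
Proof.
move=> /Cc_C0 gC; exists (C0_sup (to_C0 g)); first exact: C0_sup_ge0.
by move=> x; have := C0_supP (to_C0 g) x; rewrite to_C0E.
Qed.

Lemma CcD (g h : X -> C) : Cc g -> Cc h -> Cc (fun x => g x + h x).
Proof.
move=> [gc [K cK Kg]] [hc [L cL Lh]]; split.
  by move=> x; apply: cvgD; [exact: gc|exact: hc].
exists (K `|` L); first exact: compactU.
by move=> x /not_orP[/Kg -> /Lh ->]; rewrite addr0.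
Qed.

Lemma CcM (g h : X -> C) : Cc g -> continuous h -> Cc (fun x => h x * g x).
Proof.
move=> [gc [K cK Kg]] hc; split.
  by move=> x; apply: (@cvgM _ _ _ _ h g); [exact: hc|exact: gc].
by exists K => // x /Kg ->; rewrite mulr0.
Qed.

Lemma CcB (g h : X -> C) : Cc g -> Cc h -> Cc (fun x => g x - h x).
Proof.
move=> cg ch; have c : continuous ((fun=> -1) : X -> C) by move=> x; exact: cvg_cst.
have := CcD cg (CcM ch c).
by congr Cc; apply/funext => x; rewrite mulN1r.
Qed.

Lemma Cc_normc (g : X -> C) : Cc g -> Cc (fun x => (normc (g x))%:C%C).
Proof.
move=> [gc [K cK Kg]]; split.
  move=> x; apply: continuous_comp; last exact: continuous_real_complex.
  by apply: continuous_comp; [exact: gc|exact: normc_continuous].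
by exists K => // x /Kg ->; rewrite normc0.
Qed.

End C0_facts.

(** * Uniform continuity and translations *)

Section uniform_continuity.
Context (G : topologicalGroupType) (R : realType).
Local Notation C := (R[i]^o).

Lemma C0_unif_right (f : C0 G R) e : 0 < e ->
  \forall v \near (1%g : G), forall x, normc (f (x * v)%g - f x) < e.
Proof.
move=> e0; have e2 : 0 < e / 2 by rewrite divr_gt0.
have [K /compact_near_coveringP cK Kf] := C0_vanish f e2.
have n1 : \forall v \near (1%g : G), K `<=` (fun x => normc (f (x * v)%g - f x) < e).
  apply: cK => x Kx.
  have h1 : (f (p.1 * p.2)%g) @[p --> (x, 1%g : G)] --> f x.
    have h : (p.1 * p.2)%g @[p --> (x, 1%g : G)] --> x.
      rewrite -[X in _ --> X](mulg1 x).
      by apply: mulg_cvg; [exact: cvg_fst|exact: cvg_snd].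
    exact: (cvg_comp _ _ h (@C0_continuous _ _ f x)).
  have h2 : (f p.1) @[p --> (x, 1%g : G)] --> f x.
    by apply: continuous_cvg; [exact: C0_continuous|exact: cvg_fst].
  have h3 : (f (p.1 * p.2)%g - f p.1) @[p --> (x, 1%g : G)] --> (0 : C).
    by rewrite -(subrr (f x)); apply: cvgB.
  have /cvg_normcP/(_ e e0) := h3.
  by apply: filterS => -[y v] /=; rewrite sub0r normcN.
(* Compactness controls only the points of [K]. If [x] is outside [K] but [x v] is inside, the
   estimate is read at the point [x v] for the increment [v^-1]; if both are outside, both values
   are small. *)
apply: filterS2 n1 (near1_invg n1) => v h1 h2 x.
have [/h1//|nK] := pselect (K x).
have [Kv|nKv] := pselect (K (x * v)%g).
  by have := h2 _ Kv; rewrite mulgK normcB.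
rewrite normcB; apply: le_lt_trans (ler_normcD _ _) _; rewrite normcN.
by have := Kf _ nK; have := Kf _ nKv; lra.
Qed.

Lemma C0_unif_left (f : C0 G R) e : 0 < e ->
  \forall v \near (1%g : G), forall x, normc (f (v * x)%g - f x) < e.
Proof.
move=> e0; have e2 : 0 < e / 2 by rewrite divr_gt0.
have [K /compact_near_coveringP cK Kf] := C0_vanish f e2.
have n1 : \forall v \near (1%g : G), K `<=` (fun x => normc (f (v * x)%g - f x) < e).
  apply: cK => x Kx.
  have h1 : (f (p.2 * p.1)%g) @[p --> (x, 1%g : G)] --> f x.
    have h : (p.2 * p.1)%g @[p --> (x, 1%g : G)] --> x.
      rewrite -[X in _ --> X](mul1g x).
      by apply: mulg_cvg; [exact: cvg_snd|exact: cvg_fst].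
    exact: (cvg_comp _ _ h (@C0_continuous _ _ f x)).
  have h2 : (f p.1) @[p --> (x, 1%g : G)] --> f x.
    by apply: continuous_cvg; [exact: C0_continuous|exact: cvg_fst].
  have h3 : (f (p.2 * p.1)%g - f p.1) @[p --> (x, 1%g : G)] --> (0 : C).
    by rewrite -(subrr (f x)); apply: cvgB.
  have /cvg_normcP/(_ e e0) := h3.
  by apply: filterS => -[y v] /=; rewrite sub0r normcN.
apply: filterS2 n1 (near1_invg n1) => v h1 h2 x.
have [/h1//|nK] := pselect (K x).
have [Kv|nKv] := pselect (K (v * x)%g).
  by have := h2 _ Kv; rewrite mulKg normcB.
rewrite normcB; apply: le_lt_trans (ler_normcD _ _) _; rewrite normcN.
by have := Kf _ nK; have := Kf _ nKv; lra.
Qed.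

Definition rtrans (f : G -> C) (y : G) : G -> C := fun x => f (x * y)%g.
Definition ltrans (f : G -> C) (y : G) : G -> C := fun x => f (y^-1 * x)%g.

Lemma rtrans_C0 (f : C0 G R) y : rtrans f y \in @C0pred G R.
Proof.
rewrite inE; split.
  move=> x; apply: (cvg_comp _ _ (@mulgr_continuous _ y x)); exact: C0_continuous.
move=> e /(C0_vanish f)[K cK Kf]; exists [set x | K (x * y)%g].
  exact: compact_translater.
by move=> x /Kf.
Qed.

Lemma ltrans_C0 (f : C0 G R) y : ltrans f y \in @C0pred G R.
Proof.
rewrite inE; split.
  move=> x; apply: (cvg_comp _ _ (@mulgl_continuous _ y^-1%g x)); exact: C0_continuous.
move=> e /(C0_vanish f)[K cK Kf]; exists [set x | K (y^-1 * x)%g].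
  exact: compact_translate.
by move=> x /Kf.
Qed.

Lemma rtrans_cont (f : C0 G R) y e : 0 < e ->
  \forall y' \near y, C0_sup (to_C0 (rtrans f y') - to_C0 (rtrans f y)) <= e.
Proof.
move=> e0; apply/near_translate.
apply: filterS (C0_unif_right f e0) => v h.
apply: C0_sup_le => x; rewrite subC0E !to_C0E ?rtrans_C0//.
by rewrite /rtrans mulgA ltW.
Qed.

(** Since [(y v)^-1 x = v^-1 (y^-1 x)], the increment acts on the left, whereas in [rtrans] it acts
    on the right; each case calls for its own kind of uniform continuity. *)
Lemma ltrans_cont (f : C0 G R) y e : 0 < e ->
  \forall y' \near y, C0_sup (to_C0 (ltrans f y') - to_C0 (ltrans f y)) <= e.
Proof.
move=> e0; apply/near_translate.
have := near1_invg (C0_unif_left f e0); apply: filterS => v h.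
apply: C0_sup_le => x; rewrite subC0E !to_C0E ?ltrans_C0//.
by rewrite /ltrans invgM -mulgA ltW.
Qed.

End uniform_continuity.

Import HBSimple.

Lemma notin_set_not (T : Type) (A : set T) x : x \notin A -> ~ A x.
Proof. by move=> + Ax; rewrite mem_set. Qed.

(** * Sets of finite measure *)

Section finite_indicator.
Context d (T : measurableType d) (R : realType).
Variable m : {measure set T -> \bar R}.
Local Notation Ri f := (m.-integrable setT (EFin \o f)).

Lemma Ri_indic (A : set T) : measurable A -> (m A < +oo)%E ->
  Ri (\1_A : T -> R).
Proof.
move=> mA Afin; apply/integrableP; split.
  by apply/measurable_EFinP; exact: measurable_indic.
under eq_integral => x _ do rewrite /= ger0_norm//.
by rewrite integral_indic// setIT.
Qed.

Lemma Rintegral_indic (A : set T) : measurable A ->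
  \int[m]_x (\1_A x : R) = fine (m A).
Proof. by move=> mA; rewrite /Rintegral integral_indic// setIT. Qed.

Lemma Ri_cut (A : set T) (h : T -> R) : measurable A -> Ri h ->
  Ri (fun x => \1_A x * h x).
Proof.
move=> mA ih; apply: (Ri_dom (g := fun x => `|h x|)).
- apply: measurable_funM; first exact: measurable_indic.
  by apply/measurable_EFinP; exact: measurable_int ih.
- exact: integrable_norm.
- by move=> x; rewrite normrM ger0_norm// ler_piMl// indicE; case: (x \in A).
Qed.

Lemma le_Ri (h g : T -> R) : Ri h -> Ri g -> (forall x, h x <= g x) ->
  \int[m]_x h x <= \int[m]_x g x.
Proof. by move=> ih ig hg; apply: le_Rintegral => //= x _; exact: hg. Qed.

(** Markov's inequality: [c] times the measure of [A] is at most the integral of |h|. *)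
Lemma Ri_level_fin (A : set T) (h : T -> R) (c : R) : measurable A -> Ri h ->
  0 < c -> (forall x, A x -> c <= `|h x|) -> (m A < +oo)%E.
Proof.
move=> mA ih c0 ch; have [mh hfin] := integrableP _ _ _ ih.
rewrite -(@lte_pmul2l _ c%:E)// gt0_muley ?lte_fin//.
have := hfin; apply: le_lt_trans.
have -> : (m A = \int[m]_x (\1_A x)%:E)%E by rewrite integral_indic// setIT.
rewrite -ge0_integralZl//; last 2 first.
- by apply/measurable_EFinP; exact: measurable_indic.
- by rewrite lee_fin ltW.
apply: ge0_le_integral => //.
- by move=> x _; rewrite -EFinM lee_fin mulr_ge0// ltW.
- apply: measurable_funeM; apply/measurable_EFinP; exact: measurable_indic.
- by do 2 apply: measurableT_comp => //; apply/measurable_EFinP.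
- move=> x _ /=; rewrite -EFinM lee_fin indicE; case: (boolP (x \in A)) => xA.
    by rewrite mulr1 ch//; exact: set_mem.
  by rewrite mulr0.
Qed.

End finite_indicator.

(** * Borel measurability on the group *)

Section borel_group.
Context (G : topologicalGroupType) (R : realType).
Local Notation C := (R[i]^o).

Lemma borel_open (U : set G) : open U -> measurable (U : set (borel G)).
Proof. by move=> oU; exact: sub_sigma_algebra. Qed.

Lemma borel_closed (U : set G) : closed U -> measurable (U : set (borel G)).
Proof.
move=> cU; rewrite -[U : set (borel G)]setCK; apply: measurableC.
by apply: borel_open; exact: closed_openC.
Qed.

Lemma borel_continuous (h : G -> R) : continuous h ->
  measurable_fun setT (h : borel G -> R).
Proof.
move=> hc; apply: (@measurability _ _ _ _ setT (h : borel G -> R) _ (RGenOInfty.measurableE R)) => _ [_ [x ->] <-].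
rewrite setTI; apply: borel_open; apply: open_comp; last exact: interval_open.
by move=> ? _; exact: hc.
Qed.

Lemma borel_continuousG (t : G -> G) : continuous t ->
  measurable_fun setT (t : borel G -> borel G).
Proof.
move=> tc; apply: (@measurability _ _ (borel G) (borel G) setT t (@open G)) => // _ [U oU <-].
by rewrite setTI; apply: borel_open; apply: open_comp.
Qed.

Lemma Cmeas_continuous (f : G -> C) : continuous f -> Cmeas (f : borel G -> C).
Proof.
move=> fc; split.
  apply: borel_continuous => x; apply: continuous_comp; first exact: fc.
  exact: continuous_Re.
apply: borel_continuous => x; apply: continuous_comp; first exact: fc.
exact: continuous_Im.
Qed.

Lemma Cmeas_comp (f : borel G -> C) (t : G -> G) : continuous t -> Cmeas f ->
  Cmeas ((f \o t) : borel G -> C).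
Proof.
move=> /borel_continuousG mt [fr fi]; split.
  exact: (measurableT_comp fr mt).
exact: (measurableT_comp fi mt).
Qed.

End borel_group.

(** * Haar measure and density of C_c(G) in L^1(G) *)

Section haar.
Context (G : topologicalGroupType) (R : realType).
Hypothesis hausG : hausdorff_space G.
Hypothesis lcG : locally_compact [set: G].
Variable m : {measure set (borel G) -> \bar R}.
Hypothesis haar_m : left_haar m.
Local Notation C := (R[i]^o).
Local Notation Ri f := (m.-integrable setT (EFin \o f)).

Lemma borel_compact (K : set G) : compact K -> measurable (K : set (borel G)).
Proof. by move=> cK; apply: borel_closed; exact: compact_closed. Qed.

Lemma haar_translate (x : G) (A : set (borel G)) : measurable A ->
  m [set y | A (x * y)%g] = m A.
Proof.
move=> mA; rewrite -[RHS](haar_left haar_m x^-1%g mA); congr (m _).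
apply/seteqP; split => [y Ay|_ [y Ay <-]]; last by rewrite /= mulVKg.
by exists (x * y)%g => //; rewrite mulKg.
Qed.

Lemma haar_ge0_integral (x : G) (h : borel G -> \bar R) : measurable_fun setT h ->
  (forall y, 0 <= h y)%E -> (\int[m]_y h (x * y)%g = \int[m]_y h y)%E.
Proof.
move=> mh h0.
have mt := borel_continuousG (@mulgl_continuous G x).
transitivity (\int[pushforward m (fun y : borel G => (x * y)%g : borel G)]_y h y)%E.
  by rewrite (ge0_integral_pushforward mt).
by apply: eq_measure_integral => A mA _; exact: haar_translate.
Qed.

Lemma haar_Ri (x : G) (h : borel G -> R) : Ri h ->
  Ri (fun y : borel G => h (x * y)%g).
Proof.
move=> /integrableP[mh hfin].
have mt := borel_continuousG (@mulgl_continuous G x).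
apply/integrableP; split; first exact: (measurableT_comp mh mt).
rewrite (@haar_ge0_integral x (fun y => `|(h y)%:E|%E))//.
by apply: measurableT_comp.
Qed.

Lemma haar_Rintegral (x : G) (h : borel G -> R) : Ri h ->
  \int[m]_y h (x * y)%g = \int[m]_y h y.
Proof.
move=> ih; have mt := borel_continuousG (@mulgl_continuous G x).
congr fine.
transitivity (\int[pushforward m (fun y : borel G => (x * y)%g : borel G)]_y (h y)%:E)%E.
  rewrite (integral_pushforward mt)//.
    exact: measurable_int ih.
  exact: haar_Ri.
by apply: eq_measure_integral => A mA _; exact: haar_translate.
Qed.

Lemma haar_Cintegral (x : G) (f : borel G -> C) : Cintegrable m f ->
  Cintegral m (fun y : borel G => f (x * y)%g) = Cintegral m f.
Proof.
move=> [fr fi]; rewrite /Cintegral; congr Complex.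
  exact: (haar_Rintegral x fr).
exact: (haar_Rintegral x fi).
Qed.

Lemma Ri_bounded_compact (h : G -> R) (K : set G) (B : R) :
  measurable_fun setT (h : borel G -> R) -> compact K ->
  (forall x, `|h x| <= B) -> (forall x, ~ K x -> h x = 0) -> Ri h.
Proof.
move=> mh cK hB hK; apply: (@Ri_dom _ _ _ m h (fun x => B * \1_K x)) => //.
  by apply/RiZ/Ri_indic; [exact: borel_compact|exact: haar_compact].
move=> x; rewrite indicE; case: (boolP (x \in K)) => xK; first by rewrite mulr1.
by rewrite hK ?normr0 ?mulr0//; exact: notin_set_not.
Qed.

Lemma Cc_integrable (g : G -> C) : Cc g -> Cintegrable m g.
Proof.
move=> cg; have [B B0 gB] := Cc_bounded cg; have [gc [K cK Kg]] := cg.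
have [mr mi] := Cmeas_continuous gc.
split; apply: (@Ri_bounded_compact _ K B) => //.
- by move=> x; apply: le_trans (normc_Re _) (gB x).
- by move=> x /Kg /= ->.
- by move=> x; apply: le_trans (normc_Im _) (gB x).
- by move=> x /Kg /= ->.
Qed.

Lemma normc_le_compact (g : G -> C) (K : set G) (e : R) : Cc g -> compact K ->
  (forall x, normc (g x) <= e) -> vanish_off K g ->
  \int[m]_x normc (g x) <= e * fine (m K).
Proof.
move=> cg cK ge gK; have mK := borel_compact cK.
have iK := Ri_indic mK (haar_compact haar_m cK).
rewrite -(Rintegral_indic _ mK) -RintegralZl//.
apply: le_Ri; first exact/Cintegrable_normc/Cc_integrable.
  exact: RiZ.
move=> x; rewrite indicE; case: (boolP (x \in K)) => xK; first by rewrite mulr1.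
by rewrite gK ?normc0 ?mulr0//; exact: notin_set_not.
Qed.

(** Translates of a null nonempty open set cover every compact set, so all compact sets would be
    null and, by inner regularity, so would [G], against [haar_neq0]. *)
Lemma open_haar_gt0 (U : set G) : open U -> U !=set0 -> (0 < m U)%E.
Proof.
move=> oU [u Uu]; rewrite lt_neqAle measure_ge0 andbT; apply/eqP => mU.
have nullK (K : set G) : compact K -> m K = 0%E.
  move=> cK.
  (* [compact_union_ind] asks for a property inherited by arbitrary subsets, measurable or not;
     lying in a null Borel set is such a property. *)
  suff : exists A : set G, [/\ measurable (A : set (borel G)), m A = 0%E & K `<=` A].
    move=> [A [mA A0 KA]]; apply/eqP; rewrite eq_le measure_ge0 andbT -A0.
    by apply: le_measure; rewrite ?inE//; exact: borel_compact.
  apply: (compact_union_ind (Q := fun K => exists A : set G,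
    [/\ measurable (A : set (borel G)), m A = 0%E & K `<=` A])) cK _ _ _ _.
  - by exists set0; split => //; rewrite measure0.
  - move=> A B [A' [mA A0 AA]] [B' [mB B0 BB]]; exists (A' `|` B'); split.
    + exact: measurableU.
    + by rewrite null_set_setU.
    + by move=> x [/AA|/BB]; [left|right].
  - by move=> A B AB [B' [mB B0 BB]]; exists B'; split => // x /AB/BB.
  - move=> x _; pose V := [set y : G | U (u * x^-1 * y)%g].
    have oV : open V.
      by apply: open_comp => // ? _; exact: mulgl_continuous.
    exists V.
      by apply: open_nbhs_nbhs; split => //; rewrite /V/= mulgVK.
    exists V; split => //; first exact: borel_open.
    by rewrite haar_translate//; exact: borel_open.
have := haar_neq0 haar_m; rewrite (haar_inner haar_m openT).
suff -> : [set m K | K in [set K : set G | compact K /\ K `<=` setT]] = [set 0%E].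
  by rewrite ereal_sup1 eqxx.
apply/seteqP; split => [_ [K [cK _] <-]|_ ->]; first exact: nullK.
by exists set0; [split => //; exact: compact0|rewrite measure0].
Qed.

Definition Cc_approx (h : borel G -> R) := forall e, 0 < e ->
  exists g : G -> R, [/\ continuous g,
    exists2 K, compact K & forall x, ~ K x -> g x = 0 &
    \int[m]_x `|h x - g x| < e].

Lemma real_Cc (g : G -> R) : continuous g ->
  (exists2 K, compact K & forall x, ~ K x -> g x = 0) ->
  Cc (fun x => (g x)%:C%C : C).
Proof.
move=> gc [K cK Kg]; split.
  by move=> x; apply: continuous_comp; [exact: gc|exact: continuous_real_complex].
by exists K => // x /Kg ->.
Qed.

Lemma real_Cc_Ri (g : G -> R) : continuous g ->
  (exists2 K, compact K & forall x, ~ K x -> g x = 0) -> Ri g.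
Proof. by move=> gc gK; have [] := Cc_integrable (real_Cc gc gK). Qed.

Lemma RiB (h g : borel G -> R) : Ri h -> Ri g -> Ri (fun x => h x - g x).
Proof. by move=> ih ig; have := integrableB measurableT ih ig. Qed.

Lemma Ri_norm (h : borel G -> R) : Ri h -> Ri (fun x => `|h x|).
Proof. exact: integrable_norm. Qed.

(** [haar_inner] concerns open sets. So [A] is enclosed in an open [U], the compact [K] is taken
    inside [U] instead of [A], and a Urysohn function between [K] and [U] differs from the indicator
    of [A] by at most [(1_U - 1_A) + (1_U - 1_K)]. *)
Lemma Cc_approx_indic (A : set (borel G)) : measurable A -> (m A < +oo)%E ->
  Cc_approx (\1_A).
Proof.
move=> mA Afin e e0; have e2 : 0 < e / 2 by rewrite divr_gt0.
have [U [oU AU] mU] : exists2 U : set G, open U /\ A `<=` U &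
    (m U < m A + (e / 2)%:E)%E.
  have := haar_outer haar_m mA => mAE.
  have : (ereal_inf [set m U | U in [set U : set G | open U /\ A `<=` U]] <
      m A + (e / 2)%:E)%E.
    by rewrite -mAE lteDl ?lte_fin// ge0_fin_numE.
  by move=> /ereal_inf_lt[_ [U UA <-] mU]; exists U.
have Ufin : (m U < +oo)%E by apply: lt_trans mU _; rewrite lte_add_pinfty// ltry.
have [K [cK KU] mK] : exists2 K : set G, compact K /\ K `<=` U &
    (m U - (e / 2)%:E < m K)%E.
  have : (m U - (e / 2)%:E <
      ereal_sup [set m K | K in [set K : set G | compact K /\ K `<=` U]])%E.
    rewrite -(haar_inner haar_m oU) lteBlDr// lteDl ?lte_fin//.
    by rewrite ge0_fin_numE.
  by move=> /ereal_sup_gt[_ [K KA <-] mK]; exists K.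
have [g [gc g01 gK [L [cL LU gL]]]] := locally_compact_urysohn R hausG lcG cK oU KU.
exists g; split => //; first by exists L.
have mU' := borel_open oU; have mK' := borel_compact cK.
have Kfin := haar_compact haar_m cK.
have iA := Ri_indic mA Afin; have iU := Ri_indic mU' Ufin.
have iK := Ri_indic mK' Kfin.
have ig : Ri g by apply: real_Cc_Ri => //; exists L.
apply: (@le_lt_trans _ _ (\int[m]_x ((\1_U x - \1_A x) + (\1_U x - \1_K x)))).
  apply: le_Ri.
  - exact/Ri_norm/RiB.
  - by apply: RiD; exact: RiB.
  - move=> x; have /andP[g0 g1] := g01 x.
    have gU : g x <= \1_U x.
      rewrite indicE; case: (boolP (x \in U)) => xU //=.
      by rewrite gL// => /LU; exact: (notin_set_not xU).
    have Kg : \1_K x <= g x.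
      rewrite indicE; case: (boolP (x \in K)) => xK //=.
      by rewrite gK//; exact: set_mem.
    have AUx : \1_A x <= \1_U x :> R.
      rewrite !indicE; case: (boolP (x \in A)) => // /set_mem/AU xU.
      by rewrite mem_set.
    by rewrite ler_norml; apply/andP; split; lra.
rewrite RintegralD//; [|exact: RiB|exact: RiB].
rewrite !RintegralB// !Rintegral_indic// [e]splitr.
have /fineK fA : m A \is a fin_num by rewrite ge0_fin_numE.
have /fineK fU : m U \is a fin_num by rewrite ge0_fin_numE.
have /fineK fK : m K \is a fin_num by rewrite ge0_fin_numE.
move: mU mK; rewrite -fA -fU -fK -EFinD -EFinB !lte_fin !fA !fU !fK.
by rewrite /=; lra.
Qed.

Lemma Cc_approx0 : Cc_approx (fun=> 0).
Proof.
move=> e e0; exists (fun=> 0); split.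
- by move=> x; exact: cvg_cst.
- by exists set0 => //; exact: compact0.
- by under eq_Rintegral do rewrite subrr normr0; rewrite Rintegral_cst// mul0r.
Qed.

Lemma Cc_approxD (h k : borel G -> R) : Ri h -> Ri k ->
  Cc_approx h -> Cc_approx k -> Cc_approx (fun x => h x + k x).
Proof.
move=> ih ik ah ak e e0; have e2 : 0 < e / 2 by rewrite divr_gt0.
have [g [gc [K cK gK] hg]] := ah _ e2; have [l [lc [L cL lL] kl]] := ak _ e2.
have ig : Ri g by apply: real_Cc_Ri => //; exists K.
have il : Ri l by apply: real_Cc_Ri => //; exists L.
exists (fun x => g x + l x); split.
- by move=> x; apply: (@cvgD _ R^o); [exact: gc|exact: lc].
- exists (K `|` L); first exact: compactU.
  by move=> x /not_orP[/gK -> /lL ->]; rewrite addr0.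
- apply: (@le_lt_trans _ _ (\int[m]_x (`|h x - g x| + `|k x - l x|))).
    apply: le_Ri.
    + by apply/Ri_norm/RiB; exact: RiD.
    + by apply: RiD; apply/Ri_norm/RiB.
    + by move=> x; rewrite opprD addrACA ler_normD.
  rewrite RintegralD//; [|exact/Ri_norm/RiB|exact/Ri_norm/RiB].
  by rewrite [e]splitr ltrD.
Qed.

Lemma Cc_approxZ (c : R) (h : borel G -> R) : Ri h ->
  Cc_approx h -> Cc_approx (fun x => c * h x).
Proof.
move=> ih ah e e0; have c1 : 0 < `|c| + 1 by rewrite ltr_wpDl.
have [g [gc [K cK gK] hg]] := ah (e / (`|c| + 1)) (divr_gt0 e0 c1).
have ig : Ri g by apply: real_Cc_Ri => //; exists K.
exists (fun x => c * g x); split.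
- by move=> x; apply: (@cvgM R); [exact: cvg_cst|exact: gc].
- by exists K => // x /gK ->; rewrite mulr0.
- under eq_Rintegral do rewrite -mulrBr normrM.
  rewrite RintegralZl//; last exact/Ri_norm/RiB.
  apply: (@le_lt_trans _ _ ((`|c| + 1) * \int[m]_x `|h x - g x|)).
    by rewrite ler_wpM2r// ?lerDl// Rintegral_ge0.
  by rewrite mulrC -ltr_pdivlMr.
Qed.

Lemma Ri_Cc_approx (h : borel G -> R) : Ri h -> Cc_approx h.
Proof.
move=> ih e e0; have e2 : 0 < e / 2 by rewrite divr_gt0.
have [s_ [is_ _ s0]] := approximation_sfun_integrable measurableT ih.
have [n sn] : exists n, \int[m]_x `|h x - s_ n x| < e / 2.
  have : (fine (\int[m]_x `|(h x)%:E - (s_ n x)%:E|)%E) @[n --> \oo] --> (0 : R).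
    exact: (fine_cvg s0).
  move=> /cvgrPdist_lt/(_ _ e2)[n _ /(_ n (leqnn n))] /=.
  rewrite sub0r normrN => sn; exists n; apply: le_lt_trans sn.
  by apply: le_trans (ler_norm _).
pose s := s_ n.
have a : Cc_approx s.
  have sE : (s : borel G -> R) = (fun x => \sum_(y <- finmap.enum_fset (fset_set (range s))) y * \1_(s @^-1` [set y]) x).
    by apply/funext => x; rewrite [LHS]fimfunE fsbig_finite.
  rewrite sE.
  have isn := is_ n.
  suff : Ri (fun x : borel G => \sum_(y <- finmap.enum_fset (fset_set (range s))) y * \1_(s @^-1` [set y]) x) /\
      Cc_approx (fun x => \sum_(y <- finmap.enum_fset (fset_set (range s))) y * \1_(s @^-1` [set y]) x) by case.
  elim: (finmap.enum_fset (fset_set (range s))) => [|y l [ihl al]].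
    split; first by under eq_fun do rewrite /= big_nil; exact: Ri0.
    by under eq_fun do rewrite big_nil; exact: Cc_approx0.
  have [iy ay] : Ri (fun x : borel G => y * \1_(s @^-1` [set y]) x) /\
      Cc_approx (fun x => y * \1_(s @^-1` [set y]) x).
    (* The value 0 is set apart because its level set may have infinite measure; the other level
       sets are finite by [Ri_level_fin]. *)
    have [->|y0] := eqVneq y 0.
      split; first by under eq_fun do rewrite /= mul0r; exact: Ri0.
      by under eq_fun do rewrite mul0r; exact: Cc_approx0.
    have ms : measurable (s @^-1` [set y]) by exact: measurable_sfunP.
    have fin : (m (s @^-1` [set y]) < +oo)%E.
      apply: (Ri_level_fin ms isn (c := `|y|)); first by rewrite normr_gt0.
      by move=> x /= ->.
    have i1 := Ri_indic ms fin.
    split; first exact: RiZ.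
    by apply: Cc_approxZ => //; exact: Cc_approx_indic.
  split.
    by under eq_fun do rewrite /= big_cons; exact: RiD.
  by under eq_fun do rewrite big_cons; exact: Cc_approxD.
have [g [gc gK sg]] := a _ e2; exists g; split => //.
have ig : Ri g by exact: real_Cc_Ri.
have isn : Ri s by exact: is_.
apply: (@le_lt_trans _ _ (\int[m]_x (`|h x - s x| + `|s x - g x|))).
  apply: le_Ri.
  - exact/Ri_norm/RiB.
  - by apply: RiD; exact/Ri_norm/RiB.
  - by move=> x; rewrite -{1}(subrK (s x) (h x)) -addrA ler_normD.
rewrite RintegralD//; [|exact/Ri_norm/RiB|exact/Ri_norm/RiB].
by rewrite [e]splitr ltrD.
Qed.

Lemma Cc_dense (f : borel G -> C) (e : R) : Cintegrable m f -> 0 < e ->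
  exists2 g : G -> C, Cc g & \int[m]_x normc (f x - g x) < e.
Proof.
move=> [fr fi] e0; have e2 : 0 < e / 2 by rewrite divr_gt0.
have [g [gc gK fg]] := Ri_Cc_approx fr e2.
have [h [hc hK fh]] := Ri_Cc_approx fi e2.
have ig := real_Cc_Ri gc gK; have ih := real_Cc_Ri hc hK.
have cg : Cc (fun x => Complex (g x) (h x) : C).
  split.
    by move=> x; apply/cvg_complexP; split; [exact: gc|exact: hc].
  have [K cK Kg] := gK; have [L cL Lh] := hK.
  exists (K `|` L); first exact: compactU.
  by move=> x /not_orP[/Kg -> /Lh ->].
exists (fun x => Complex (g x) (h x)) => //.
apply: (@le_lt_trans _ _ (\int[m]_x
    (`|complex.Re (f x) - g x| + `|complex.Im (f x) - h x|))).
  apply: le_Ri.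
  - by apply/Cintegrable_normc/CintegrableB; [split|exact: Cc_integrable].
  - by apply: RiD; exact/Ri_norm/RiB.
  - by move=> x; apply: le_trans (normc_le _) _; case: (f x).
rewrite RintegralD//; [|exact/Ri_norm/RiB|exact/Ri_norm/RiB].
by rewrite [e]splitr ltrD.
Qed.

(** Off the support of an approximating [g] in C_c(G), the function [f] coincides with [f - g]. *)
Lemma Cintegrable_tight (f : borel G -> C) (e : R) : Cintegrable m f -> 0 < e ->
  exists2 K : set G, compact K & \int[m]_x (\1_(~` K) x * normc (f x)) < e.
Proof.
move=> fi e0; have [g cg fg] := Cc_dense fi e0.
have [gc [K cK Kg]] := cg; exists K => //; apply: le_lt_trans fg.
apply: le_Ri.
- by apply: Ri_cut (Cintegrable_normc fi); apply: measurableC; exact: borel_compact.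
- by apply/Cintegrable_normc/CintegrableB => //; exact: Cc_integrable.
- move=> x; rewrite indicE in_setC; case: (boolP (x \in K)) => xK /=.
    by rewrite mul0r normc_ge0.
  by rewrite mul1r Kg ?subr0//; exact: notin_set_not.
Qed.

End haar.

(** * Bounded functionals and vector-valued integrals *)

Section bounded_functionals.
Context (G : topologicalGroupType) (R : realType).
Local Notation C := (R[i]^o).
Implicit Types (L : C0 G R -> C) (M : R).

(** A plain function with an explicit bound: point evaluations, L^1 densities and the weak limit are
    handled alike, and [M] enters the error estimates. Packaging as a [measure_algebra] is left to
    [bfun_measure]. *)
Definition bounded_functional L M := [/\ 0 <= M,
  forall (a : C) f g, L (a *: f + g) = a * L f + L g &
  forall f, normc (L f) <= M * C0_sup f].

Lemma bfunD L M f g : bounded_functional L M -> L (f + g) = L f + L g.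
Proof. by move=> [_ lin _]; rewrite -[f in LHS]scale1r lin mul1r. Qed.

Lemma bfun0 L M : bounded_functional L M -> L 0 = 0.
Proof.
move=> bL; have := bfunD 0 0 bL; rewrite addr0 => /eqP.
by rewrite -subr_eq0 opprD addrA subrr sub0r oppr_eq0 => /eqP.
Qed.

Lemma bfunZ L M (a : C) f : bounded_functional L M -> L (a *: f) = a * L f.
Proof.
by move=> bL; have [_ lin _] := bL; rewrite -[a *: f]addr0 lin (bfun0 bL) addr0.
Qed.

Lemma bfunB L M f g : bounded_functional L M -> L (f - g) = L f - L g.
Proof. by move=> bL; rewrite (bfunD _ _ bL) -scaleN1r (bfunZ _ _ bL) mulN1r. Qed.

Lemma bfun_eval x : bounded_functional (fun f : C0 G R => f x) 1.
Proof. by split => // f; rewrite mul1r; exact: C0_supP. Qed.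

End bounded_functionals.

Lemma mul_div_succ_le (R : realFieldType) (a b : R) : 0 <= a -> 0 <= b ->
  b * (a / (2 * (b + 1))) <= a / 2.
Proof.
move=> a0 b0; have b1 : 0 < b + 1 by rewrite ltr_wpDl.
have -> : b * (a / (2 * (b + 1))) = a / 2 * (b / (b + 1)).
  by field; rewrite gt_eqF.
rewrite ler_piMr ?divr_ge0//.
by rewrite ler_pdivrMr// mul1r lerDl.
Qed.

Section vector_integral.
Context (G : topologicalGroupType) (R : realType).
Hypothesis hausG : hausdorff_space G.
Hypothesis lcG : locally_compact [set: G].
Variable m : {measure set (borel G) -> \bar R}.
Hypothesis haar_m : left_haar m.
Local Notation C := (R[i]^o).
Local Notation Ri f := (m.-integrable setT (EFin \o f)).

Definition cut (D : set (borel G)) (nu : borel G -> C) : borel G -> C :=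
  fun y => (\1_D y)%:C%C * nu y.

Lemma normc_cut D nu y : normc (cut D nu y) = \1_D y * normc (nu y).
Proof. by rewrite normcM normc_real ger0_norm// indicE. Qed.

Lemma cut_integrable D nu : measurable D -> Cintegrable m nu ->
  Cintegrable m (cut D nu).
Proof.
move=> mD; apply: (@CintegrableMb _ _ _ _ _ _ 1).
  by apply: Cmeas_real; exact: measurable_indic.
by move=> y; rewrite normc_real indicE; case: (_ \in _); rewrite ?normr1 ?normr0.
Qed.

Lemma cutDI D A nu : cut D nu = (fun y => cut (D `&` A) nu y + cut (D `\` A) nu y).
Proof.
apply/funext => y; rewrite /cut -mulrDl; congr (_ * _).
rewrite -[RHS](rmorphD (real_complex R)); congr (real_complex R _).
rewrite !indicE in_setI in_setD; case: (y \in D); case: (y \in A) => //=; lra.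
Qed.

Lemma bfun_integral b : Cintegrable m b ->
  bounded_functional (fun f : C0 G R => Cintegral m (fun x => f x * b x))
    (\int[m]_x normc (b x)).
Proof.
move=> ib.
have ifb (f : C0 G R) : Cintegrable m (fun x => f x * b x).
  apply: (CintegrableMb _ _ ib (B := C0_sup f)); last exact: C0_supP.
  exact/Cmeas_continuous/C0_continuous.
split.
- by apply: Rintegral_ge0 => x _; exact: normc_ge0.
- move=> a f g; rewrite -CintegralZ// -CintegralD//; last exact: CintegrableZ.
  by apply: eq_Cintegral => x; rewrite addC0E scaleC0E mulrDl mulrA.
- move=> f; apply: le_trans (normc_Cintegral (ifb f)) _.
  rewrite mulrC -RintegralZl//; last exact: Cintegrable_normc.
  apply: le_Ri; [exact/Cintegrable_normc|exact/RiZ/Cintegrable_normc|].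
  by move=> x; rewrite normcM ler_wpM2r ?normc_ge0//; exact: C0_supP.
Qed.

Variables (F : G -> C0 G R) (B : R).
Hypothesis F_cont : forall y e, 0 < e ->
  \forall y' \near y, C0_sup (F y' - F y) <= e.
Hypothesis F_bd : forall y, C0_sup (F y) <= B.
Variable nu : borel G -> C.
Hypothesis inu : Cintegrable m nu.

Definition vint : G -> C := fun x => Cintegral m (fun y => F y x * nu y).

Lemma bfun_comp_continuous L M : bounded_functional L M ->
  continuous (fun y => L (F y)).
Proof.
move=> bL; have [M0 _ LM] := bL; move=> y; apply/cvg_normcP => e e0.
have M1 : 0 < M + 1 by rewrite ltr_wpDl.
apply: filterS (F_cont y (divr_gt0 e0 M1)) => y' h.
rewrite normcB -(bfunB _ _ bL); apply: le_lt_trans (LM _) _.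
apply: (@le_lt_trans _ _ (M * (e / (M + 1)))); first by rewrite ler_wpM2l.
by rewrite mulrCA gtr_pMr// ltr_pdivrMr// mul1r ltrDl.
Qed.

Lemma bfun_comp_bound L M : bounded_functional L M ->
  forall y, normc (L (F y)) <= M * B.
Proof.
move=> [M0 _ LM] y; apply: le_trans (LM _) _.
by rewrite ler_wpM2l.
Qed.

Lemma bfun_comp_integrable L M lam : bounded_functional L M ->
  Cintegrable m lam -> Cintegrable m (fun y => L (F y) * lam y).
Proof.
move=> bL ilam; apply: (@CintegrableMb _ _ _ m (fun y => L (F y)) lam (M * B)) => //; last exact: bfun_comp_bound.
exact/Cmeas_continuous/(bfun_comp_continuous bL).
Qed.

(* Near each point y the function F is within e of the constant F y; the local
   approximations by (\int nu) F y are glued by compact_union_ind. *)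
Lemma vint_approx_compact (K : set G) (e : R) : compact K -> 0 < e ->
  exists h : C0 G R, forall L M, bounded_functional L M ->
    normc (Cintegral m (fun y => L (F y) * cut K nu y) - L h) <=
    M * (e * \int[m]_y normc (cut K nu y)).
Proof.
move=> cK e0.
(* The claim is strengthened to all measurable [D] inside a Borel set [A] containing [K]. In a
   union, [D] can then be cut into its disjoint parts inside and outside [A1], so that the integrals
   in the error bounds add up. *)
suff [A [mA KA]] : exists A : set (borel G), [/\ measurable A, K `<=` A &
    forall D : set (borel G), measurable D -> D `<=` A ->
    exists h : C0 G R, forall L M, bounded_functional L M ->
    normc (Cintegral m (fun y => L (F y) * cut D nu y) - L h) <=
    M * (e * \int[m]_y normc (cut D nu y))].
  by apply => //; exact: borel_compact.
apply: (compact_union_ind (Q := fun K : set G =>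
    exists A : set (borel G), [/\ measurable A, K `<=` A &
    forall D : set (borel G), measurable D -> D `<=` A ->
    exists h : C0 G R, forall L M, bounded_functional L M ->
    normc (Cintegral m (fun y => L (F y) * cut D nu y) - L h) <=
    M * (e * \int[m]_y normc (cut D nu y))])) cK _ _ _ _.
- exists set0; split => // D mD; rewrite subset0 => ->; exists 0 => L M bL.
  have [M0 _ _] := bL.
  rewrite (bfun0 bL) subr0 (_ : (fun y => _) = fun=> 0).
    rewrite Cintegral0 normc0 mulr_ge0// mulr_ge0 ?(ltW e0)//.
    by apply: Rintegral_ge0 => x _; exact: normc_ge0.
  by apply/funext => y; rewrite /cut indic0 mul0r mulr0.
- move=> A B' [A1 [mA1 AA1 hA]] [B1 [mB1 BB1 hB]].
  exists (A1 `|` B1); split; first exact: measurableU.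
    by move=> x [/AA1|/BB1]; [left|right].
  move=> D mD DAB.
  have mDA : measurable (D `&` A1) by exact: measurableI.
  have mDB : measurable (D `\` A1) by exact: measurableD.
  have [h1 H1] := hA _ mDA (@subIsetr _ _ _).
  have [|h2 H2] := hB _ mDB; first by move=> x [/DAB[]].
  exists (h1 + h2) => L M bL.
  have i1 := cut_integrable mDA inu; have i2 := cut_integrable mDB inu.
  have -> : Cintegral m (fun y => L (F y) * cut D nu y) =
      Cintegral m (fun y => L (F y) * cut (D `&` A1) nu y) +
      Cintegral m (fun y => L (F y) * cut (D `\` A1) nu y).
    rewrite -CintegralD; [|exact: (bfun_comp_integrable bL)..].
    by apply: eq_Cintegral => y; rewrite -mulrDr (cutDI D A1).
  have -> : \int[m]_y normc (cut D nu y) = \int[m]_y normc (cut (D `&` A1) nu y) +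
      \int[m]_y normc (cut (D `\` A1) nu y).
    rewrite -RintegralD//; [|exact: Cintegrable_normc..].
    apply: eq_Rintegral => y _; rewrite !normc_cut -mulrDl; congr (_ * _).
    by rewrite !indicE in_setI in_setD; case: (y \in D); case: (y \in A1) => //=; lra.
  rewrite (bfunD _ _ bL) opprD addrACA mulrDr mulrDr.
  by apply: le_trans (ler_normcD _ _) _; apply: lerD; [exact: H1|exact: H2].
- by move=> A A' AA' [A1 [mA1 A1' hA]]; exists A1; split => // x /AA'/A1'.
- move=> y _; have : nbhs y (fun y' => C0_sup (F y' - F y) <= e) := F_cont y e0.
  rewrite nbhsE => -[U [oU Uy] UF].
  exists U; first by exists U.
  exists U; split => //; first exact: borel_open.
  move=> D mD DU; have iD := cut_integrable mD inu.
  exists (Cintegral m (cut D nu) *: F y) => L M bL; have [M0 _ LM] := bL.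
  rewrite (bfunZ _ _ bL) [X in _ - X]mulrC -CintegralZ// -CintegralB; last 2 first.
  - exact: (bfun_comp_integrable bL).
  - exact: CintegrableZ.
  have iB : Cintegrable m (fun y' => L (F y') * cut D nu y' - L (F y) * cut D nu y').
    by apply: CintegrableB; [exact: (bfun_comp_integrable bL)|exact: CintegrableZ].
  apply: le_trans (normc_Cintegral iB) _.
  rewrite mulrA -RintegralZl//; last exact: Cintegrable_normc.
  apply: le_Ri; [exact: Cintegrable_normc|exact/RiZ/Cintegrable_normc|].
  move=> y'; rewrite -mulrBl normcM normc_cut.
  rewrite indicE; case: (boolP (y' \in D)) => y'D /=; last by rewrite !mul0r !mulr0.
  rewrite mul1r ler_wpM2r ?normc_ge0// -(bfunB _ _ bL).
  by apply: le_trans (LM _) _; rewrite ler_wpM2l//; apply/UF/DU/set_mem.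
Qed.

(** One [h] serves all functionals at the same time. Point evaluations show that it is uniformly
    close to [vint]; for a general [L], the number [L h] is then close both to the value of [L] at
    [vint] and to the integral of [L (F y) * nu y]. *)
Lemma vint_approx (e : R) : 0 < e ->
  exists h : C0 G R, forall L M, bounded_functional L M ->
    normc (Cintegral m (fun y => L (F y) * nu y) - L h) <= M * e.
Proof.
move=> e0; have B0 : 0 <= B by apply: le_trans (F_bd 1%g); exact: C0_sup_ge0.
have B1 : 0 < 2 * (B + 1) by rewrite mulr_gt0// ltr_wpDl.
set N := \int[m]_y normc (nu y).
have N0 : 0 <= N by apply: Rintegral_ge0 => x _; exact: normc_ge0.
have N1 : 0 < 2 * (N + 1) by rewrite mulr_gt0// ltr_wpDl.
have [K cK tail] := Cintegrable_tight hausG lcG haar_m inu (divr_gt0 e0 B1).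
have [h H] := vint_approx_compact cK (divr_gt0 e0 N1).
exists h => L M bL; have [M0 _ LM] := bL.
have mK : measurable (K : set (borel G)) by exact: borel_compact.
have mK' : measurable (~` K : set (borel G)) by exact: measurableC.
have i1 := cut_integrable mK inu; have i2 := cut_integrable mK' inu.
have -> : Cintegral m (fun y => L (F y) * nu y) =
    Cintegral m (fun y => L (F y) * cut K nu y) +
    Cintegral m (fun y => L (F y) * cut (~` K) nu y).
  rewrite -CintegralD; [|exact: (bfun_comp_integrable bL)..].
  apply: eq_Cintegral => y; rewrite -mulrDr; congr (_ * _).
  have := congr1 (fun f => f y) (cutDI setT K nu).
  by rewrite /= setTI setTD => <-; rewrite /cut indicT/= mul1r.
rewrite addrAC; apply: le_trans (ler_normcD _ _) _.
have h1 : normc (Cintegral m (fun y => L (F y) * cut K nu y) - L h) <= M * (e / 2).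
  apply: le_trans (H L M bL) _; rewrite ler_wpM2l//.
  apply: (@le_trans _ _ (e / (2 * (N + 1)) * N)).
    rewrite ler_wpM2l//; first by rewrite divr_ge0// ltW.
    apply: le_Ri; [exact: Cintegrable_normc..|].
    move=> y; rewrite normc_cut indicE.
    by case: (_ \in _); rewrite ?mul1r ?mul0r ?normc_ge0.
  by rewrite mulrC mul_div_succ_le// ltW.
have h2 : normc (Cintegral m (fun y => L (F y) * cut (~` K) nu y)) <= M * (e / 2).
  apply: le_trans (normc_Cintegral (bfun_comp_integrable bL i2)) _.
  apply: (@le_trans _ _ (M * B * \int[m]_y normc (cut (~` K) nu y))).
    rewrite -RintegralZl//; last exact: Cintegrable_normc.
    apply: le_Ri.
    - exact/Cintegrable_normc/(bfun_comp_integrable bL).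
    - exact/RiZ/Cintegrable_normc.
    - move=> y; rewrite normcM ler_wpM2r ?normc_ge0//.
      exact: (bfun_comp_bound bL).
  rewrite -mulrA ler_wpM2l//.
  apply: (@le_trans _ _ (B * (e / (2 * (B + 1))))).
    rewrite ler_wpM2l//; apply/ltW; apply: le_lt_trans tail.
    rewrite le_eqVlt; apply/orP; left; apply/eqP.
    by apply: eq_Rintegral => y _; rewrite normc_cut.
  by rewrite mul_div_succ_le// ltW.
by have := lerD h1 h2; rewrite -mulrDr -splitr.
Qed.

Lemma vint_C0 : vint \in @C0pred G R.
Proof.
apply: C0_unif_closed => e e0; have [h H] := vint_approx e0; exists h => x.
by have := H _ _ (bfun_eval R x); rewrite mul1r.
Qed.

Lemma bfun_vint L M : bounded_functional L M ->
  L (to_C0 vint) = Cintegral m (fun y => L (F y) * nu y).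
Proof.
move=> bL; have [M0 _ LM] := bL; apply/eqP; rewrite -subr_eq0; apply/eqP.
apply: (@normc_eps0 R _ (M + M)) => e e0; have [h H] := vint_approx e0.
rewrite -(subrK (L h) (L _)) -addrA mulrDl.
apply: le_trans (ler_normcD _ _) _; apply: lerD.
  rewrite -(bfunB _ _ bL); apply: le_trans (LM _) _; rewrite ler_wpM2l//.
  apply: C0_sup_le => x; rewrite subC0E to_C0E ?vint_C0//.
  by have := H _ _ (bfun_eval R x); rewrite mul1r.
by rewrite normcB; exact: H.
Qed.

End vector_integral.

(** * Convolution *)

Section convolution.
Context (G : topologicalGroupType) (R : realType).
Hypothesis hausG : hausdorff_space G.
Hypothesis lcG : locally_compact [set: G].
Variable m : {measure set (borel G) -> \bar R}.
Hypothesis haar_m : left_haar m.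
Local Notation C := (R[i]^o).
Local Notation Ri f := (m.-integrable setT (EFin \o f)).

Definition conv (phi psi : borel G -> C) : borel G -> C :=
  fun x : G => Cintegral m (fun y : G => phi y * psi (y^-1 * x)%g).

Lemma ltrans_bd (f : C0 G R) y : C0_sup (to_C0 (ltrans f y)) <= C0_sup f.
Proof. by apply: C0_sup_le => x; rewrite to_C0E ?ltrans_C0//; exact: C0_supP. Qed.

Lemma rtrans_bd (f : C0 G R) y : C0_sup (to_C0 (rtrans f y)) <= C0_sup f.
Proof. by apply: C0_sup_le => x; rewrite to_C0E ?rtrans_C0//; exact: C0_supP. Qed.

Lemma conv_vint (phi : borel G -> C) (psi : C0 G R) :
  conv phi psi = vint m (fun y => to_C0 (ltrans psi y)) phi.
Proof.
apply/funext => x; apply: eq_Cintegral => y.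
by rewrite to_C0E ?ltrans_C0// mulrC.
Qed.

Lemma Cc_cutoff (K : set G) : compact K ->
  exists chi : G -> C, [/\ Cc chi, forall x, K x -> chi x = 1 &
    forall x, normc (chi x) <= 1].
Proof.
move=> cK; have [g [gc g01 gK [L [cL _ gL]]]] := locally_compact_urysohn R hausG lcG cK openT (@subsetT _ _).
exists (fun x => (g x)%:C%C); split.
- by apply: real_Cc => //; exists L.
- by move=> x /gK ->.
- by move=> x; rewrite normc_real; have /andP[g0 g1] := g01 x; rewrite ger0_norm.
Qed.

Section compact_support.
Variables (phi : borel G -> C) (psi : G -> C) (K : set G).
Hypothesis iphi : Cintegrable m phi.
Hypothesis cK : compact K.
Hypothesis phiK : vanish_off K phi.
Hypothesis cpsi : Cc psi.

Let psiE : psi = to_C0 psi :> (G -> C).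
Proof. by rewrite to_C0E//; exact: Cc_C0. Qed.

Lemma conv_C0 : conv phi psi \in @C0pred G R.
Proof.
rewrite psiE conv_vint; apply: (vint_C0 hausG lcG haar_m (B := C0_sup (to_C0 psi))) => //.
- by move=> y e e0; exact: ltrans_cont.
- by move=> y; exact: ltrans_bd.
Qed.

Lemma conv_Cc : Cc (conv phi psi).
Proof.
split; first by have := conv_C0; rewrite inE => -[].
have [_ [L cL psiL]] := cpsi.
exists [set (p.1 * p.2)%g | p in K `*` L]; first exact: compact_mulg.
move=> x nx; rewrite /conv (@eq_Cintegral _ _ _ _ _ (fun=> 0)) ?Cintegral0// => y.
have [Ky|/phiK ->] := pselect (K y); last by rewrite mul0r.
rewrite psiL ?mulr0// => Ly; apply: nx; exists (y, (y^-1 * x)%g) => //=.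
by rewrite mulVKg.
Qed.

(** Integration against [f] need not be bounded on C_0(G), for instance when [f = 1]. A cutoff [chi]
    equal to 1 on a product set carrying the convolution makes it so, which allows [bfun_vint]; left
    invariance then moves [y] into the argument of [f]. *)
Lemma conv_integral (f : G -> C) : continuous f ->
  Cintegral m (fun x => f x * conv phi psi x) =
  Cintegral m (fun y : G => phi y * Cintegral m (fun x : G => f (y * x)%g * psi x)).
Proof.
move=> fc; have [_ [L cL psiL]] := cpsi.
have cKL := compact_mulg cK cL.
have [chi [cchi chi1 _]] := Cc_cutoff cKL.
have ib : Cintegrable m (fun x => f x * chi x) by apply: Cc_integrable => //; exact: CcM.
have bL := bfun_integral ib.
have Fc : forall y (e : R), 0 < e -> \forall y' \near y,
    C0_sup (to_C0 (ltrans (to_C0 psi) y') - to_C0 (ltrans (to_C0 psi) y)) <= e.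
  by move=> y e e0; exact: ltrans_cont.
have Fb : forall y, C0_sup (to_C0 (ltrans (to_C0 psi) y)) <= C0_sup (to_C0 psi).
  by move=> y; exact: ltrans_bd.
have := bfun_vint hausG lcG haar_m Fc Fb iphi bL.
rewrite -conv_vint -psiE => e.
transitivity (Cintegral m (fun x => to_C0 (conv phi psi) x * (f x * chi x))).
  apply: eq_Cintegral => x; rewrite to_C0E ?conv_C0//.
  have [xKL|nx] := pselect ([set (p.1 * p.2)%g | p in K `*` L] x).
    by rewrite chi1// mulr1 mulrC.
  suff -> : conv phi psi x = 0 by rewrite mulr0 mul0r.
  rewrite /conv (@eq_Cintegral _ _ _ _ _ (fun=> 0)) ?Cintegral0// => y.
  have [Ky|/phiK ->] := pselect (K y); last by rewrite mul0r.
  rewrite psiL ?mulr0// => Ly; apply: nx; exists (y, (y^-1 * x)%g) => //=.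
  by rewrite mulVKg.
rewrite e; apply: eq_Cintegral => y; rewrite mulrC.
have [Ky|/phiK ->] := pselect (K y); last by rewrite !mul0r.
congr (_ * _).
have ik : Cintegrable m (fun x : G => f (y * x)%g * psi x).
  have fyc : continuous (fun x : G => f (y * x)%g).
    by move=> x; apply: continuous_comp; [exact: mulgl_continuous|exact: fc].
  exact: (Cc_integrable hausG haar_m (CcM cpsi fyc)).
rewrite -(haar_Cintegral haar_m y^-1%g ik); apply: eq_Cintegral => x.
have -> : to_C0 (ltrans psi y) x = psi (y^-1 * x)%g.
  by rewrite psiE to_C0E ?ltrans_C0.
rewrite mulVKg.
have [Lx|/psiL ->] := pselect (L (y^-1 * x)%g); last by rewrite mul0r mulr0.
rewrite chi1 ?mulr1 1?mulrC//.
by exists (y, (y^-1 * x)%g) => //=; rewrite mulVKg.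
Qed.

End compact_support.

Definition nconv (phi psi : borel G -> C) (x : G) : R :=
  \int[m]_(y in [set: borel G]) (normc (phi y) * normc (psi ((y : G)^-1 * x)%g)).

Lemma nconv_conv phi psi : conv (fun y => (normc (phi y))%:C%C)
  (fun y => (normc (psi y))%:C%C) = (fun x => (nconv phi psi x)%:C%C).
Proof.
apply/funext => x; rewrite /conv -Cintegral_real; apply: eq_Cintegral => y.
by rewrite -[RHS]/(real_complex R _) rmorphM.
Qed.

(** The test function 1 in [conv_integral], applied to absolute values, plays the part of Tonelli's
    theorem. All L^1 bounds on convolutions come from here. *)
Lemma nconv_integral (phi : borel G -> C) (psi : G -> C) (K : set G) :
  Cintegrable m phi -> compact K -> vanish_off K phi -> Cc psi ->
  [/\ continuous (nconv phi psi), Ri (nconv phi psi) &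
    \int[m]_x nconv phi psi x =
    (\int[m]_x normc (phi x)) * \int[m]_x normc (psi x)].
Proof.
move=> iphi cK phiK cpsi.
have ipsi := Cc_integrable hausG haar_m cpsi.
have in1 := Cintegrable_real (Cintegrable_normc iphi).
have v1 : vanish_off K (fun y => (normc (phi y))%:C%C : C).
  by move=> x /phiK ->; rewrite normc0.
have c1 := Cc_normc cpsi.
have cc := conv_Cc in1 cK v1 c1; rewrite nconv_conv in cc.
have ci := Cc_integrable hausG haar_m cc.
have [cc1 _] := cc; split.
- move=> x; exact: (continuous_comp (cc1 x) (@continuous_Re _ _)).
- by case: ci.
- have c1' : continuous ((fun=> 1) : G -> C) by move=> x; exact: cvg_cst.
  have := conv_integral in1 cK v1 c1 c1'; rewrite nconv_conv.
  under eq_Cintegral do rewrite mul1r.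
  rewrite Cintegral_real => e; apply: (@complexI R); rewrite e.
  have -> : Cintegral m (fun x : G => 1 * (normc (psi x))%:C%C) =
      (\int[m]_x normc (psi x))%:C%C :> C.
    by rewrite -Cintegral_real; apply: eq_Cintegral => x; rewrite mul1r.
  under eq_Cintegral do rewrite mulrC.
  by rewrite CintegralZ// Cintegral_real mulrC -[RHS]/(real_complex R _) rmorphM.
Qed.

(* Comparing the integrals of g and of g o inv through the integral of a
   convolution f * g replaces the modular function of G. *)
Lemma inv_integral_le (W : set G) : compact W -> exists2 c : R, 0 <= c &
  forall g : G -> R, continuous g -> (forall x, 0 <= g x) ->
    (forall x, ~ W x -> g x = 0) ->
    \int[m]_(x in [set: borel G]) g ((x : G)^-1)%g <= c * \int[m]_x g x.
Proof.
move=> cW; have [V V1 cV] := compact_nbhs lcG (1%g : G).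
have mV := borel_compact hausG cV; have Vfin := haar_compact haar_m cV.
have mV0 : 0 < fine (m V).
  rewrite -lte_fin fineK ?ge0_fin_numE//.
  apply: (@lt_le_trans _ _ (m V°)); last first.
    apply: le_measure; rewrite ?inE//; last exact: interior_subset.
    by apply: borel_open; exact: open_interior.
  by apply: (open_haar_gt0 hausG haar_m); [exact: open_interior|exists 1%g].
have cVW := compact_mulg cV (compact_invg cW).
have [f [cf f1 fb]] := Cc_cutoff cVW.
(* For [z] in [V], the convolution of |f| and [g] at [z] is the integral of [|f (z y)| g (y^-1)]. As
   [f] is 1 on V W^-1, this is at least the integral of [g (y^-1)]. Integrating over [V] and
   evaluating the total by [nconv_integral] gives this constant. *)
exists ((\int[m]_x normc (f x)) / fine (m V)).
  by rewrite divr_ge0 ?(ltW mV0)// Rintegral_ge0// => x _; exact: normc_ge0.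
move=> g gc g0 gW.
have [fc [K cK fK]] := cf.
have cg : Cc (fun x => (g x)%:C%C : C) by apply: real_Cc => //; exists W.
have if_ := Cc_integrable hausG haar_m cf.
have [nc ni ne] := nconv_integral if_ cK fK cg.
have gE x : normc ((g x)%:C%C : C) = g x by rewrite normc_real ger0_norm.
have igv : Ri (fun x : G => g (x^-1)%g).
  apply: real_Cc_Ri => //.
    by move=> x; apply: continuous_comp; [exact: invg_continuous|exact: gc].
  by exists [set x | W (x^-1)%g]; [exact: compact_invg|move=> x /gW].
set I := \int[m]_(x in _) _.
rewrite mulrAC ler_pdivlMr//.
have -> : \int[m]_x g x = \int[m]_x normc ((g x)%:C%C : C).
  by apply: eq_Rintegral => x _; rewrite gE.
rewrite -ne -(Rintegral_indic m mV) -RintegralZl//; last exact: Ri_indic.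
apply: le_Ri => //; first by apply: RiZ; exact: Ri_indic.
move=> z; rewrite indicE; case: (boolP (z \in V)) => zV; last first.
  rewrite mulr0; apply: Rintegral_ge0 => x _; rewrite mulr_ge0//; exact: normc_ge0.
rewrite mulr1.
have ik : Ri (fun y : borel G => normc (f y) * g ((y : G)^-1 * z)%g).
  have := Cintegrable_normc (@CintegrableMb _ _ _ m f (fun y : G => (g (y^-1 * z)%g)%:C%C : C) 1
     (Cmeas_continuous fc) fb _).
  rewrite (_ : _ \o _ = (fun y : borel G => normc (f y) * g ((y : G)^-1 * z)%g)).
    apply; apply: Cintegrable_real; apply: real_Cc_Ri => //.
      move=> y; apply: continuous_comp; last exact: gc.
      by apply: mulg_cvg; [exact: invg_continuous|exact: cvg_cst].
    exists [set y | (fun w => W (w^-1)%g) (z^-1 * y)%g].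
      by apply: (compact_translate (K := [set w | W (w^-1)%g])); exact: compact_invg.
    by move=> y /= nW; apply: gW; move: nW; rewrite invgM invgK.
  by apply/funext => y /=; rewrite normcM gE.
have -> : nconv f (fun x : borel G => (g x)%:C%C) z =
    \int[m]_(y in [set: borel G]) (normc (f (z * y)%g) * g ((y : G)^-1)%g).
  rewrite /nconv; under eq_Rintegral do rewrite gE.
  rewrite -(haar_Rintegral haar_m z ik); apply: eq_Rintegral => y _.
  by rewrite invgM mulgVK.
apply: le_Ri => //.
  have := haar_Ri haar_m z ik; congr (_.-integrable _ _).
  by apply/funext => y /=; rewrite invgM mulgVK.
move=> y; have [Wy|/gW ->] := pselect (W (y : G)^-1%g); last by rewrite mulr0.
rewrite f1 ?normc1 ?mul1r//.
by exists (z, y : G) => //; split => //; exact: set_mem.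
Qed.

(** Exceptional null sets for [psi] have to remain negligible in the variable [y] of [psi (y^-1 x)].
    Regularity of [m] reduces the claim to a continuous [g] supported in a small open neighbourhood
    of [N], to which [inv_integral_le] applies. *)
Lemma inv_null (N : set (borel G)) (K : set G) (x : G) : measurable N -> m N = 0%E ->
  compact K -> m [set y : borel G | K y /\ N ((y : G)^-1 * x)%g] = 0%E.
Proof.
move=> mN N0 cK.
pose W0 : set G := [set w | K (x * w^-1)%g].
have cW0 : compact W0.
  exact: (compact_invg (K := [set y | K (x * y)%g]) (@compact_translate G K x cK)).
have [chi [chic chi01 chi1 [L [cL _ chiL]]]] :=
  locally_compact_urysohn R hausG lcG cW0 openT (@subsetT _ _).
(* The constant [c] must be fixed before the open set [U] of small measure is chosen. So the
   inverses that occur are confined beforehand to [U0], an open set between [W0] and the compact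
   [L]. *)
pose U0 : set G := chi @^-1` [set r | 1/2 < r].
have oU0 : open U0 by apply: open_comp; [move=> ? _; exact: chic|exact: open_gt].
have U0L : U0 `<=` L.
  by move=> y; rewrite /U0/= => h; apply: contrapT => /chiL e; rewrite e in h; clear N0; lra.
have [c c0 hc] := inv_integral_le cL.
set S := [set y | _].
have mS : measurable (S : set (borel G)).
  have mt : measurable_fun setT ((fun y : G => (y^-1 * x)%g) : borel G -> borel G).
    apply: borel_continuousG => y.
    by apply: mulg_cvg; [exact: invg_continuous|exact: cvg_cst].
  have -> : S = (K : set (borel G)) `&` ((fun y : G => (y^-1 * x)%g) @^-1` N) by [].
  apply: measurableI; first exact: borel_compact.
  by rewrite -[X in measurable X]setTI; exact: mt.
apply/eqP; rewrite eq_le measure_ge0 andbT; apply/lee_addgt0Pr => e e0.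
rewrite add0e.
have c1 : 0 < c + 1 by rewrite ltr_wpDl.
have ec : 0 < e / (c + 1) by rewrite divr_gt0.
have [U [oU NU] mU] : exists2 U : set G, open U /\ N `<=` U & (m U < (e / (c + 1))%:E)%E.
  have : (ereal_inf [set m U | U in [set U : set G | open U /\ N `<=` U]] <
      (e / (c + 1))%:E)%E by rewrite -(haar_outer haar_m mN) N0 lte_fin.
  by move=> /ereal_inf_lt[_ [U UA <-] mU]; exists U.
pose V : set G := [set y | (U `&` U0) (y^-1)%g].
have oUU : open (U `&` U0) by exact: openI.
have oV : open V by apply: open_comp => // ? _; exact: invg_continuous.
rewrite -(haar_translate haar_m x mS).
apply: (@le_trans _ _ (m V)).
  apply: le_measure; rewrite ?inE.
  - have mt := @borel_continuousG G _ (@mulgl_continuous G x).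
    by rewrite -[X in measurable X]setTI; exact: mt.
  - exact: borel_open.
  - move=> y; rewrite /S/V/= => -[Kxy].
    rewrite invgM mulgVK => Ny; split; first exact: NU.
    rewrite /U0/= chi1; first by rewrite ltr_pdivrMr// mul1r ltr1n.
    by rewrite /W0/= invgK.
rewrite (haar_inner haar_m oV); apply: ub_ereal_sup => _ [K' [cK' K'V] <-].
have [g [gc g01 gK' [L' [cL' L'U gL']]]] := locally_compact_urysohn R hausG lcG
  (compact_invg cK') oUU (fun y K'y => ltac:(by have := K'V _ K'y; rewrite /V/= invgK)).
have mK' := borel_compact hausG cK'; have K'fin := haar_compact haar_m cK'.
have g0 y : 0 <= g y by have /andP[] := g01 y.
have ig : Ri g by apply: (real_Cc_Ri hausG haar_m gc); exists L'.
have igv : Ri (fun y : G => g (y^-1)%g).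
  apply: real_Cc_Ri => //.
    by move=> y; apply: continuous_comp; [exact: invg_continuous|exact: gc].
  by exists [set y | L' (y^-1)%g]; [exact: compact_invg|move=> y /gL'].
have Ufin : (m U < +oo)%E by apply: lt_trans mU _; rewrite ltry.
have mU' := borel_open oU.
rewrite -(@fineK _ (m K')) ?ge0_fin_numE// lee_fin -(Rintegral_indic m mK').
apply: (@le_trans _ _ (\int[m]_(y in [set: borel G]) g ((y : G)^-1)%g)).
  apply: le_Ri => //; first exact: Ri_indic.
  move=> y; rewrite indicE; case: (boolP (y \in K')) => yK //.
  by rewrite gK'//= invgK; exact: set_mem.
apply: le_trans (hc g gc g0 _) _.
  by move=> y nL; apply: gL' => /L'U[_ /U0L].
apply: (@le_trans _ _ ((c + 1) * (e / (c + 1)))); last by rewrite mulrC divfK// gt_eqF.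
apply: ler_pM => //.
- by apply: Rintegral_ge0 => y _.
- by rewrite lerDl.
- rewrite -lee_fin; apply: (@le_trans _ _ (m U)); last exact: ltW.
  rewrite -(@fineK _ (m U)) ?ge0_fin_numE// lee_fin -(Rintegral_indic m mU').
  apply: le_Ri => //; first exact: Ri_indic.
  move=> y; rewrite indicE; case: (boolP (y \in U)) => yU.
    by have /andP[] := g01 y.
  by rewrite gL'// => /L'U[] /(notin_set_not yU).
Qed.

End convolution.

(** * Approximation of integrable functions by sequences, and the dual action on C_0(G) *)

Section convolution_existence.
Context (G : topologicalGroupType) (R : realType).
Hypothesis hausG : hausdorff_space G.
Hypothesis lcG : locally_compact [set: G].
Variable m : {measure set (borel G) -> \bar R}.
Hypothesis haar_m : left_haar m.
Local Notation C := (R[i]^o).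
Local Notation Ri f := (m.-integrable setT (EFin \o f)).

Lemma R_ae0 (h : borel G -> R) : Ri h -> (forall x, 0 <= h x) ->
  (forall e, 0 < e -> \int[m]_x h x <= e) -> {ae m, forall x, h x = 0}.
Proof.
move=> ih h0 he.
have I0 : \int[m]_x h x = 0.
  apply/eqP; rewrite eq_le Rintegral_ge0// andbT; apply/ler_addgt0Pr => e e0.
  by rewrite add0r; exact: he.
have : (\int[m]_x `|(h x)%:E| = 0)%E.
  under eq_integral => x _ do rewrite gee0_abs ?lee_fin//.
  by rewrite -(fineK (integrable_fin_num measurableT ih)) -[fine _]/(\int[m]_x h x) I0.
move/(ae_eq_integral_abs m measurableT (measurable_int _ ih)).
by apply: filterS => x /(_ I) [].
Qed.

(** This stands in for sigma-compactness of [G]: compact sets can be chosen so that the mass left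
    outside the n-th one is below [1/(n+1)]. *)
Lemma compact_exhaustion (phi : borel G -> C) : Cintegrable m phi ->
  exists K_ : nat -> set G, [/\ forall n, compact (K_ n),
    forall n, K_ n `<=` K_ n.+1 &
    {ae m, forall y, phi y = 0 \/ exists n, K_ n y}].
Proof.
move=> iphi.
have /boolp.choice[L_ HL] : forall n : nat, exists L : set G, compact L /\
    \int[m]_x (\1_(~` L) x * normc (phi x)) < n.+1%:R^-1.
  move=> n.
  have n1 : 0 < (n.+1%:R : R)^-1 by rewrite invr_gt0.
  by have [K cK hK] := Cintegrable_tight hausG lcG haar_m iphi n1; exists K.
pose K_ := fix K_ n := if n is k.+1 then K_ k `|` L_ k.+1 else L_ 0%N.
have LK n : L_ n `<=` K_ n by case: n => // n x /= Lx; right.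
have cK n : compact (K_ n).
  elim: n => [|n IH]; first by case: (HL 0%N).
  by apply: compactU => //; case: (HL n.+1).
exists K_; split => //; first by move=> n x Kx; left.
pose A : set (borel G) := \bigcap_n ~` (K_ n).
have mA : measurable A.
  by apply: bigcap_measurable => // n _; apply: measurableC; exact: borel_compact.
have inphi := Cintegrable_normc iphi.
have : {ae m, forall x, \1_A x * normc (phi x) = 0}.
  apply: R_ae0.
  - exact: Ri_cut.
  - by move=> x; rewrite mulr_ge0 ?normc_ge0// indicE.
  - move=> e e0; have [n ne] : exists n, (n.+1%:R : R)^-1 < e.
      have [n _ /(_ n (leqnn n))] := near_infty_natSinv_lt (PosNum e0).
      by exists n.
    apply/ltW; apply: lt_trans ne; case: (HL n) => cL; apply: le_lt_trans.
    have mL : measurable (~` L_ n : set (borel G)).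
      by apply: measurableC; exact: borel_compact.
    apply: le_Ri; [exact: Ri_cut..|] => x.
    rewrite ler_wpM2r ?normc_ge0// !indicE ler_nat.
    case: (boolP (x \in A)) => // /set_mem Ax.
    by rewrite mem_set// => Lx; exact: (Ax n I (LK _ _ Lx)).
apply: filterS => y /eqP; rewrite mulf_eq0 => /orP[|/eqP/eq0_normc ->]; last by left.
rewrite indicE; case: (boolP (y \in A)) => [|yA]; first by rewrite oner_eq0.
move=> _; right; apply: contrapT => nK; apply: (notin_set_not yA) => n _ Ky.
by apply: nK; exists n.
Qed.

(** [B_ n] is a partial sum of [|psi_ 0| + |psi_ 1 - psi_ 0| + ...]. These increasing majorants are
    again in C_c(G), so that [nconv_integral] applies to them, and their integrals exceed that of
    |psi| by at most [d]. *)
Lemma Cc_sequence (psi : borel G -> C) (d : R) : Cintegrable m psi -> 0 < d ->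
  exists (psi_ : nat -> G -> C) (B_ : nat -> G -> R), [/\
    forall n, Cc (psi_ n) /\ Cc (fun x => (B_ n x)%:C%C : C),
    forall n x, normc (psi_ n x) <= B_ n x /\ B_ n x <= B_ n.+1 x,
    forall n, \int[m]_x normc (psi x - psi_ n x) <= d / (2 ^+ n),
    forall n, \int[m]_x B_ n x <= \int[m]_x normc (psi x) + d &
    {ae m, forall x, psi_ ^~ x @ \oo --> psi x}].
Proof.
move=> ipsi d0.
pose dn n : R := d / 4 / 2 ^+ n.
have dn0 n : 0 < dn n by rewrite !divr_gt0// exprn_gt0.
have dnS n : dn n = 2 * dn n.+1.
  by rewrite /dn exprS; field; rewrite expf_neq0.
have /boolp.choice[psi_ Hp] : forall n, exists g : G -> C,
    Cc g /\ \int[m]_x normc (psi x - g x) < dn n.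
  move=> n.
  by have [g cg hg] := Cc_dense hausG lcG haar_m ipsi (dn0 n); exists g.
have cp n : Cc (psi_ n) by case: (Hp n).
have ip n : Cintegrable m (psi_ n) := Cc_integrable hausG haar_m (cp n).
have idiff n : Ri (fun x => normc (psi x - psi_ n x)).
  exact/Cintegrable_normc/CintegrableB.
pose B_ := fix B_ n (x : G) : R := if n is k.+1 then
  B_ k x + normc (psi_ k.+1 x - psi_ k x) else normc (psi_ 0%N x).
have cB n : Cc (fun x => (B_ n x)%:C%C : C).
  elim: n => [|n IH] /=; first exact: Cc_normc.
  have := CcD IH (Cc_normc (CcB (cp n.+1) (cp n))).
  by congr Cc; apply/funext => x; rewrite -[RHS]/(real_complex R _) rmorphD.
have iB n : Ri (B_ n) by have [] := Cc_integrable hausG haar_m (cB n).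
have isub n : Ri (fun x => normc (psi_ n.+1 x - psi_ n x)).
  exact/Cintegrable_normc/CintegrableB.
exists psi_, B_; split => //.
- move=> n x; split; last by rewrite /= lerDl normc_ge0.
  elim: n => [|n IH] //=; rewrite -{1}(subrK (psi_ n x) (psi_ n.+1 x)) addrC.
  by apply: le_trans (ler_normcD _ _) _; rewrite lerD2r.
- move=> n; case: (Hp n) => _ /ltW/le_trans; apply.
  rewrite /dn ler_pM2r ?invr_gt0 ?exprn_gt0//; lra.
(* Passing from [n] to [n.+1] adds at most [dn n + dn n.+1 = 3 * dn n.+1]. The correction [3 * dn n]
   absorbs it because [dn] is halved at each step; the start is [d = 4 * dn 0]. *)
- suff h n : \int[m]_x B_ n x <= \int[m]_x normc (psi x) + d - 3 * dn n.
    by move=> n; apply: le_trans (h n) _; have := dn0 n; lra.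
  elim: n => [|n IH].
    have -> : d = 4 * dn 0%N by rewrite /dn expr0; field.
    apply: (@le_trans _ _ (\int[m]_x (normc (psi x) + normc (psi x - psi_ 0%N x)))).
      apply: le_Ri => //.
        by apply: RiD => //; exact: Cintegrable_normc.
      move=> x /=; rewrite (normcB (psi x)) -{1}(subrK (psi x) (psi_ 0%N x)) addrC.
      exact: ler_normcD.
    rewrite RintegralD//; last exact: Cintegrable_normc.
    by case: (Hp 0%N) => _; lra.
  rewrite /= RintegralD//.
  have : \int[m]_x normc (psi_ n.+1 x - psi_ n x) <= dn n + dn n.+1.
    apply: (@le_trans _ _ (\int[m]_x (normc (psi x - psi_ n x) +
        normc (psi x - psi_ n.+1 x)))).
      apply: le_Ri => //; first exact: RiD.
      move=> x; rewrite (normcB (psi x) (psi_ n.+1 x)) [leRHS]addrC.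
      have -> : psi_ n.+1 x - psi_ n x = (psi_ n.+1 x - psi x) + (psi x - psi_ n x).
        by rewrite addrA subrK.
      exact: ler_normcD.
    rewrite RintegralD//; case: (Hp n) => _; case: (Hp n.+1) => _; lra.
  by move: IH; rewrite (dnS n); lra.
(* The L^1 distances are summable, so the series of [|psi - psi_ k|] converges almost everywhere and
   its terms tend to 0. *)
- pose s_ n (x : borel G) := \sum_(k < n) normc (psi x - psi_ k x).
  have s0 : s_ 0%N = fun=> 0 by apply/funext => x; rewrite /s_ big_ord0.
  have sS n : s_ n.+1 = fun x => s_ n x + normc (psi x - psi_ n x).
    by apply/funext => x; rewrite /s_ big_ord_recr.
  have is_ n : Ri (s_ n).
    by elim: n => [|n IH]; [rewrite s0; exact: Ri0|rewrite sS; exact: RiD].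
  have [||n|g [ig g0 _ sg _]] := @R_levi _ _ _ m s_ d is_.
  + by move=> n x; apply: sumr_ge0 => k _; exact: normc_ge0.
  + by move=> n x; rewrite sS lerDl normc_ge0.
  + suff h : \int[m]_x s_ n x <= 2 * dn 0%N - 2 * dn n.
      apply: le_trans h _; rewrite /dn expr0.
      have : 0 < d / 4 / 2 ^+ n := dn0 n; lra.
    elim: n => [|n IH].
      by rewrite subrr s0 Rintegral_cst// mul0r.
    by rewrite sS RintegralD//; case: (Hp n) => _; move: IH; have := dnS n; lra.
  apply: filterS sg => x sx; apply/cvg_normcP => e e0.
  have := sx; rewrite -cvg_shiftS => sx1.
  have h0 : s_ n.+1 x - s_ n x @[n --> \oo] --> (0 : R).
    by rewrite -(subrr (g x)); apply: (@cvgB _ R^o).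
  have /cvgrPdist_lt/(_ e e0) := h0.
  apply: filterS => n; rewrite /= sub0r normrN sS addrAC subrr add0r -normcB.
  by apply: le_lt_trans; exact: ler_norm.
Qed.

Lemma cvgM_complex (u v : nat -> C) (a b : C) : u @ \oo --> a -> v @ \oo --> b ->
  u n * v n @[n --> \oo] --> a * b.
Proof. by move=> ua vb; have := cvgM ua vb; apply. Qed.

(** The adjoint of right convolution by [psi]: the product of [mu] and [psi] takes at [f] the value
    of [mu] at [rconv f psi]. *)
Definition rconv (f : G -> C) (psi : borel G -> C) : G -> C :=
  fun x => Cintegral m (fun y : G => f (x * y)%g * psi y).

Lemma rconv_vint (f : C0 G R) psi :
  rconv f psi = vint m (fun y => to_C0 (rtrans f y)) psi.
Proof.
by apply/funext => x; apply: eq_Cintegral => y; rewrite to_C0E ?rtrans_C0.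
Qed.

Lemma rconv_C0 (f : C0 G R) psi : Cintegrable m psi -> rconv f psi \in @C0pred G R.
Proof.
move=> ipsi; rewrite rconv_vint.
apply: (vint_C0 hausG lcG haar_m (B := C0_sup f)) => //.
- by move=> y e e0; exact: rtrans_cont.
- by move=> y; exact: rtrans_bd.
Qed.

Lemma rconv_integrable (f : C0 G R) (x : G) psi : Cintegrable m psi ->
  Cintegrable m (fun y : borel G => f (x * y)%g * psi y).
Proof.
move=> ipsi; apply: (@CintegrableMb _ _ _ m (fun y : borel G => f (x * y)%g) psi (C0_sup f)) => //.
  apply: Cmeas_continuous => y.
  by apply: continuous_comp; [exact: mulgl_continuous|exact: C0_continuous].
by move=> y; exact: C0_supP.
Qed.

Lemma rconv_bound (f : C0 G R) psi x : Cintegrable m psi ->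
  normc (rconv f psi x) <= C0_sup f * \int[m]_y normc (psi y).
Proof.
move=> ipsi; apply: le_trans (normc_Cintegral (rconv_integrable f x ipsi)) _.
rewrite -RintegralZl//; last exact: Cintegrable_normc.
apply: le_Ri; [exact/Cintegrable_normc/rconv_integrable|exact/RiZ/Cintegrable_normc|].
by move=> y; rewrite normcM ler_wpM2r ?normc_ge0//; exact: C0_supP.
Qed.

Lemma rconvB (f : C0 G R) psi psi' x : Cintegrable m psi -> Cintegrable m psi' ->
  rconv f (fun y => psi y - psi' y) x = rconv f psi x - rconv f psi' x.
Proof.
move=> ipsi ipsi'; rewrite /rconv -CintegralB; [|exact: rconv_integrable..].
by apply: eq_Cintegral => y; rewrite mulrBr.
Qed.

End convolution_existence.

(** * Convolution of two integrable functions *)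

Section convolution_ae.
Context (G : topologicalGroupType) (R : realType).
Hypothesis hausG : hausdorff_space G.
Hypothesis lcG : locally_compact [set: G].
Variable m : {measure set (borel G) -> \bar R}.
Hypothesis haar_m : left_haar m.
Local Notation C := (R[i]^o).
Local Notation Ri f := (m.-integrable setT (EFin \o f)).

Lemma cvg_complex_near_eq (u : nat -> C) (a : C) :
  (\forall n \near \oo, u n = a) -> u @ \oo --> a.
Proof.
move=> ua; apply/cvg_normcP => e e0.
by apply: filterS ua => n ->; rewrite subrr normc0.
Qed.

Local Notation rconv := (rconv m).
(** [R_levi] is used twice to find majorants: in [x] for the convolutions [A_ n] of |phi_ n| and
    [B_ n], then in [y] at each [x] where [A] bounds all of them. The slack [d] comes from the
    [B_ n]; it disappears later because the convolution itself does not depend on [d]. *)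
Lemma conv_exists (phi psi : borel G -> C) (d : R) :
  Cintegrable m phi -> Cintegrable m psi -> 0 < d ->
  exists h : borel G -> C, [/\ Cintegrable m h,
    \int[m]_x normc (h x) <=
      (\int[m]_x normc (phi x)) * (\int[m]_x normc (psi x) + d),
    {ae m, forall x : borel G,
      Cintegrable m (fun y : borel G => phi y * psi ((y : G)^-1 * x)%g) /\
      h x = conv m phi psi x} &
    forall f : C0 G R, Cintegral m (fun x => f x * h x) =
      Cintegral m (fun y => phi y * rconv f psi y)].
Proof.
move=> iphi ipsi d0.
have [K_ [cK KS Kphi]] := compact_exhaustion hausG lcG haar_m iphi.
have [psi_ [B_ [cpB pB psid Bd psic]]] := Cc_sequence hausG lcG haar_m ipsi d0.
have mK n : measurable (K_ n : set (borel G)) by exact: borel_compact.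
pose phi_ n := cut (K_ n) phi.
have iphi_ n : Cintegrable m (phi_ n) by exact: cut_integrable.
have phiK n : vanish_off (K_ n) (phi_ n).
  move=> x nK; rewrite /phi_ /cut indicE (_ : x \in K_ n = false) ?mul0r//.
  by apply/negbTE/negP => /set_mem.
have cp n : Cc (psi_ n) by case: (cpB n).
have cB n : Cc (fun x => (B_ n x)%:C%C : C) by case: (cpB n).
have B0 n x : 0 <= B_ n x by case: (pB n x) => + _; apply: le_trans; exact: normc_ge0.
have nB n x : normc ((B_ n x)%:C%C : C) = B_ n x by rewrite normc_real ger0_norm.
have nphi_ n y : normc (phi_ n y) <= normc (phi_ n.+1 y).
  rewrite !normc_cut ler_wpM2r ?normc_ge0// !indicE ler_nat.
  by case: (boolP (y \in K_ n)) => // /set_mem/KS Ky; rewrite mem_set.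
have phi_le n y : normc (phi_ n y) <= normc (phi y).
  rewrite normc_cut indicE; case: (_ \in _); first by rewrite mul1r.
  by rewrite mul0r normc_ge0.
pose Bc n := (fun x => (B_ n x)%:C%C : C) : borel G -> C.
pose A_ n := nconv m (phi_ n) (Bc n).
have A_E n x : A_ n x = \int[m]_(y in [set: borel G])
    (normc (phi_ n y) * B_ n ((y : G)^-1 * x)%g).
  by apply: eq_Rintegral => y _; rewrite nB.
have iA n := nconv_integral hausG lcG haar_m (iphi_ n) (cK n) (phiK n) (cB n).
have inv_cont (x : G) : continuous (fun y : G => (y^-1 * x)%g).
  by move=> y; apply: mulg_cvg; [exact: invg_continuous|exact: cvg_cst].
have iprod n (x : G) : Ri (fun y : borel G => normc (phi_ n y) * B_ n ((y : G)^-1 * x)%g).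
  have [Bn _ BBn] := Cc_bounded (cB n).
  have := Cintegrable_normc (@CintegrableMb _ _ _ m
    (fun y : G => (B_ n (y^-1 * x)%g)%:C%C : C) (phi_ n) Bn _ _ (iphi_ n)).
  rewrite (_ : _ \o _ = (fun y : borel G => normc (phi_ n y) * B_ n ((y : G)^-1 * x)%g)).
    apply; last by move=> y; exact: (BBn (y^-1 * x)%g).
    apply: Cmeas_continuous => y.
    apply: (@continuous_comp _ _ _ (fun y : G => (y^-1 * x)%g) (Bc n)).
      exact: inv_cont.
    by have [+ _] := cB n; exact.
  by apply/funext => y /=; rewrite normcM nB mulrC.
have prodS n (x y : G) : normc (phi_ n y) * B_ n (y^-1 * x)%g <=
    normc (phi_ n.+1 y) * B_ n.+1 (y^-1 * x)%g.
  by apply: ler_pM => //; [exact: normc_ge0|case: (pB n (y^-1 * x)%g)].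
pose M := (\int[m]_x normc (phi x)) * (\int[m]_x normc (psi x) + d).
have [||||A [riA A0 AA _ AM]] := @R_levi _ _ _ m A_ M.
- by move=> n; case: (iA n).
- by move=> n x; apply: Rintegral_ge0 => y _; rewrite mulr_ge0// normc_ge0.
- by move=> n x; rewrite !A_E; apply: le_Ri.
- move=> n; case: (iA n) => _ _ ->; apply: ler_pM.
  + by apply: Rintegral_ge0 => y _; exact: normc_ge0.
  + by apply: Rintegral_ge0 => y _; exact: normc_ge0.
  + by apply: le_Ri; [exact: Cintegrable_normc..|].
  + by rewrite (_ : (fun x => _) = B_ n)//; apply/funext => x; rewrite nB.
have [N2 [mN2 N20 psiN2]] := psic.
have cut_phi (y : G) n : K_ n y -> phi_ ^~ y @ \oo --> phi y.
  move=> Ky; apply: cvg_complex_near_eq; exists n => // k /= nk.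
  have Kk : K_ k y.
    elim: k nk => [|k IH]; first by rewrite leqn0 => /eqP <-.
    by rewrite leq_eqVlt => /orP[/eqP <-//|]; rewrite ltnS => /IH/KS.
  by rewrite /phi_ /cut indicE mem_set// mul1r.
have phi_cvg (y : G) : phi y = 0 \/ (exists n, K_ n y) -> phi_ ^~ y @ \oo --> phi y.
  case=> [y0|[n]]; last exact: cut_phi.
  by apply: cvg_complex_near_eq; apply: nearW => n; rewrite /phi_ /cut y0 mulr0.
have h_bound n x : normc (conv m (phi_ n) (psi_ n) x) <= A_ n x.
  have ii : Cintegrable m (fun y : borel G => phi_ n y * psi_ n ((y : G)^-1 * x)%g).
    have [Bn _ BBn] := Cc_bounded (cp n).
    rewrite (_ : (fun y => _) = fun y : borel G => psi_ n ((y : G)^-1 * x)%g * phi_ n y).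
      apply: (@CintegrableMb _ _ _ m (fun y : borel G => psi_ n ((y : G)^-1 * x)%g) _ Bn) => //.
      apply: Cmeas_continuous => y.
      apply: (@continuous_comp _ _ _ (fun y : G => (y^-1 * x)%g) (psi_ n)).
        exact: inv_cont.
      by have [+ _] := cp n; exact.
    by apply/funext => y; rewrite mulrC.
  apply: le_trans (normc_Cintegral ii) _; rewrite A_E.
  apply: le_Ri => //; first exact: Cintegrable_normc.
  move=> y; rewrite normcM ler_wpM2l ?normc_ge0//.
  by case: (pB n (y^-1 * x)%g).
have main : {ae m, forall x : G,
    Cintegrable m (fun y : borel G => phi y * psi ((y : G)^-1 * x)%g) /\
    conv m (phi_ n) (psi_ n) x @[n --> \oo] --> conv m phi psi x /\
    forall n, A_ n x <= A x}.
  apply: filterS AA => x Ax.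
  have [||||g [ig g0 gg _ _]] := @R_levi _ _ _ m
    (fun n (y : borel G) => normc (phi_ n y) * B_ n ((y : G)^-1 * x)%g) (A x).
  - by [].
  - by move=> n y; rewrite mulr_ge0// normc_ge0.
  - by move=> n y; exact: prodS.
  - by move=> n; rewrite -A_E.
  (* [N2] contains the points where [psi_ n] fails to converge to [psi]. Its preimage is shown to be
     null only within each [K_ n], which is enough: elsewhere [phi] vanishes almost everywhere. *)
  have nullK : {ae m, forall y : G, forall n, ~ (K_ n y /\ N2 (y^-1 * x)%g)}.
    apply/ae_foralln => n; exists [set y : G | K_ n y /\ N2 (y^-1 * x)%g]; split.
    + have -> : [set y : G | K_ n y /\ N2 (y^-1 * x)%g] = (K_ n : set (borel G)) `&`
          ((fun y : G => (y^-1 * x)%g) @^-1` N2) by [].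
      apply: measurableI => //.
      rewrite -[X in measurable X]setTI.
      exact: (borel_continuousG (inv_cont x)).
    + exact: (inv_null hausG lcG haar_m).
    + by move=> y /= /contrapT.
  have [|||||i1 c1] := @C_dominated _ _ _ m
    (fun n (y : borel G) => phi_ n y * psi_ n ((y : G)^-1 * x)%g)
    (fun y : borel G => phi y * psi ((y : G)^-1 * x)%g) g.
  - move=> n; apply: CmeasM; first exact: (Cintegrable_meas (iphi_ n)).
    apply: (Cmeas_comp (inv_cont x)); apply: Cmeas_continuous.
    by have [] := cp n.
  - apply: CmeasM; first exact: (Cintegrable_meas iphi).
    exact: (Cmeas_comp (inv_cont x) (Cintegrable_meas ipsi)).
  - by [].
  - apply: filterS2 Kphi nullK => y hy nN.
    have [y0|[n Ky]] := hy.
      rewrite y0 mul0r; apply: cvg_complex_near_eq; apply: nearW => n.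
      by rewrite /phi_ /cut y0 mulr0 mul0r.
    apply: (cvgM_complex (phi_cvg y hy)).
    by apply: contrapT => h; apply: (nN n); split => //; exact: psiN2.
  - apply: filterS gg => y hy n; apply: le_trans (hy n).
    by rewrite normcM ler_wpM2l ?normc_ge0//; case: (pB n (y^-1 * x)%g).
  by split => //; split.
have [N3 [mN3 N30 hN3]] := main.
have off x : ~ N3 x -> Cintegrable m (fun y : borel G => phi y * psi ((y : G)^-1 * x)%g) /\
    conv m (phi_ n) (psi_ n) x @[n --> \oo] --> conv m phi psi x /\
    forall n, A_ n x <= A x.
  by move=> nx; apply: contrapT => h; apply: nx; exact: hN3.
(* Everything is set to 0 on the exceptional set [N3]. Then [h_ n] tends to [h] at every point,
   which gives the measurability of [h]. *)
pose h := cut (~` N3) (conv m phi psi).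
pose h_ n := cut (~` N3) (conv m (phi_ n) (psi_ n)).
have mN3' : measurable (~` N3) by exact: measurableC.
have ic n : Cc (conv m (phi_ n) (psi_ n)).
  by apply: (conv_Cc hausG lcG haar_m (iphi_ n) (cK n)).
have ih_ n : Cintegrable m (h_ n).
  by apply: cut_integrable => //; exact: (Cc_integrable hausG haar_m (ic n)).
have hh x : h_ ^~ x @ \oo --> h x.
  have [Nx|/off[_ [c _]]] := pselect (N3 x).
    have z (q : borel G -> C) : cut (~` N3) q x = 0.
      by rewrite /cut indicE in_setC mem_set// mul0r.
    rewrite /h z; apply: cvg_complex_near_eq; apply: nearW => n.
    by rewrite /h_ z.
  have c0 : ((fun=> (\1_(~` N3) x)%:C%C) : nat -> C) @ \oo --> ((\1_(~` N3) x)%:C%C : C).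
    exact: cvg_cst.
  exact: (cvgM_complex c0 c).
have h_A n x : normc (h_ n x) <= A x.
  rewrite normc_cut indicE in_setC; case: (boolP (x \in N3)) => xN /=.
    by rewrite mul0r.
  rewrite mul1r; have [_ [_ /(_ n)]] := off x (notin_set_not xN).
  by apply: le_trans; exact: h_bound.
have mh : Cmeas h.
  split.
    apply: (@measurable_fun_cvg _ _ _ _ (fun n x => complex.Re (h_ n x))).
      by move=> n; case: (Cintegrable_meas (ih_ n)).
    by move=> x _; have /cvg_complexP[] := hh x.
  apply: (@measurable_fun_cvg _ _ _ _ (fun n x => complex.Im (h_ n x))).
    by move=> n; case: (Cintegrable_meas (ih_ n)).
  by move=> x _; have /cvg_complexP[] := hh x.
have hA x : normc (h x) <= A x.
  have c : normc (h_ n x) @[n --> \oo] --> normc (h x).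
    exact: (continuous_cvg _ (@normc_continuous R (h x)) (hh x)).
  by apply: (cvgr_to_le c); apply: nearW => n; exact: h_A.
have ih : Cintegrable m h by exact: (Cintegrable_dom mh riA).
exists h; split => //.
- by apply: le_trans AM; apply: le_Ri => //; exact: Cintegrable_normc.
- exists N3; split => // x nP; apply: contrapT => nN3; apply: nP => /=.
  have [i [_ _]] := off _ nN3; split => //.
  by rewrite /h /cut indicE mem_set// mul1r.
- move=> f; have fm : Cmeas (f : borel G -> C) by exact/Cmeas_continuous/C0_continuous.
  have [|||||_ c1] := @C_dominated _ _ _ m (fun n x => f x * h_ n x)
    (fun x => f x * h x) (fun x => C0_sup f * A x).
  + by move=> n; apply: CmeasM => //; exact: (Cintegrable_meas (ih_ n)).
  + exact: CmeasM.
  + exact: RiZ.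
  + apply: aeW => x.
    have c0 : ((fun=> f x) : nat -> C) @ \oo --> (f x : C) by exact: cvg_cst.
    exact: (cvgM_complex c0 (hh x)).
  + apply: aeW => x n; rewrite normcM ler_pM ?normc_ge0//; exact: C0_supP.
  (* The two sides of the identity are limits of the same numbers: [conv_integral] identifies them
     for compactly supported data, and dominated convergence applies on each side. *)
  have hE n : Cintegral m (fun x => f x * h_ n x) =
      Cintegral m (fun y => phi_ n y * rconv f (psi_ n) y).
    rewrite -(conv_integral hausG lcG haar_m (iphi_ n) (cK n) (phiK n) (cp n) (@C0_continuous _ _ f)).
    have ifc : Cintegrable m (fun x => f x * conv m (phi_ n) (psi_ n) x).
      apply: (CintegrableMb fm (B := C0_sup f)); first by move=> x; exact: C0_supP.
      exact: (Cc_integrable hausG haar_m (ic n)).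
    apply: ae_eq_Cintegral => //.
      apply: (CintegrableMb fm (B := C0_sup f)); first by move=> x; exact: C0_supP.
      exact: ih_.
    exists N3; split => // x nP; apply: contrapT => nN3; apply: nP => /=.
    by rewrite /h_ /cut indicE mem_set// mul1r.
  have ip n : Cintegrable m (psi_ n) := Cc_integrable hausG haar_m (cp n).
  have rm (q : borel G -> C) : Cintegrable m q -> Cmeas (rconv f q : borel G -> C).
    by move=> iq; apply: Cmeas_continuous; have := rconv_C0 hausG lcG haar_m f iq; rewrite inE => -[].
  have [|||||_ c2] := @C_dominated _ _ _ m (fun n y => phi_ n y * rconv f (psi_ n) y)
    (fun y => phi y * rconv f psi y)
    (fun y => C0_sup f * (\int[m]_x normc (psi x) + d) * normc (phi y)).
  + by move=> n; apply: CmeasM; [exact: (Cintegrable_meas (iphi_ n))|exact: rm].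
  + by apply: CmeasM; [exact: (Cintegrable_meas iphi)|exact: rm].
  + exact/RiZ/Cintegrable_normc.
  + apply: filterS Kphi => y hy; apply: (cvgM_complex (phi_cvg y hy)).
    apply/cvg_normcP => e e0.
    have s1 : 0 < C0_sup f + 1 by rewrite ltr_wpDl// C0_sup_ge0.
    have : d / (2 ^+ n) @[n --> \oo] --> (0 : R).
      rewrite -[X in _ --> X](mulr0 d); apply: (@cvgM R); first exact: cvg_cst.
      rewrite (_ : (fun n => _) = (fun n => (2^-1 : R) ^+ n)).
        apply: cvg_expr; rewrite ger0_norm// invf_lt1//; lra.
      by apply/funext => n; rewrite exprVn.
    move=> /cvgrPdist_lt/(_ _ (divr_gt0 e0 s1)); apply: filterS => n.
    rewrite sub0r normrN => hn; rewrite -rconvB//.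
    apply: le_lt_trans (rconv_bound f y (CintegrableB ipsi (ip n))) _.
    apply: (@le_lt_trans _ _ ((C0_sup f + 1) * (d / 2 ^+ n))).
      apply: ler_pM => //; first exact: C0_sup_ge0.
      - by apply: Rintegral_ge0 => ? _; exact: normc_ge0.
      - by rewrite lerDl.
    by rewrite mulrC -ltr_pdivlMr//; apply: le_lt_trans hn; exact: ler_norm.
  + apply: aeW => y n; rewrite normcM mulrC; apply: ler_pM => //.
    * exact: normc_ge0.
    * exact: normc_ge0.
    * apply: le_trans (rconv_bound f y (ip n)) _.
      rewrite ler_wpM2l ?C0_sup_ge0//; apply: le_trans (Bd n).
      apply: le_Ri; first exact: Cintegrable_normc.
        by have [] := Cc_integrable hausG haar_m (cB n).
      by move=> x; case: (pB n x).
  have c1' : Cintegral m (fun y => phi_ n y * rconv f (psi_ n) y) @[n --> \oo] -->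
      Cintegral m (fun x => f x * h x).
    by move: c1; under eq_fun do rewrite hE.
  exact: (cvg_unique (@norm_hausdorff _ C) c1' c2).
Qed.

End convolution_ae.

(** * The algebra L^1(G) and its approximate units *)

Lemma le_of_thirds (R : realFieldType) (x a b c b' eps : R) :
  x <= a + b -> b <= c + b' -> a <= b' -> b' < eps / 3 -> c <= eps / 3 -> x <= eps.
Proof. lra. Qed.

Section L1_convolution.
Context (G : topologicalGroupType) (R : realType).
Hypothesis hausG : hausdorff_space G.
Hypothesis lcG : locally_compact [set: G].
Variable m : {measure set (borel G) -> \bar R}.
Hypothesis haar_m : left_haar m.
Local Notation C := (R[i]^o).
Local Notation Ri f := (m.-integrable setT (EFin \o f)).
Implicit Types phi psi : L1 m.

Local Open Scope quotient_scope.

Definition L1_rnorm phi : R := \int[m]_x normc (phi x).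

Lemma L1_normE phi : `|phi| = (L1_rnorm phi)%:C%C :> R[i].
Proof. by []. Qed.

Lemma L1_rnorm_ge0 phi : 0 <= L1_rnorm phi.
Proof. by apply: Rintegral_ge0 => x _; exact: normc_ge0. Qed.

Lemma L1_rnormD phi psi : L1_rnorm (phi + psi) <= L1_rnorm phi + L1_rnorm psi.
Proof. by rewrite -lecR rmorphD/= -!L1_normE ler_normD. Qed.

Lemma L1_rnormB phi psi : L1_rnorm (phi - psi) = L1_rnorm (psi - phi).
Proof. by apply: (@complexI R); rewrite -!L1_normE distrC. Qed.

Lemma L1_int phi : Cintegrable m phi.
Proof. exact: Cintegrable_L1. Qed.

Definition L1_mk (f : borel G -> C) (fi : Cintegrable m f) : L1 m :=
  \pi_(L1 m) (IntegrableFun (mem_set fi : f \in @L1pred _ _ _ m)).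

Lemma L1_mkE f (fi : Cintegrable m f) : {ae m, forall x, L1_mk fi x = f x}.
Proof.
have /L1_piP : \pi_(L1 m) (repr (L1_mk fi)) =
  \pi_(L1 m) (IntegrableFun (mem_set fi : f \in @L1pred _ _ _ m)) by rewrite reprK.
exact: filterS.
Qed.

Lemma L1_eqP phi psi : {ae m, forall x, phi x = psi x} -> phi = psi.
Proof. by move=> h; rewrite -[phi]reprK -[psi]reprK; apply/L1_piP. Qed.

Lemma L1_reprB phi psi : {ae m, forall x, (phi - psi : L1 m) x = phi x - psi x}.
Proof.
have h := L1_reprD (phi - psi) psi; rewrite subrK in h.
by apply: filterS h => x ->; rewrite addrK.
Qed.

Lemma L1_rnorm_ae phi (f : borel G -> C) : Cintegrable m f ->
  {ae m, forall x, phi x = f x} -> L1_rnorm phi = \int[m]_x normc (f x).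
Proof. by move=> fi h; apply: ae_eq_normc => //; exact: L1_int. Qed.

Lemma conv_integrable (phi psi : borel G -> C) :
  Cintegrable m phi -> Cintegrable m psi ->
  {ae m, forall x : borel G,
    Cintegrable m (fun y : borel G => phi y * psi ((y : G)^-1 * x)%g)}.
Proof.
move=> ip iq; have [h [_ _ hx _]] := conv_exists hausG lcG haar_m ip iq ltr01.
by apply: filterS hx => x [].
Qed.

Lemma Cintegral_norm0 (f : borel G -> C) : Cintegrable m f ->
  (forall d, 0 < d -> \int[m]_x normc (f x) <= d) -> {ae m, forall x, f x = 0}.
Proof.
move=> fi h; have := R_ae0 (Cintegrable_normc fi) (fun x => normc_ge0 (f x)) h.
by apply: filterS => x /eq0_normc.
Qed.

(** The bound of [conv_exists] exceeds the product of the norms by [N] times an arbitrary [d], so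
    here it forces 0. This makes convolution compatible with almost everywhere equality in either
    factor. *)
Lemma conv_null (phi psi : borel G -> C) :
  Cintegrable m phi -> Cintegrable m psi ->
  (\int[m]_x normc (phi x)) * \int[m]_x normc (psi x) = 0 ->
  {ae m, forall x, conv m phi psi x = 0}.
Proof.
move=> ip iq pq0; set N := \int[m]_x normc (phi x) in pq0.
have N0 : 0 <= N by apply: Rintegral_ge0 => x _; exact: normc_ge0.
have [h [ih _ hx _]] := conv_exists hausG lcG haar_m ip iq ltr01.
have h0 : {ae m, forall x, h x = 0}.
  apply: Cintegral_norm0 => // d d0.
  have N1 : 0 < N + 1 by rewrite ltr_wpDl.
  have [h' [ih' h'N h'x _]] := conv_exists hausG lcG haar_m ip iq (divr_gt0 d0 N1).
  rewrite (ae_eq_normc ih ih'); last first.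
    by apply: filterS2 hx h'x => x [_ ->] [_ ->].
  apply: le_trans h'N _; rewrite mulrDr -/N pq0 add0r.
  by rewrite mulrCA ler_piMr ?ltW// ltr_pdivrMr// mul1r ltrDl.
by apply: filterS2 hx h0 => x [_ <-].
Qed.

(** The sum is required only almost everywhere because the representative of a sum in [L1] need not
    be the sum of the representatives. The defect [k] has norm 0 and is disposed of by
    [conv_null]. *)
Lemma conv_aeDl (p1 p2 p3 q : borel G -> C) : Cintegrable m p1 -> Cintegrable m p2 ->
  Cintegrable m p3 -> Cintegrable m q -> {ae m, forall x, p3 x = p1 x + p2 x} ->
  {ae m, forall x, conv m p3 q x = conv m p1 q x + conv m p2 q x}.
Proof.
move=> i1 i2 i3 iq h.
pose k x := p3 x - (p1 x + p2 x).
have i12 := CintegrableD i1 i2.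
have ik : Cintegrable m k by exact: CintegrableB.
have k0 : \int[m]_x normc (k x) = 0.
  rewrite (ae_eq_normc ik (Cintegrable0 _)).
    by under eq_Rintegral do rewrite normc0; rewrite Rintegral_cst// mul0r.
  by apply: filterS h => x; rewrite /k => ->; rewrite subrr.
have ck : {ae m, forall x, conv m k q x = 0} by apply: conv_null => //; rewrite k0 mul0r.
have h1 := conv_integrable i1 iq; have h2 := conv_integrable i2 iq.
have h3 := conv_integrable i3 iq.
apply: filterS2 ck (filterI h1 (filterI h2 h3)) => x {}ck [j1 [j2 j3]]; apply/eqP; rewrite -subr_eq0 -ck /conv -CintegralD//.
rewrite -CintegralB//; last exact: CintegrableD.
by apply/eqP/eq_Cintegral => y; rewrite /k !mulrDl mulNr mulrDl.
Qed.

Lemma conv_aeDr (p q1 q2 q3 : borel G -> C) : Cintegrable m q1 -> Cintegrable m q2 ->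
  Cintegrable m q3 -> Cintegrable m p -> {ae m, forall x, q3 x = q1 x + q2 x} ->
  {ae m, forall x, conv m p q3 x = conv m p q1 x + conv m p q2 x}.
Proof.
move=> i1 i2 i3 ip h.
pose k x := q3 x - (q1 x + q2 x).
have i12 := CintegrableD i1 i2.
have ik : Cintegrable m k by exact: CintegrableB.
have k0 : \int[m]_x normc (k x) = 0.
  rewrite (ae_eq_normc ik (Cintegrable0 _)).
    by under eq_Rintegral do rewrite normc0; rewrite Rintegral_cst// mul0r.
  by apply: filterS h => x; rewrite /k => ->; rewrite subrr.
have ck : {ae m, forall x, conv m p k x = 0} by apply: conv_null => //; rewrite k0 mulr0.
have h1 := conv_integrable ip i1; have h2 := conv_integrable ip i2.
have h3 := conv_integrable ip i3.
apply: filterS2 ck (filterI h1 (filterI h2 h3)) => x {}ck [j1 [j2 j3]]; apply/eqP; rewrite -subr_eq0 -ck /conv -CintegralD//.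
rewrite -CintegralB//; last exact: CintegrableD.
by apply/eqP/eq_Cintegral => y; rewrite /k mulrBr mulrDr.
Qed.

Lemma conv_ae_eq (p p' q q' : borel G -> C) : Cintegrable m p -> Cintegrable m p' ->
  Cintegrable m q -> Cintegrable m q' ->
  {ae m, forall x, p x = p' x} -> {ae m, forall x, q x = q' x} ->
  {ae m, forall x, conv m p q x = conv m p' q' x}.
Proof.
move=> ip ip' iq iq' pp qq; have i0 := Cintegrable0 m.
have z (f : borel G -> C) : {ae m, forall x, conv m (fun=> 0) f x = 0}.
  by apply: aeW => x; rewrite /conv; under eq_Cintegral do rewrite mul0r; exact: Cintegral0.
have z' (f : borel G -> C) : {ae m, forall x, conv m f (fun=> 0) x = 0}.
  by apply: aeW => x; rewrite /conv; under eq_Cintegral do rewrite mulr0; exact: Cintegral0.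
have h1 : {ae m, forall x, conv m p q x = conv m p' q x}.
  have pp0 : {ae m, forall x, p x = p' x + 0} by apply: filterS pp => x ->; rewrite addr0.
  by apply: filterS2 (conv_aeDl ip' i0 ip iq pp0) (z q) => x -> ->; rewrite addr0.
have h2 : {ae m, forall x, conv m p' q x = conv m p' q' x}.
  have qq0 : {ae m, forall x, q x = q' x + 0} by apply: filterS qq => x ->; rewrite addr0.
  by apply: filterS2 (conv_aeDr iq' i0 iq ip' qq0) (z' p') => x -> ->; rewrite addr0.
by apply: filterS2 h1 h2 => x -> ->.
Qed.

(** The function from [conv_exists] shows that the set defining [L1_conv] is inhabited, so the
    default value is not taken. *)
Lemma L1_convE phi psi : {ae m, forall x, L1_conv phi psi x = conv m phi psi x}.
Proof.
apply: (@xgetPex _ 0 [set h : L1 m | {ae m, forall x : borel G,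
    h x = Cintegral m (fun y : G => phi y * psi (y^-1 * x)%g)}]).
have [h [ih _ hx _]] := conv_exists hausG lcG haar_m (L1_int phi) (L1_int psi) ltr01.
exists (L1_mk ih) => /=; apply: filterS2 hx (L1_mkE ih) => x [_ h1] ->.
exact: h1.
Qed.

Lemma L1_convDl phi1 phi2 psi :
  L1_conv (phi1 + phi2) psi = L1_conv phi1 psi + L1_conv phi2 psi.
Proof.
apply: L1_eqP.
have h1 := conv_aeDl (L1_int phi1) (L1_int phi2) (L1_int (phi1 + phi2)) (L1_int psi)
  (L1_reprD phi1 phi2).
have h2 := L1_reprD (L1_conv phi1 psi) (L1_conv phi2 psi).
have h3 := L1_convE phi1 psi; have h4 := L1_convE phi2 psi.
have h5 := L1_convE (phi1 + phi2) psi.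
apply: filterS2 (filterI h1 h2) (filterI h3 (filterI h4 h5)).
by move=> x [e1 e2] [e3 [e4 e5]]; rewrite e5 e1 e2 e3 e4.
Qed.

Lemma L1_convDr phi psi1 psi2 :
  L1_conv phi (psi1 + psi2) = L1_conv phi psi1 + L1_conv phi psi2.
Proof.
apply: L1_eqP.
have h1 := conv_aeDr (L1_int psi1) (L1_int psi2) (L1_int (psi1 + psi2)) (L1_int phi)
  (L1_reprD psi1 psi2).
have h2 := L1_reprD (L1_conv phi psi1) (L1_conv phi psi2).
have h3 := L1_convE phi psi1; have h4 := L1_convE phi psi2.
have h5 := L1_convE phi (psi1 + psi2).
apply: filterS2 (filterI h1 h2) (filterI h3 (filterI h4 h5)).
by move=> x [e1 e2] [e3 [e4 e5]]; rewrite e5 e1 e2 e3 e4.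
Qed.

Lemma L1_conv_bound phi psi : L1_rnorm (L1_conv phi psi) <= L1_rnorm phi * L1_rnorm psi.
Proof.
apply/ler_addgt0Pr => e e0.
have N1 : 0 < L1_rnorm phi + 1 by rewrite ltr_wpDl// L1_rnorm_ge0.
have [h [ih hN hx _]] := conv_exists hausG lcG haar_m (L1_int phi) (L1_int psi)
  (divr_gt0 e0 N1).
rewrite (L1_rnorm_ae ih); last first.
  by apply: filterS2 hx (L1_convE phi psi) => x [_ ->] ->.
apply: le_trans hN _; rewrite mulrDr lerD2l.
by rewrite mulrCA ler_piMr ?ltW// ltr_pdivrMr// mul1r ltrDl.
Qed.

Lemma L1_bfun phi : bounded_functional (L1_to_M phi) (L1_rnorm phi).
Proof. exact/bfun_integral/L1_int. Qed.

Lemma L1_to_MD phi psi f : L1_to_M (phi + psi) f = L1_to_M phi f + L1_to_M psi f.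
Proof.
have fm : Cmeas (f : borel G -> C) by exact/Cmeas_continuous/C0_continuous.
have i q : Cintegrable m q -> Cintegrable m (fun x => f x * q x).
  by apply: (CintegrableMb fm (B := C0_sup f)); exact: C0_supP.
rewrite /L1_to_M -CintegralD; [|exact/i/L1_int..].
apply: ae_eq_Cintegral; first exact/i/L1_int.
  by apply: CintegrableD; exact/i/L1_int.
by apply: filterS (L1_reprD phi psi) => x ->; rewrite mulrDr.
Qed.

Lemma L1_to_MB phi psi f : L1_to_M (phi - psi) f = L1_to_M phi f - L1_to_M psi f.
Proof.
by have := L1_to_MD (phi - psi) psi f; rewrite subrK => ->; rewrite addrK.
Qed.

Lemma L1_to_M_conv phi psi f :
  L1_to_M (L1_conv phi psi) f = L1_to_M phi (to_C0 (rconv m f psi)).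
Proof.
have [h [ih _ hx hf]] := conv_exists hausG lcG haar_m (L1_int phi) (L1_int psi) ltr01.
have fm : Cmeas (f : borel G -> C) by exact/Cmeas_continuous/C0_continuous.
have i q : Cintegrable m q -> Cintegrable m (fun x => f x * q x).
  by apply: (CintegrableMb fm (B := C0_sup f)); exact: C0_supP.
transitivity (Cintegral m (fun x => f x * h x)).
  apply: ae_eq_Cintegral; [exact/i/L1_int|exact: i|].
  by apply: filterS2 hx (L1_convE phi psi) => x [_ ->] ->.
have rC := rconv_C0 hausG lcG haar_m f (L1_int psi).
by rewrite hf; apply: eq_Cintegral => x; rewrite (to_C0E rC); exact: mulrC.
Qed.

(** Symmetry lets one family serve on both sides: left invariance turns the convolution of [g] and
    [e] at [x] into the integral of [g (x y) e (y^-1)], and no modular function appears once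
    [e (y^-1) = e y]. *)
Definition unit_in (V : set G) (E : L1 m) := exists e : G -> R, [/\
  continuous e /\ (forall x, 0 <= e x), forall x, e (x^-1)%g = e x,
  (exists K, [/\ compact K, K `<=` V & forall x, ~ K x -> e x = 0]),
  \int[m]_x e x = 1 & {ae m, forall x, E x = (e x)%:C%C}].

Lemma unit_in_ex (V : set G) : nbhs 1%g V -> exists E, unit_in V E.
Proof.
rewrite nbhsE => -[U [oU U1] UV].
have [w [wc w01 w1 [K [cK KU wK]]]] := locally_compact_urysohn R hausG lcG
  (@compact_set1 _ (1%g : G)) oU (fun x (x1 : x = 1%g) => ltac:(by rewrite x1)).
(* This product is symmetric, still vanishes off [K] through its first factor, and keeps the value 1
   at the identity, hence a positive integral. *)
pose e0 (x : G) := w x * w (x^-1)%g.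
have e0c : continuous e0.
  move=> x; apply: (@cvgM R); first exact: wc.
  by apply: continuous_comp; [exact: invg_continuous|exact: wc].
have w0 x : 0 <= w x by have /andP[] := w01 x.
have e00 x : 0 <= e0 x by rewrite mulr_ge0.
have e0K x : ~ K x -> e0 x = 0 by move=> /wK; rewrite /e0 => ->; rewrite mul0r.
have ie0 : Ri e0 by apply: (real_Cc_Ri hausG haar_m e0c); exists K.
pose W : set G := e0 @^-1` [set r | 1/2 < r].
have oW : open W by apply: open_comp; [move=> ? _; exact: e0c|exact: open_gt].
have W1 : W 1%g.
  by rewrite /W/= /e0 invg1 w1// mulr1 ltr_pdivrMr// mul1r ltr1n.
have mW := borel_open oW.
have Wfin : (m W < +oo)%E.
  apply: (Ri_level_fin mW ie0 (c := 1/2)) => [|x]; first lra.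
  by rewrite /W/= ger0_norm// => /ltW.
have mW0 : 0 < fine (m W).
  rewrite -lte_fin fineK ?ge0_fin_numE//.
  by apply: (open_haar_gt0 hausG haar_m) => //; exists 1%g.
have I0 : 0 < \int[m]_x e0 x.
  apply: (@lt_le_trans _ _ (1/2 * fine (m W))); first by rewrite mulr_gt0// divr_gt0.
  rewrite -(Rintegral_indic m mW) -RintegralZl//; last exact: Ri_indic.
  apply: le_Ri => //; first by apply: RiZ; exact: Ri_indic.
  move=> x; rewrite indicE; case: (boolP (x \in W)) => [/set_mem xW|_].
    by rewrite mulr1 ltW.
  by rewrite mulr0.
set I := \int[m]_x e0 x in I0.
pose e (x : G) := I^-1 * e0 x.
have ec : continuous e by move=> x; apply: (@cvgM R); [exact: cvg_cst|exact: e0c].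
have ie : Ri e by exact: RiZ.
exists (L1_mk (Cintegrable_real ie)), e; split.
- by split => // x; rewrite mulr_ge0// invr_ge0 ltW.
- by move=> x; rewrite /e /e0 invgK mulrC [X in _ = _ * X]mulrC mulrC.
- exists K; split => //; first exact: subset_trans UV.
  by move=> x /e0K; rewrite /e => ->; rewrite mulr0.
- by rewrite RintegralZl// -/I mulVf// gt_eqF.
- exact: L1_mkE.
Qed.

Lemma unit_in_sub V V' E : V `<=` V' -> unit_in V E -> unit_in V' E.
Proof.
move=> VV [e [ec es [K [cK KV eK]] e1 Ee]]; exists e; split => //.
by exists K; split => //; exact: subset_trans VV.
Qed.

Lemma unit_in_norm V E : unit_in V E -> L1_rnorm E = 1.
Proof.
move=> [e [[ec e0] es [K [cK KV eK]] e1 Ee]].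
have ie : Ri e by apply: (real_Cc_Ri hausG haar_m ec); exists K.
rewrite (L1_rnorm_ae (Cintegrable_real ie) Ee) -e1.
by apply: eq_Rintegral => x _; rewrite normc_real ger0_norm.
Qed.

Lemma average_bound (e : G -> R) (V : set G) (u : G -> C) (d : R) :
  continuous e -> (forall x, 0 <= e x) ->
  (exists K, [/\ compact K, K `<=` V & forall x, ~ K x -> e x = 0]) ->
  \int[m]_x e x = 1 -> continuous u -> (forall y, V y -> normc (u y) <= d) ->
  normc (Cintegral m (fun y => (e y)%:C%C * u y)) <= d.
Proof.
move=> ec e0 [K [cK KV eK]] e1 uc ud.
have ce : Cc (fun y => (e y)%:C%C : C) by apply: real_Cc => //; exists K.
have ie : Ri e by apply: (real_Cc_Ri hausG haar_m ec); exists K.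
have ii : Cintegrable m (fun y => (e y)%:C%C * u y).
  have := Cc_integrable hausG haar_m (CcM ce uc); congr Cintegrable.
  by apply/funext => y; rewrite mulrC.
apply: le_trans (normc_Cintegral ii) _.
rewrite -[leRHS]mulr1 -e1 -RintegralZl//.
apply: le_Ri; [exact: Cintegrable_normc|exact: RiZ|].
move=> y; rewrite normcM normc_real ger0_norm// mulrC.
have [Ky|/eK ->] := pselect (K y); last by rewrite !mulr0.
by rewrite ler_wpM2r//; exact/ud/KV.
Qed.

Lemma left_unit_Cc (g : G -> C) (ig : Cintegrable m g) (eps : R) : Cc g -> 0 < eps ->
  \forall V \near powerset_filter_from (nbhs (1%g : G)), forall E,
    unit_in V E -> L1_rnorm (L1_conv E (L1_mk ig) - L1_mk ig) <= eps.
Proof.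
move=> cg eps0; have [gc [K cK gK]] := cg.
(* The compact [V0] is fixed before [V] shrinks, so that all the differences vanish off one compact
   set [L] and a uniform bound [d] yields the L^1 bound [d * m L]. *)
have [V0 V01 cV0] := compact_nbhs lcG (1%g : G).
have cVK := compact_mulg cV0 cK; have cL := compactU cVK cK.
set L := _ `|` _ in cL.
have Lfin := haar_compact haar_m cL.
have L1' : 0 < fine (m L) + 1 by rewrite ltr_wpDl// fine_ge0.
have d0 := divr_gt0 eps0 L1'; set d := eps / _ in d0.
have gE : to_C0 g = g :> (G -> C) by rewrite to_C0E//; exact: Cc_C0.
have nu := near1_invg (C0_unif_left (to_C0 g) d0); rewrite gE in nu.
near=> V => E [e [[ec e0] es eV e1 Ee]].
have VV0 : V `<=` V0 by near: V; exact: small_set_sub.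
have Vu : V `<=` [set v | forall x, normc (g (v^-1 * x)%g - g x) < d].
  by near: V; exact: small_set_sub.
have [K' [cK' K'V eK']] := eV.
have ce : Cc (fun y => (e y)%:C%C : C) by apply: real_Cc => //; exists K'.
have ie := Cc_integrable hausG haar_m ce.
have eoff : vanish_off K' (fun y => (e y)%:C%C : C) by move=> y /eK' ->.
have cc := conv_Cc hausG lcG haar_m ie cK' eoff cg.
have cdiff := CcB cc cg.
rewrite (L1_rnorm_ae (Cc_integrable hausG haar_m cdiff)); last first.
  have h1 := L1_reprB (L1_conv E (L1_mk ig)) (L1_mk ig).
  have h2 := L1_convE E (L1_mk ig).
  have h3 := conv_ae_eq (L1_int E) ie (L1_int (L1_mk ig)) ig Ee (L1_mkE ig).
  apply: filterS2 (filterI h1 h2) (filterI h3 (L1_mkE ig)).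
  by move=> x [-> ->] [-> ->].
apply: (@le_trans _ _ (d * fine (m L))).
  apply: (normc_le_compact hausG haar_m cdiff cL).
    move=> x.
    have uc : continuous (fun y : G => g (y^-1 * x)%g).
      move=> y; apply: (@continuous_comp _ _ _ (fun y : G => (y^-1 * x)%g) g); last exact: gc.
      by apply: mulg_cvg; [exact: invg_continuous|exact: cvg_cst].
    have uc' : continuous (fun y : G => g (y^-1 * x)%g - g x).
      by move=> y; apply: cvgB; [exact: uc|exact: cvg_cst].
    have -> : conv m (fun y => (e y)%:C%C) g x - g x =
        Cintegral m (fun y : G => (e y)%:C%C * (g (y^-1 * x)%g - g x)).
      have i1 : Cintegrable m (fun y : G => (e y)%:C%C * g (y^-1 * x)%g).
        have := Cc_integrable hausG haar_m (CcM ce uc); congr Cintegrable.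
        by apply/funext => y; rewrite mulrC.
      have i2 : Cintegrable m (fun y : G => g x * (e y)%:C%C) by exact: CintegrableZ.
      have gx : g x = Cintegral m (fun y : G => g x * (e y)%:C%C).
        by rewrite CintegralZ// Cintegral_real e1 mulr1.
      transitivity (Cintegral m (fun y : G => (e y)%:C%C * g (y^-1 * x)%g) -
          Cintegral m (fun y : G => g x * (e y)%:C%C)); first by rewrite -gx.
      by rewrite -CintegralB//; apply: eq_Cintegral => y; rewrite mulrBr [X in _ - X]mulrC.
    by apply: (average_bound ec e0 eV e1 uc') => y /Vu/(_ x)/ltW.
  move=> x /not_orP[nVK /gK gx]; rewrite gx subr0.
  rewrite /conv (@eq_Cintegral _ _ _ _ _ (fun=> 0)) ?Cintegral0// => y.
  have [K'y|/eoff ->] := pselect (K' y); last by rewrite mul0r.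
  rewrite gK ?mulr0// => Ky; apply: nVK; exists ((y : G), (y^-1 * x)%g) => //=.
    by split => //; exact/VV0/K'V.
  by rewrite mulVKg.
by rewrite /d mulrAC ler_pdivrMr// ler_wpM2l ?ltW// ltrDl.
Unshelve. all: by end_near. Qed.

Lemma right_unit_Cc (g : G -> C) (ig : Cintegrable m g) (eps : R) : Cc g -> 0 < eps ->
  \forall V \near powerset_filter_from (nbhs (1%g : G)), forall E,
    unit_in V E -> L1_rnorm (L1_conv (L1_mk ig) E - L1_mk ig) <= eps.
Proof.
move=> cg eps0; have [gc [K cK gK]] := cg.
have [V0 V01 cV0] := compact_nbhs lcG (1%g : G).
have cKV := compact_mulg cK cV0; have cL := compactU cKV cK.
set L := _ `|` _ in cL.
have Lfin := haar_compact haar_m cL.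
have L1' : 0 < fine (m L) + 1 by rewrite ltr_wpDl// fine_ge0.
have d0 := divr_gt0 eps0 L1'; set d := eps / _ in d0.
have gE : to_C0 g = g :> (G -> C) by rewrite to_C0E//; exact: Cc_C0.
have nu := C0_unif_right (to_C0 g) d0; rewrite gE in nu.
near=> V => E [e [[ec e0] es eV e1 Ee]].
have VV0 : V `<=` V0 by near: V; exact: small_set_sub.
have Vu : V `<=` [set v | forall x, normc (g (x * v)%g - g x) < d].
  by near: V; exact: small_set_sub.
have [K' [cK' K'V eK']] := eV.
have ce : Cc (fun y => (e y)%:C%C : C) by apply: real_Cc => //; exists K'.
have ie := Cc_integrable hausG haar_m ce.
have cc := conv_Cc hausG lcG haar_m ig cK gK ce.
have cdiff := CcB cc cg.
rewrite (L1_rnorm_ae (Cc_integrable hausG haar_m cdiff)); last first.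
  have h1 := L1_reprB (L1_conv (L1_mk ig) E) (L1_mk ig).
  have h2 := L1_convE (L1_mk ig) E.
  have h3 := conv_ae_eq (L1_int (L1_mk ig)) ig (L1_int E) ie (L1_mkE ig) Ee.
  apply: filterS2 (filterI h1 h2) (filterI h3 (L1_mkE ig)).
  by move=> x [-> ->] [-> ->].
apply: (@le_trans _ _ (d * fine (m L))).
  apply: (normc_le_compact hausG haar_m cdiff cL).
    move=> x.
    have uc : continuous (fun y : G => g (x * y)%g).
      by move=> y; apply: continuous_comp; [exact: mulgl_continuous|exact: gc].
    have uc' : continuous (fun y : G => g (x * y)%g - g x).
      by move=> y; apply: cvgB; [exact: uc|exact: cvg_cst].
    have -> : conv m g (fun y => (e y)%:C%C) x - g x =
        Cintegral m (fun y : G => (e y)%:C%C * (g (x * y)%g - g x)).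
      have ec' : continuous (fun y : G => (e (y^-1 * x)%g)%:C%C : C).
        have [ecc _] := ce.
        move=> y; apply: (@continuous_comp _ _ _ (fun y : G => (y^-1 * x)%g)
          (fun y => (e y)%:C%C : C)); last exact: ecc.
        by apply: mulg_cvg; [exact: invg_continuous|exact: cvg_cst].
      have i0 : Cintegrable m (fun y : G => g y * (e (y^-1 * x)%g)%:C%C).
        have := Cc_integrable hausG haar_m (CcM cg ec'); congr Cintegrable.
        by apply/funext => y; rewrite mulrC.
      have i1 : Cintegrable m (fun y : G => (e y)%:C%C * g (x * y)%g).
        have := Cc_integrable hausG haar_m (CcM ce uc); congr Cintegrable.
        by apply/funext => y; rewrite mulrC.
      have i2 : Cintegrable m (fun y : G => g x * (e y)%:C%C) by exact: CintegrableZ.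
      have gx : g x = Cintegral m (fun y : G => g x * (e y)%:C%C).
        by rewrite CintegralZ// Cintegral_real e1 mulr1.
      rewrite /conv -(haar_Cintegral haar_m x i0).
      transitivity (Cintegral m (fun y : G => (e y)%:C%C * g (x * y)%g) -
          Cintegral m (fun y : G => g x * (e y)%:C%C)).
        rewrite -gx; congr (_ - _); apply: eq_Cintegral => y.
        by rewrite invgM mulgVK es mulrC.
      by rewrite -CintegralB//; apply: eq_Cintegral => y; rewrite mulrBr [X in _ - X]mulrC.
    by apply: (average_bound ec e0 eV e1 uc') => y /Vu/(_ x)/ltW.
  move=> x /not_orP[nKV /gK gx]; rewrite gx subr0.
  rewrite /conv (@eq_Cintegral _ _ _ _ _ (fun=> 0)) ?Cintegral0// => y.
  have [Ky|/gK ->] := pselect (K y); last by rewrite mul0r.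
  rewrite eK' ?mulr0// => K'y; apply: nKV; exists ((y : G), (y^-1 * x)%g) => //=.
    by split => //; exact/VV0/K'V.
  by rewrite mulVKg.
by rewrite /d mulrAC ler_pdivrMr// ler_wpM2l ?ltW// ltrDl.
Unshelve. all: by end_near. Qed.

Lemma L1_rnorm_near_Cc phi (eps : R) : 0 < eps -> exists (g : G -> C) (ig : Cintegrable m g),
  Cc g /\ L1_rnorm (phi - L1_mk ig) < eps.
Proof.
move=> eps0; have [g cg hg] := Cc_dense hausG lcG haar_m (L1_int phi) eps0.
have ig := Cc_integrable hausG haar_m cg; exists g, ig; split => //.
rewrite (L1_rnorm_ae (CintegrableB (L1_int phi) ig))//.
by apply: filterS2 (L1_reprB phi (L1_mk ig)) (L1_mkE ig) => x -> ->.
Qed.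

Lemma L1_rnorm_triangle phi psi chi : L1_rnorm (phi - chi) <= L1_rnorm (phi - psi) + L1_rnorm (psi - chi).
Proof. by apply: le_trans (L1_rnormD _ _); rewrite addrA subrK. Qed.

Lemma left_unit phi (eps : R) : 0 < eps ->
  \forall V \near powerset_filter_from (nbhs (1%g : G)), forall E,
    unit_in V E -> L1_rnorm (L1_conv E phi - phi) <= eps.
Proof.
move=> eps0; have e3 : 0 < eps / 3 by rewrite divr_gt0.
have [g [ig [cg hg]]] := L1_rnorm_near_Cc phi e3.
apply: filterS (left_unit_Cc ig cg e3) => V hV E VE.
have dE : L1_conv E phi - L1_conv E (L1_mk ig) = L1_conv E (phi - L1_mk ig).
  by have := L1_convDr E (phi - L1_mk ig) (L1_mk ig); rewrite subrK => ->; rewrite addrK.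
apply: (le_of_thirds (L1_rnorm_triangle _ (L1_conv E (L1_mk ig)) _)
  (L1_rnorm_triangle _ (L1_mk ig) _) _ _ (hV E VE)); last by rewrite L1_rnormB.
rewrite dE; apply: le_trans (L1_conv_bound _ _) _.
by rewrite (unit_in_norm VE) mul1r L1_rnormB.
Qed.

Lemma right_unit phi (eps : R) : 0 < eps ->
  \forall V \near powerset_filter_from (nbhs (1%g : G)), forall E,
    unit_in V E -> L1_rnorm (L1_conv phi E - phi) <= eps.
Proof.
move=> eps0; have e3 : 0 < eps / 3 by rewrite divr_gt0.
have [g [ig [cg hg]]] := L1_rnorm_near_Cc phi e3.
apply: filterS (right_unit_Cc ig cg e3) => V hV E VE.
have dE : L1_conv phi E - L1_conv (L1_mk ig) E = L1_conv (phi - L1_mk ig) E.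
  by have := L1_convDl (phi - L1_mk ig) (L1_mk ig) E; rewrite subrK => ->; rewrite addrK.
apply: (le_of_thirds (L1_rnorm_triangle _ (L1_conv (L1_mk ig) E) _)
  (L1_rnorm_triangle _ (L1_mk ig) _) _ _ (hV E VE)); last by rewrite L1_rnormB.
rewrite dE; apply: le_trans (L1_conv_bound _ _) _.
by rewrite (unit_in_norm VE) mulr1 L1_rnormB.
Qed.

End L1_convolution.

(** * Weak-* limits in M(G) *)

Section functional_tightness.
Context (G : topologicalGroupType) (R : realType).
Hypothesis hausG : hausdorff_space G.
Hypothesis lcG : locally_compact [set: G].
Local Notation C := (R[i]^o).

Lemma C0_near_Cc (f : C0 G R) (d : R) : 0 < d -> exists f' : G -> C,
  [/\ Cc f', C0_sup (f - to_C0 f') <= d & C0_sup (to_C0 f') <= C0_sup f].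
Proof.
move=> d0; have d2 : 0 < d / 2 by rewrite divr_gt0.
have [K cK Kf] := C0_vanish f d2.
have [chi [cchi chi1 chib]] := Cc_cutoff R hausG lcG cK.
have cf : Cc (fun x => f x * chi x) by apply: CcM => //; exact: C0_continuous.
have fC := Cc_C0 cf.
exists (fun x => f x * chi x); split => //; apply: C0_sup_le => x.
  rewrite subC0E (to_C0E fC).
  have -> : f x - f x * chi x = f x * (1 - chi x) by rewrite mulrBr mulr1.
  have [Kx|/Kf fx] := pselect (K x).
    by rewrite chi1// subrr mulr0 normc0 ltW.
  rewrite normcM; apply: (@le_trans _ _ (d / 2 * 2)); last by rewrite divfK.
  apply: ler_pM; [exact: normc_ge0..|exact: ltW|].
  apply: le_trans (ler_normcD _ _) _; rewrite normcN normc1.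
  by have := chib x; lra.
rewrite (to_C0E fC) normcM; apply: le_trans (C0_supP f x).
by rewrite ler_piMr ?normc_ge0.
Qed.

Lemma phase (z : C) : exists2 u : C, normc u = 1 & u * z = (normc z)%:C%C.
Proof.
have [->|z0] := eqVneq z 0.
  by exists 1; [exact: normc1|rewrite mulr0 normc0].
have n0 : normc z != 0 by apply: contra z0 => /eqP/eq0_normc ->.
have np : 0 < normc z by rewrite lt_neqAle eq_sym n0 normc_ge0.
exists ((normc z)^-1%:C%C * conjz z).
  by rewrite normcM normc_real ger0_norm ?invr_ge0 ?normc_ge0// normc_conjz mulVf.
rewrite -mulrA mul_conjz -[LHS](rmorphM (real_complex R)).
by rewrite expr2 mulKf.
Qed.

(* Take f1 of norm 1 and compact support K with L f1 close to the norm of L.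
   If g has norm 1 and vanishes on K then f1 + u g has norm 1 for every phase u,
   so adding |L g| to |L f1| cannot exceed the norm of L. *)
Lemma bfun_tight (L : C0 G R -> C) (M e : R) : bounded_functional L M -> 0 < e ->
  exists2 K : set G, compact K & forall g : C0 G R, (forall x, K x -> g x = 0) ->
    normc (L g) <= e * C0_sup g.
Proof.
move=> bL e0; have [M0 _ LM] := bL.
pose A := [set normc (L f) | f in [set f : C0 G R | C0_sup f <= 1]].
have A_sup : has_sup A.
  split.
    exists (normc (L 0)), 0 => //=; apply: C0_sup_le => x.
    by rewrite normc0.
  exists M => _ [f /= f1 <-]; apply: le_trans (LM f) _.
  by rewrite ler_piMr.
have e2 : 0 < e / 2 by rewrite divr_gt0.
have [_ [f0 /= f01 <-] f0S] := sup_adherent e2 A_sup.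
have M1 : 0 < M + 1 by rewrite ltr_wpDl.
have [f1 [cf1 f01d f1b]] := C0_near_Cc f0 (divr_gt0 e2 M1).
have Lf1 : sup A - e < normc (L (to_C0 f1)).
  have : normc (L f0) <= normc (L (f0 - to_C0 f1)) + normc (L (to_C0 f1)).
    rewrite (bfunB _ _ bL) -{1}(subrK (L (to_C0 f1)) (L f0)).
    exact: ler_normcD.
  have : normc (L (f0 - to_C0 f1)) <= e / 2.
    apply: le_trans (LM _) _.
    apply: (@le_trans _ _ (M * (e / 2 / (M + 1)))); first by rewrite ler_wpM2l.
    by rewrite mulrCA ler_piMr ?(ltW e2)// ler_pdivrMr// mul1r lerDl.
  by move: f0S; lra.
have [fc [K cK fK]] := cf1; exists K => // g gK.
have key (g' : C0 G R) : (forall x, K x -> g' x = 0) -> C0_sup g' <= 1 ->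
    normc (L g') <= e.
  move=> g'K g'1.
  have [u u1 uL] := phase (L (to_C0 f1)); have [v v1 vL] := phase (L g').
  have : A (normc (L (u *: to_C0 f1 + v *: g'))).
    exists (u *: to_C0 f1 + v *: g') => //=; apply: C0_sup_le => x.
    rewrite addC0E !scaleC0E.
    have [Kx|nK] := pselect (K x).
      rewrite g'K// mulr0 addr0 normcM u1 mul1r.
      by apply: le_trans (C0_supP _ _) _; exact: le_trans f1b f01.
    rewrite to_C0E ?Cc_C0// fK// mulr0 add0r normcM v1 mul1r.
    by apply: le_trans (C0_supP _ _) _.
  move=> /(ub_le_sup A_sup.2).
  rewrite (bfunD _ _ bL) !(bfunZ _ _ bL) uL vL.
  rewrite -[X in normc X](rmorphD (real_complex R)) normc_real ger0_norm.
    by move: Lf1; lra.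
  by rewrite addr_ge0 ?normc_ge0.
have [s0|s0] := eqVneq (C0_sup g) 0.
  by have := LM g; rewrite s0 !mulr0.
have sp : 0 < C0_sup g by rewrite lt_neqAle eq_sym s0 C0_sup_ge0.
pose c : C := (C0_sup g)^-1%:C%C.
have nc : normc c = (C0_sup g)^-1 by rewrite normc_real ger0_norm ?invr_ge0 ?ltW.
have := key (c *: g) _ _; rewrite (bfunZ _ _ bL) normcM nc => h.
rewrite -ler_pdivrMr// mulrC; apply: h.
  by move=> x Kx; rewrite scaleC0E gK// mulr0.
apply: C0_sup_le => x; rewrite scaleC0E normcM nc mulrC ler_pdivrMr// mul1r.
exact: C0_supP.
Qed.

(** This guarantees that the inner [to_C0] in [M_conv] is not a default. For the decay, [L] nearly
    ignores functions vanishing on a compact [K], while [f] is nearly supported in a compact [L']; a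
    point [x] of [K] satisfies [x y] in [L'] only if [y] lies in K^-1 L'. *)
Lemma bfun_rtrans_C0 (L : C0 G R -> C) (M : R) (f : C0 G R) :
  bounded_functional L M -> (fun y => L (to_C0 (rtrans f y))) \in @C0pred G R.
Proof.
move=> bL; have [M0 _ LM] := bL; rewrite inE; split.
  by apply: (bfun_comp_continuous _ bL) => y e e0; exact: rtrans_cont.
move=> e e0; have e2 : 0 < e / 2 by rewrite divr_gt0.
have M1 : 0 < M + 1 by rewrite ltr_wpDl.
have S1 : 0 < C0_sup f + 1 by rewrite ltr_wpDl ?C0_sup_ge0.
have [f' [cf' ff' f'b]] := C0_near_Cc f (divr_gt0 e2 M1).
have [K cK hK] := bfun_tight bL (divr_gt0 e2 S1).
have [_ [L' cL' f'L]] := cf'; have f'C := Cc_C0 cf'.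
exists [set (p.1 * p.2)%g | p in [set x | K (x^-1)%g] `*` L'].
  exact: compact_mulg (compact_invg cK) cL'.
move=> y ny.
have h1 : normc (L (to_C0 (rtrans (to_C0 f') y))) < e / 2.
  apply: (@le_lt_trans _ _ (e / 2 / (C0_sup f + 1) * C0_sup (to_C0 (rtrans (to_C0 f') y)))).
    apply: hK => x Kx; rewrite to_C0E ?rtrans_C0// /rtrans (to_C0E f'C) f'L// => Lxy.
    apply: ny; exists ((x^-1)%g, (x * y)%g) => /=; last by rewrite mulKg.
    by split => //=; rewrite invgK.
  apply: (@le_lt_trans _ _ (e / 2 / (C0_sup f + 1) * C0_sup f)).
    apply: ler_wpM2l; first by apply/ltW; rewrite divr_gt0.
    exact: le_trans (rtrans_bd _ _) f'b.
  by rewrite mulrAC ltr_pdivrMr// ltr_pM2l// ltrDl.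
have h2 : normc (L (to_C0 (rtrans f y) - to_C0 (rtrans (to_C0 f') y))) <= e / 2.
  apply: le_trans (LM _) _.
  apply: (@le_trans _ _ (M * (e / 2 / (M + 1)))).
    rewrite ler_wpM2l//; apply: le_trans ff'; apply: C0_sup_le => x.
    rewrite subC0E (to_C0E (rtrans_C0 f y)) (to_C0E (rtrans_C0 (to_C0 f') y)).
    exact: (C0_supP (f - to_C0 f') (x * y)%g).
  by rewrite mulrCA ler_piMr ?(ltW e2)// ler_pdivrMr// mul1r lerDl.
rewrite (bfunB _ _ bL) in h2.
rewrite -(subrK (L (to_C0 (rtrans (to_C0 f') y))) (L (to_C0 (rtrans f y)))).
by apply: le_lt_trans (ler_normcD _ _) _; rewrite [e]splitr ler_ltD.
Qed.

Lemma bfun_measure (L : C0 G R -> C) (M : R) : bounded_functional L M ->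
  exists mu : measure_algebra G R, forall f, mu f = L f.
Proof.
move=> bL; have [M0 lin LM] := bL.
pose L' : {linear C0 G R -> C} := HB.pack L (GRing.isLinear.Build C (C0 G R) C _ L lin).
have cL : continuous L'.
  apply/linear_bounded_continuous/linear_boundedP.
  have Mr : (M%:C%C : R[i]) \is Num.real by rewrite ger0_real// lecR.
  near=> r => f.
  apply: (@le_trans _ _ (M%:C%C * `|f|)).
    by rewrite C0_normE -[leRHS](rmorphM (real_complex R)) Defs.normcE lecR; exact: LM.
  by rewrite ler_wpM2r//; near: r; exact: nbhs_pinfty_ge.
by exists (MeasureAlgebra cL).
Unshelve. all: by end_near. Qed.

(** Compactness of the segment gives a cluster point, and an ultrafilter converges to each of its
    cluster points. Applied to one test function at a time, this yields the weak-* limit with no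
    topology on the dual. *)
Lemma ultra_bounded_cvg (X : Type) (U : set_system X) (UU : UltraFilter U)
    (z : X -> R) (M : R) : (\forall x \near U, `|z x| <= M) ->
  exists l : R, z @ U --> l.
Proof.
move=> zM.
have Uz : (z @ U) `[- M, M]%classic.
  by apply: filterS zM => x; rewrite /= in_itv/= -ler_norml.
have [l [_ cl]] := @segment_compact R (- M) M (z @ U) _ Uz.
exists l => B Bl.
have [//|nB] := in_ultra_setVsetC (z @^-1` B) UU.
have [r [/= nr Br]] := cl (~` B) B nB Bl.
by [].
Qed.

Lemma ultra_bounded_cvgC (X : Type) (U : set_system X) (UU : UltraFilter U)
    (z : X -> C) (M : R) : (\forall x \near U, normc (z x) <= M) ->
  exists l : C, z @ U --> l.
Proof.
move=> zM.
have [a ca] := @ultra_bounded_cvg _ _ UU (fun x => complex.Re (z x)) M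
  (filterS (fun x h => le_trans (normc_Re (z x)) h) zM).
have [b cb] := @ultra_bounded_cvg _ _ UU (fun x => complex.Im (z x)) M
  (filterS (fun x h => le_trans (normc_Im (z x)) h) zM).
by exists (Complex a b); apply/cvg_complexP.
Qed.

End functional_tightness.

(** * Associativity through test functions, and the filter of units *)

Section multiplier.
Context (G : topologicalGroupType) (R : realType).
Hypothesis hausG : hausdorff_space G.
Hypothesis lcG : locally_compact [set: G].
Variable m : {measure set (borel G) -> \bar R}.
Hypothesis haar_m : left_haar m.
Local Notation C := (R[i]^o).
Implicit Types phi psi p q r : L1 m.

Lemma L1_to_M_le p f : normc (L1_to_M p f) <= L1_rnorm p * C0_sup f.
Proof. by have [_ _] := L1_bfun p; exact. Qed.

Lemma rconv_sup (f : C0 G R) q : C0_sup (to_C0 (rconv m f q)) <= C0_sup f * L1_rnorm q.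
Proof.
have qC := rconv_C0 hausG lcG haar_m f (L1_int q).
by apply: C0_sup_le => x; rewrite (to_C0E qC); exact: rconv_bound (L1_int q).
Qed.

Lemma rconv_apply (f : C0 G R) q x :
  rconv m f q x = L1_to_M q (to_C0 (ltrans f (x^-1)%g)).
Proof.
by apply: eq_Cintegral => y; rewrite to_C0E ?ltrans_C0// /ltrans invgK.
Qed.

Lemma rconv_valE (f : C0 G R) q x : to_C0 (rconv m f q) x = rconv m f q x.
Proof. by rewrite (to_C0E (rconv_C0 hausG lcG haar_m f (L1_int q))). Qed.

Lemma C0_ext (f g : C0 G R) : (forall x, f x = g x) -> f = g.
Proof. by move=> fg; apply/val_inj/funext. Qed.

Lemma rconv_C0B (f : C0 G R) p q :
  to_C0 (rconv m f p) - to_C0 (rconv m f q) = to_C0 (rconv m f (p - q : L1 m)).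
Proof.
by apply: C0_ext => x; rewrite subC0E !rconv_valE !rconv_apply L1_to_MB.
Qed.

(** Left translations commute with [rconv], so evaluation at [x] reduces the claim to [L1_to_M_conv]
    for a translate of [f]; no new exchange of integrals is needed. *)
Lemma rconv_conv (f : C0 G R) q r :
  to_C0 (rconv m (to_C0 (rconv m f r)) q) = to_C0 (rconv m f (L1_conv q r)).
Proof.
apply: C0_ext => x; rewrite !rconv_valE !rconv_apply.
rewrite (L1_to_M_conv hausG lcG haar_m); congr (L1_to_M q _).
apply: C0_ext => y; rewrite rconv_valE (to_C0E (ltrans_C0 _ _)) /ltrans rconv_valE.
apply: eq_Cintegral => z; rewrite (to_C0E (ltrans_C0 _ _)) /ltrans.
by rewrite mulgA.
Qed.

(** Both sides are values at [f] of a triple product: this is associativity of convolution in tested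
    form. *)
Lemma L1_to_M_conv2 p q r (f : C0 G R) :
  L1_to_M (L1_conv p q) (to_C0 (rconv m f r)) =
  L1_to_M p (to_C0 (rconv m f (L1_conv q r))).
Proof. by rewrite (L1_to_M_conv hausG lcG haar_m) rconv_conv. Qed.

(** By [bfun_rtrans_C0] the inner function is in C_0(G), so [to_C0] leaves it unchanged, and
    [bfun_vint] takes [mu] out of the integral. *)
Lemma M_conv_rconv (mu : measure_algebra G R) (M : R) q f :
  bounded_functional mu M -> M_conv mu (L1_to_M q) f = mu (to_C0 (rconv m f q)).
Proof.
move=> bmu.
have Fc : forall y (e : R), 0 < e -> \forall y' \near y,
    C0_sup (to_C0 (rtrans f y') - to_C0 (rtrans f y)) <= e.
  by move=> y e e0; exact: rtrans_cont.
have := bfun_vint hausG lcG haar_m Fc (rtrans_bd f) (L1_int q) bmu.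
rewrite -rconv_vint => ->.
rewrite /M_conv /L1_to_M; apply: eq_Cintegral => y; congr (_ * _).
exact: (congr1 (fun h => h (y : G)) (to_C0E (bfun_rtrans_C0 hausG lcG f bmu))).
Qed.

Definition units_filter : set_system (L1 m) :=
  filter_from (nbhs (1%g : G)) (fun V => [set E | unit_in V E]).

Lemma units_filter_proper : ProperFilter units_filter.
Proof.
apply: filter_from_proper; last by move=> V /(unit_in_ex hausG lcG haar_m).
apply: filter_from_filter; first by exists setT; exact: filterT.
move=> V V' nV nV'; exists (V `&` V'); first exact: filterI.
by move=> E VE; split; apply: unit_in_sub VE => x [].
Qed.

Lemma near_units (P : L1 m -> Prop) :
  (\forall V \near powerset_filter_from (nbhs (1%g : G)),
    forall E, unit_in V E -> P E) ->
  \forall E \near units_filter, P E.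
Proof.
move=> nP; have [V [nV VP]] := filter_ex (filterI (near_small_set _) nP).
by exists V.
Qed.

Lemma units_left phi e : 0 < e ->
  \forall E \near units_filter, L1_rnorm (L1_conv E phi - phi) <= e.
Proof. by move=> e0; apply/near_units/left_unit. Qed.

Lemma units_right phi e : 0 < e ->
  \forall E \near units_filter, L1_rnorm (L1_conv phi E - phi) <= e.
Proof. by move=> e0; apply/near_units/right_unit. Qed.

Lemma units_norm : \forall E \near units_filter, L1_rnorm E = 1.
Proof.
exists setT; first exact: filterT.
by move=> E; exact: (unit_in_norm hausG haar_m).
Qed.

End multiplier.

Lemma continuous_linear_L1_bounded (G : topologicalGroupType) (R : realType)
  (m : {measure set (borel G) -> \bar R}) (alpha : {linear L1 m -> L1 m}) :
  continuous alpha -> exists2 a : R, 0 <= a & forall phi, L1_rnorm (alpha phi) <= a * L1_rnorm phi.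
Proof.
move=> ac; have := (linear_bounded_continuous alpha).2 ac.
move=> /linear_boundedP ab.
have r0 : (0 : R[i]) \is Num.real by exact: real0.
have [r [/= ra rp]] := filter_ex (filterI ab (nbhs_pinfty_gt r0)).
(* The bound [r] for [alpha] is an element of [R[i]]; being positive, it is real. *)
exists (complex.Re r); first by move: rp; rewrite ltcE/= => /andP[_ /ltW].
have rE : r = (complex.Re r)%:C%C.
  by move: rp; rewrite ltcE/= => /andP[/eqP i0 _]; rewrite -[LHS]complexEta i0.
move=> phi; have := ra phi.
by rewrite rE !L1_normE -[leRHS](rmorphM (real_complex R)) lecR.
Qed.

(** * Jordan centralizers *)

Section jordan_centralizer.
Context (R : realType) (G : topologicalGroupType).
Hypothesis hausG : hausdorff_space G.
Hypothesis lcG : locally_compact [set: G].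
Variable m : {measure set (borel G) -> \bar R}.
Hypothesis haar_m : left_haar m.
Local Notation C := (R[i]^o).
Variables (alpha : {linear L1 m -> L1 m}) (T : {additive L1 m -> L1 m}).
Hypothesis alpha_mul : forall phi psi : L1 m,
  alpha (L1_conv phi psi) = L1_conv (alpha phi) (alpha psi).
Hypothesis T_jordan : jordan_left_centralizer alpha T.
Variables (a c : R).
Hypotheses (a0 : 0 <= a) (c0 : 0 <= c).
Hypothesis alpha_bounded : forall phi, L1_rnorm (alpha phi) <= a * L1_rnorm phi.
Hypothesis T_bounded : forall phi, L1_rnorm (T phi) <= c * L1_rnorm phi.
Variable U : set_system (L1 m).
Hypothesis UU : UltraFilter U.
Hypothesis unitsU : units_filter (m := m) `<=` U.
Implicit Types phi psi : L1 m.
Local Notation rc f q := (to_C0 (rconv m f (q : L1 m))).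

Let UF : Filter U. Proof. by have [] := UU; case. Qed.

Let near_U (P : L1 m -> Prop) :
  (\forall E \near units_filter (m := m), P E) -> \forall E \near U, P E.
Proof. by move=> nP; exact: (unitsU nP). Qed.

Lemma jordan_polarization phi psi :
  T (L1_conv phi psi + L1_conv psi phi) =
  L1_conv (T phi) (alpha psi) + L1_conv (T psi) (alpha phi).
Proof.
have DL := L1_convDl hausG lcG haar_m; have DR := L1_convDr hausG lcG haar_m.
have := T_jordan (phi + psi).
rewrite DL !DR !raddfD DL !DR /= (T_jordan phi) (T_jordan psi).
by rewrite -!addrA => /addrI; rewrite !addrA => /addIr.
Qed.

Lemma cvg_le_eps (z : L1 m -> C) (l : C) (K : R) :
  (forall e, 0 < e -> \forall E \near U, normc (l - z E) <= K * e) -> z @ U --> l.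
Proof.
move=> h; apply/cvg_normcP => e e0.
have K1 : 0 < `|K| + 1 by rewrite ltr_wpDl.
apply: filterS (h _ (divr_gt0 e0 K1)) => E /le_lt_trans; apply.
apply: (@le_lt_trans _ _ (`|K| * (e / (`|K| + 1)))).
  by rewrite ler_wpM2r ?ler_norm// ltW// divr_gt0.
by rewrite mulrCA gtr_pMr// ltr_pdivrMr// mul1r ltrDl.
Qed.

Lemma T_units_cvg phi (g : C0 G R) :
  L1_to_M (T (L1_conv phi E + L1_conv E phi)) g @[E --> U] -->
  L1_to_M (T phi) g + L1_to_M (T phi) g.
Proof.
apply: (@cvg_le_eps _ _ (c * 2 * C0_sup g)) => e e0.
apply: filterS2 (near_U (units_left hausG lcG haar_m phi e0))
  (near_U (units_right hausG lcG haar_m phi e0)) => E hl hr.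
rewrite normcB -L1_to_MD -L1_to_MB.
have -> : T (L1_conv phi E + L1_conv E phi) - (T phi + T phi) =
    T ((L1_conv phi E - phi) + (L1_conv E phi - phi)).
  by rewrite -!raddfD -raddfB opprD addrACA.
apply: le_trans (L1_to_M_le _ _) _.
rewrite mulrAC ler_wpM2r ?C0_sup_ge0//; apply: le_trans (T_bounded _) _.
rewrite -mulrA ler_wpM2l//; apply: le_trans (L1_rnormD _ _) _.
have -> : 2 * e = e + e by rewrite mulr_natl mulr2n.
exact: lerD hr hl.
Qed.

(** The family [w] is left free because the limit is needed for units on the left, with [L] given by
    T(phi), and for units on the right, with [L] the weak limit. *)
Lemma rconv_units_cvg (L : C0 G R -> C) (M : R) (f : C0 G R)
    (w : L1 m -> L1 m) phi : bounded_functional L M ->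
  (forall e, 0 < e -> \forall E \near U, L1_rnorm (w E - phi) <= e) ->
  L (rc f (alpha (w E))) @[E --> U] --> L (rc f (alpha phi)).
Proof.
move=> bL hw; have [M0 _ LM] := bL.
apply: (@cvg_le_eps _ _ (M * (C0_sup f * a))) => e e0.
apply: filterS (hw e e0) => E hE.
rewrite normcB -(bfunB _ _ bL) (rconv_C0B hausG lcG haar_m) -raddfB.
apply: le_trans (LM _) _; rewrite -mulrA ler_wpM2l//.
apply: le_trans (rconv_sup hausG lcG haar_m _ _) _.
rewrite -mulrA ler_wpM2l ?C0_sup_ge0//; apply: le_trans (alpha_bounded _) _.
by rewrite ler_wpM2l.
Qed.

Lemma cvgD_complex (u v : L1 m -> C) (x y : C) : u @ U --> x -> v @ U --> y ->
  u E + v E @[E --> U] --> x + y.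
Proof. by move=> ux vy; have := cvgD ux vy; apply. Qed.

Lemma cvg_unique_complex (u : L1 m -> C) (x y : C) : u @ U --> x -> u @ U --> y -> x = y.
Proof. exact: (cvg_unique (@norm_hausdorff _ C)). Qed.

Section weak_limit.
Variable mu : C0 G R -> C.
Hypothesis mu_bfun : bounded_functional mu c.
Hypothesis mu_lim : forall f, L1_to_M (T E) f @[E --> U] --> mu f.

Lemma T_conv_alpha phi psi (f : C0 G R) :
  L1_to_M (L1_conv (T phi) (alpha psi)) f =
  mu (rc f (alpha (L1_conv phi psi))).
Proof.
(* Testing at [g] amounts to multiplying on the right by alpha(psi) before testing at [f]. *)
pose g := rc f (alpha psi).
have c1 := @T_units_cvg phi g.
have c2 : L1_to_M (T (L1_conv phi E + L1_conv E phi)) g @[E --> U] -->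
    L1_to_M (T phi) g + mu (rc f (alpha (L1_conv phi psi))).
  have e1 E : L1_to_M (T (L1_conv phi E + L1_conv E phi)) g =
      L1_to_M (T phi) (rc f (alpha (L1_conv E psi))) +
      L1_to_M (T E) (rc f (alpha (L1_conv phi psi))).
    by rewrite jordan_polarization L1_to_MD !(L1_to_M_conv2 hausG lcG haar_m) !alpha_mul.
  under eq_fun do rewrite e1.
  apply: cvgD_complex; last exact: mu_lim.
  have hw e : 0 < e -> \forall E \near U, L1_rnorm (L1_conv E psi - psi) <= e.
    by move=> e0; apply: near_U; exact: units_left.
  exact: (@rconv_units_cvg _ _ f (fun E => L1_conv E psi) psi (L1_bfun (T phi)) hw).
have /addrI <- := cvg_unique_complex c1 c2.
by rewrite (L1_to_M_conv hausG lcG haar_m).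
Qed.

Lemma T_weak_limit phi (f : C0 G R) :
  L1_to_M (T phi) f = mu (rc f (alpha phi)).
Proof.
have c1 := @T_units_cvg phi f.
set z := mu _.
have c2 : L1_to_M (T (L1_conv phi E + L1_conv E phi)) f @[E --> U] --> z + z.
  have e1 E : L1_to_M (T (L1_conv phi E + L1_conv E phi)) f =
      mu (rc f (alpha (L1_conv phi E))) +
      L1_to_M (T E) (rc f (alpha phi)).
    by rewrite jordan_polarization L1_to_MD T_conv_alpha (L1_to_M_conv hausG lcG haar_m).
  under eq_fun do rewrite e1.
  apply: cvgD_complex; last exact: mu_lim.
  have hw e : 0 < e -> \forall E \near U, L1_rnorm (L1_conv phi E - phi) <= e.
    by move=> e0; apply: near_U; exact: units_right.
  exact: (@rconv_units_cvg _ _ f (fun E => L1_conv phi E) phi mu_bfun hw).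
have := cvg_unique_complex c1 c2; rewrite -!mulr2n => /eqP.
by rewrite -subr_eq0 -mulrnBl mulrn_eq0/= subr_eq0 => /eqP.
Qed.

End weak_limit.

(** Uniqueness of limits along [U] makes [mu] linear, and it inherits the bound [c] of [T] because
    units have norm 1. *)
Lemma weak_limit_exists : exists mu : C0 G R -> C, bounded_functional mu c /\
  forall f, L1_to_M (T E) f @[E --> U] --> mu f.
Proof.
have bnd f : \forall E \near U, normc (L1_to_M (T E) f) <= c * C0_sup f.
  apply: filterS (near_U (units_norm hausG haar_m)) => E nE.
  apply: le_trans (L1_to_M_le _ _) _; rewrite ler_wpM2r ?C0_sup_ge0//.
  by have := T_bounded E; rewrite nE mulr1.
have /boolp.choice[mu mu_lim] : forall f : C0 G R, exists l : C,
    L1_to_M (T E) f @[E --> U] --> l.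
  by move=> f; exact: (ultra_bounded_cvgC UU (bnd f)).
exists mu; split => //; split => //.
- move=> b f g; apply: (cvg_unique_complex (mu_lim (b *: f + g))).
  have e1 E : L1_to_M (T E) (b *: f + g) = b * L1_to_M (T E) f + L1_to_M (T E) g.
    by have [_ + _] := L1_bfun (T E); apply.
  under eq_fun do rewrite e1.
  have cb : ((fun=> b) : L1 m -> C) @ U --> (b : C) by exact: cvg_cst.
  have cbm : b * L1_to_M (T E) f @[E --> U] --> b * mu f.
    by have := cvgM cb (mu_lim f); apply.
  exact: (cvgD_complex cbm (mu_lim g)).
- move=> f; have cn : normc (L1_to_M (T E) f) @[E --> U] --> normc (mu f).
    exact: (continuous_cvg _ (@normc_continuous R (mu f)) (mu_lim f)).
  exact: (cvgr_to_le cn (bnd f)).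
Qed.

End jordan_centralizer.

Theorem theorem3p1 (R : realType) (G : topologicalGroupType)
  (hausG : hausdorff_space G) (lcG : locally_compact [set: G])
  (m : {measure set (borel G) -> \bar R}) (haar_m : left_haar m)
  (alpha : {linear L1 m -> L1 m})
  (alpha_mul : forall phi psi : L1 m,
    alpha (L1_conv phi psi) = L1_conv (alpha phi) (alpha psi))
  (alpha_cont : continuous alpha)
  (T : {additive L1 m -> L1 m})
  (T_jordan : jordan_left_centralizer alpha T)
  (T_bounded : exists2 c : R, 0 <= c &
    forall phi : L1 m, `|T phi| <= c%:C%C * `|phi|) :
  exists mu : measure_algebra G R, forall phi : L1 m,
    L1_to_M (T phi) = M_conv mu (L1_to_M (alpha phi)).
Proof.
have [a a0 alpha_bounded] := continuous_linear_L1_bounded alpha_cont.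
have [c c0 Tc] := T_bounded.
have {}Tc phi : L1_rnorm (T phi) <= c * L1_rnorm phi.
  by have := Tc phi; rewrite !L1_normE -[leRHS](rmorphM (real_complex R)) lecR.
have [U [UU unitsU]] := ultraFilterLemma (units_filter_proper hausG lcG haar_m).
have [mu0 [bmu mu_lim]] := weak_limit_exists hausG haar_m c0 Tc UU unitsU.
have [mu muE] := bfun_measure bmu.
exists mu => phi; apply/funext => f.
have bmu' : bounded_functional mu c by rewrite (_ : measure_fun mu = mu0 :> (_ -> _))//; apply/funext.
rewrite (M_conv_rconv hausG lcG haar_m _ _ bmu') muE.
exact: (T_weak_limit hausG lcG haar_m alpha_mul T_jordan a0 c0 alpha_bounded Tc UU
  unitsU bmu mu_lim).
Qed.
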